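(* Let $f\in L^2(\mathbb R)$ and let $\psi\in L^2(\mathbb R)$ be admissible. If $\mathcal A^{\psi}_{\Lambda_S}[f](t,\zeta)$ is the novel special affine wavelet transform of $f$, then $f$ can be reconstructed as $$f(x)=\frac1{C_\psi}\int_{\mathbb R\times\mathbb R^+}\mathcal A^{\psi}_{\Lambda_S}[f](t,\zeta)\,\psi^{\Lambda_S}_{t,\zeta}(x)\,\frac{dt\,d\zeta}{\zeta^2},\quad\text{a.e.}$$
   Context: Fix real parameters $A,B,C,D,p,q$ with $AD-BC=1$ and $B\neq0$ (collected in $\Lambda_S$). $z^*$ denotes the complex conjugate of $z$, and $\mathbb R^+=(0,\infty)$. Put $K_B=\frac1{\sqrt{2\pi B}}$ and $$\mathcal K_{\Lambda_S}(x,\omega)=K_B^*\exp\left\{\frac{i}{2B}\big(Ax^2+2x(p-\omega)-2\omega(Dp-Bq)+D\omega^2\big)\right\}.$$ The special affine Fourier transform (SAFT) of $f$ is $\widehat f_{\Lambda_S}(\omega)=\int_{\mathbb R}f(x)\,\mathcal K_{\Lambda_S}(x,\omega)\,dx$; it satisfies the Parseval formula $\langle f,g\rangle=\langle\widehat f_{\Lambda_S},\widehat g_{\Lambda_S}\rangle$ for $f,g\in L^2(\mathbb R)$, where $\langle f,g\rangle=\int_{\mathbb R}fg^*\,dx$. For $\psi\in L^2(\mathbb R)$, $t\in\mathbb R$, $\zeta\in\mathbb R^+$, put $$\psi^{\Lambda_S}_{t,\zeta}(x)=\frac{K_B}{\sqrt\zeta}\,\psi\left(\frac{x-t}{\zeta}\right)\exp\left\{\frac{iAx(t-x)}{B}\right\}.$$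 The novel special affine wavelet transform of $f\in L^2(\mathbb R)$ is $\mathcal A^{\psi}_{\Lambda_S}[f](t,\zeta)=\int_{\mathbb R}f(x)\,\big(\psi^{\Lambda_S}_{t,\zeta}(x)\big)^*dx$. Let $\Psi(x,\zeta)=\exp\left\{\frac{i}{2B}\big(Ax^2(\zeta^2-1)+2xp(\zeta-1)\big)\right\}\psi^*(-x)$ and let $\widehat\Psi_{\Lambda_S}(\zeta\omega,\zeta)$ denote the SAFT of $x\mapsto\Psi(x,\zeta)$ evaluated at $\zeta\omega$. The function $\psi\in L^2(\mathbb R)$ is said to be admissible if $$C_\psi=\int_{\mathbb R^+}\frac{\big|\widehat\Psi_{\Lambda_S}(\zeta\omega,\zeta)\big|^2}{\zeta}\,d\zeta<\infty\quad\text{for a.e. }\omega\in\mathbb R.$$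
   Formalization: C_ψ, which may vary with ω, is assumed equal a.e. to one nonzero constant (otherwise the formula fails); the double integral is the L² limit of integrals over ζ>e as e→0+, with the pointwise formula a.e. where the integral converges absolutely. *)

(* Defs.v *)
From HB Require Import structures.
From mathcomp Require Import all_boot all_order all_algebra.
From mathcomp Require Import all_classical all_reals all_analysis.
From mathcomp Require Export complex.

Set Implicit Arguments.
Unset Strict Implicit.
Unset Printing Implicit Defensive.

Import Order.TTheory GRing.Theory Num.Theory.
Import numFieldNormedType.Exports.

Local Open Scope classical_set_scope.
Local Open Scope ring_scope.
Local Open Scope complex_scope.

Section complex_integration.
Context {d : measure_display} {T : measurableType d} {R : realType}.
Implicit Types (mu : {measure set T -> \bar R}) (D : set T) (f : T -> R[i]).

Definition cmeasurable D f : Prop :=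
  measurable_fun D (fun x => complex.Re (f x)) /\
  measurable_fun D (fun x => complex.Im (f x)).

Definition cintegrable mu D f : Prop :=
  mu.-integrable D (fun x => (complex.Re (f x))%:E) /\
  mu.-integrable D (fun x => (complex.Im (f x))%:E).

(* Absolutely convergent Lebesgue integral; only meaningful when
   [cintegrable mu D f] holds. *)
Definition cintegral mu D f : R[i] :=
  Rintegral mu D (fun x => complex.Re (f x)) +i*
  Rintegral mu D (fun x => complex.Im (f x)).

End complex_integration.

Section L2.
Context {R : realType}.
Local Notation mu := (@lebesgue_measure R).

Definition sqnorm2 (f : R -> R[i]) : \bar R :=
  (\int[mu]_x ((Normc.normc (f x)) ^+ 2)%:E)%E.

Definition L2 (f : R -> R[i]) : Prop :=
  cmeasurable setT f /\ (sqnorm2 f < +oo)%E.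

Definition expi (theta : R) : R[i] := cos theta +i* sin theta.

End L2.

Section saft.
Context {R : realType}.
Local Notation mu := (@lebesgue_measure R).

(* Principal square root: [sqrtc] of a negative real r is i * sqrt |r|. *)
Definition KB (B : R) : R[i] := (sqrtc (2 * pi * B)%:C)^-1.

Definition saft_kernel (A B D p q x w : R) : R[i] :=
  (KB B)^* *
  expi ((A * x ^+ 2 + 2 * x * (p - w) - 2 * w * (D * p - B * q)
         + D * w ^+ 2) / (2 * B)).

(* A square-integrable h need not be integrable, so the integral defining its
   SAFT is, as for the Fourier-Plancherel transform, the limit in L^2 of the
   integrals over [-n, n].  It agrees a.e. with the integral of h times the
   kernel over the line when h is also integrable. *)
Definition is_saft (A B D p q : R) (h H : R -> R[i]) : Prop :=
  L2 H /\
  (fun n : nat => sqnorm2 (fun w =>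
     H w - cintegral mu `[- n%:R, n%:R]
             (fun x => h x * saft_kernel A B D p q x w))) @ \oo --> 0%E.

Definition wavelet (A B : R) (psi : R -> R[i]) (t zeta x : R) : R[i] :=
  KB B / (Num.sqrt zeta)%:C * psi ((x - t) / zeta)
  * expi (A * x * (t - x) / B).

Definition sawt (A B : R) (psi f : R -> R[i]) (t zeta : R) : R[i] :=
  cintegral mu setT (fun x => f x * (wavelet A B psi t zeta x)^*).

Definition bigpsi (A B p : R) (psi : R -> R[i]) (x zeta : R) : R[i] :=
  expi ((A * x ^+ 2 * (zeta ^+ 2 - 1) + 2 * x * p * (zeta - 1)) / (2 * B))
  * (psi (- x))^*.

(* [Psihat w zeta] is the SAFT of x |-> bigpsi x zeta at w.  For fixed zeta it
   is determined up to a null set of w; joint measurability makes the integrals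
   over zeta below independent of the chosen version, for a.e. w. *)
Definition is_bigpsi_saft (A B D p q : R) (psi : R -> R[i])
    (Psihat : R -> R -> R[i]) : Prop :=
  cmeasurable [set: R * R] (fun z => Psihat z.1 z.2) /\
  forall zeta : R, 0 < zeta ->
    is_saft A B D p q (fun x => bigpsi A B p psi x zeta)
                      (fun w => Psihat w zeta).

Definition Cpsi (Psihat : R -> R -> R[i]) (w : R) : \bar R :=
  (\int[mu]_(zeta in `]0%R, +oo[)
     ((Normc.normc (Psihat (zeta * w) zeta)) ^+ 2 / zeta)%:E)%E.

Definition admissible (Psihat : R -> R -> R[i]) : Prop :=
  {ae mu, forall w, (Cpsi Psihat w < +oo)%E}.

End saft.

Section reconstruction.
Context {R : realType}.
Local Notation mu := (@lebesgue_measure R).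
Local Notation mu2 := (mu \x mu)%E.

Definition strip (e : R) : set (R * R) := [set: R] `*` `]e, +oo[.

(* z = (t, zeta); the factor zeta^-2 is the density of dt dzeta / zeta^2. *)
Definition synthesis (A B : R) (psi f : R -> R[i]) (x : R) (z : R * R) : R[i] :=
  sawt A B psi f z.1 z.2 * wavelet A B psi z.1 z.2 x
  * ((z.2 ^+ 2)^-1)%:C.

(* I is the integral of the family F x (t, zeta) over R x R^+, as an element
   of L^2 in x: the integrals over zeta > e converge absolutely for every x,
   and tend to I in L^2 as e -> 0+.  (For general square-integrable f the
   inversion integrand is not absolutely integrable near zeta = 0.) *)
Definition is_L2_integral (F : R -> R * R -> R[i]) (I : R -> R[i]) : Prop :=
  [/\ L2 I,
      forall e : R, 0 < e ->
        (forall x, cintegrable mu2 (strip e) (F x)) /\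
        L2 (fun x => cintegral mu2 (strip e) (F x))
    & (fun e : R => sqnorm2 (fun x => I x - cintegral mu2 (strip e) (F x)))
        @ 0^'+ --> 0%E].

End reconstruction.

(* Main.v *)
(* Put h x = f x * exp (i A x^2 / 2B).  Up to a unimodular factor, the transform
   of f at scale zeta is the correlation of h with the chirped and dilated
   window psi (y / zeta) * exp (- i A y^2 / 2B), and the modulus of the Fourier
   transform of that window is, up to scaling, that of the SAFT of
   x |-> bigpsi x zeta at zeta * (B v + p).  Plancherel's formula in t at each
   fixed zeta, followed by integration over zeta, therefore produces C_psi and
   yields the Parseval formula
     \iint |W f (t, zeta)|^2 dt dzeta / zeta^2 = c * ||f||^2.
   By polarization and Fubini, c <f, g> - <S_e f, g>, where S_e f is the
   synthesis integral over zeta > e, is an integral over zeta <= e; taking for g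
   the truncations of c f - S_e f bounds ||c f - S_e f||^2 by c times the energy
   of W f below scale e, which tends to 0.  When the integral over the whole
   half-plane converges absolutely, Fatou's lemma identifies it with c f.

   Plancherel's formula is proved with Abel means, for bounded continuous
   integrable functions, and extended by density. *)

Require Import Defs.
From HB Require Import structures.
From mathcomp Require Import all_boot all_order all_algebra.
From mathcomp Require Import all_classical all_reals all_analysis.
From mathcomp Require Import complex.
From mathcomp Require Import measurable_realfun ring lra.

Set Implicit Arguments.
Unset Strict Implicit.
Unset Printing Implicit Defensive.

Import Order.TTheory GRing.Theory Num.Theory.
Import numFieldNormedType.Exports.

Local Open Scope classical_set_scope.
Local Open Scope ring_scope.
Local Open Scope complex_scope.

(** Two limits have to be taken separately. A window built from [psi] is only square integrable, so
    its Fourier integral need not exist. The identity at a fixed scale is therefore proved first for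
    truncated windows and for a signal that is bounded, integrable and continuous: the Fourier
    transform of its chirp is then bounded, and multiplication by it preserves L^2 convergence. Only
    after integration over scales is the signal made general. Both passages rest on
    [isometry_limit], where one side converges in L^2 and the other merely pointwise.

    In the reconstruction the obstacle is that the synthesis integral over [zeta > e] is at first
    known only to be bounded in [x], not square integrable, so the residual cannot be paired with
    itself. Cut to [-n, n] it becomes an admissible test function, integrable and square integrable;
    the resulting bound does not depend on n, and square integrability of the synthesis integral is
    a consequence. *)

Notation normc := Normc.normc.

(* [^*] would denote [Num.conj] or [conjc] depending on the ambient scope. *)
Notation "z ^J" := (conjc z) (at level 1, format "z ^J").

Lemma conjCE (R : realType) (z : R[i]) : Num.conj z = z^J.
Proof. by []. Qed.

(** * Complex-valued measurable functions and integrals *)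

Section complex_algebra.
Context {R : realType}.
Implicit Types z u v : R[i].

Lemma sqr_normc z : normc z ^+ 2 = complex.Re z ^+ 2 + complex.Im z ^+ 2.
Proof. by case: z => a b /=; rewrite sqr_sqrtr// addr_ge0// sqr_ge0. Qed.

Lemma normc_ge0 z : 0 <= normc z.
Proof. by case: z => a b /=; exact: sqrtr_ge0. Qed.

Lemma normr_Re_le z : `|complex.Re z| <= normc z.
Proof.
rewrite -(@ler_pXn2r _ 2) ?nnegrE ?normc_ge0// real_normK ?num_real//.
by rewrite sqr_normc lerDl sqr_ge0.
Qed.

Lemma normr_Im_le z : `|complex.Im z| <= normc z.
Proof.
rewrite -(@ler_pXn2r _ 2) ?nnegrE ?normc_ge0// real_normK ?num_real//.
by rewrite sqr_normc lerDr sqr_ge0.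
Qed.

Lemma normc_le_ReIm z : normc z <= `|complex.Re z| + `|complex.Im z|.
Proof.
rewrite -(@ler_pXn2r _ 2) ?nnegrE ?normc_ge0 ?addr_ge0// sqr_normc sqrrD.
by rewrite !real_normK ?num_real// [leRHS]addrAC lerDl mulrn_wge0 ?mulr_ge0.
Qed.

Lemma normc_conj z : normc z^J = normc z.
Proof. by case: z => a b /=; rewrite sqrrN. Qed.

Lemma normc_real (x : R) : normc x%:C = `|x|.
Proof. by rewrite /= expr0n/= addr0 sqrtr_sqr. Qed.

Lemma normc_mul z u : normc (z * u) = normc z * normc u.
Proof. exact: Normc.normcM. Qed.

Lemma normc_distC u v : normc (u - v) = normc (v - u).
Proof. by rewrite -opprB normcN. Qed.

Lemma mulcJ z : z * z^J = (normc z ^+ 2)%:C.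
Proof.
rewrite sqr_normc; case: z => a b /=; apply/eqP; rewrite eq_complex /=.
by apply/andP; split; apply/eqP; ring.
Qed.

Lemma normc_expi (t : R) : normc (expi t) = 1.
Proof. by rewrite /= cos2Dsin2 sqrtr1. Qed.

Lemma expiD (a b : R) : expi (a + b) = expi a * expi b.
Proof.
apply/eqP; rewrite eq_complex /= cosD sinD.
by apply/andP; split; apply/eqP; ring.
Qed.

Lemma expiN (a : R) : expi (- a) = (expi a)^J.
Proof. by rewrite /expi cosN sinN. Qed.

Lemma sqr_normcD u v : normc (u + v) ^+ 2 =
  normc u ^+ 2 + normc v ^+ 2 + 2 * complex.Re (u * v^J).
Proof. by rewrite !sqr_normc; case: u v => a b [c d] /=; ring. Qed.

End complex_algebra.

Section cmeasurable.
Context {d : measure_display} {T : measurableType d} {R : realType}.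
Implicit Types (D : set T) (f g : T -> R[i]).

Lemma cmeasurable_cst D (z : R[i]) : cmeasurable D (fun=> z).
Proof. by split; exact: measurable_cst. Qed.

Lemma cmeasurable_real D (g : T -> R) : measurable_fun D g ->
  cmeasurable D (fun x => (g x)%:C).
Proof. by move=> mg; split => //=; exact: measurable_cst. Qed.

Lemma cmeasurableD D f g : cmeasurable D f -> cmeasurable D g ->
  cmeasurable D (fun x => f x + g x).
Proof.
move=> [f1 f2] [g1 g2]; split.
  by under eq_fun do rewrite raddfD; exact: measurable_funD.
by under eq_fun do rewrite raddfD; exact: measurable_funD.
Qed.

Lemma cmeasurableM D f g : cmeasurable D f -> cmeasurable D g ->
  cmeasurable D (fun x => f x * g x).
Proof.
move=> [f1 f2] [g1 g2]; split.
  rewrite (_ : (fun _ => _) = (fun x =>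
    complex.Re (f x) * complex.Re (g x) - complex.Im (f x) * complex.Im (g x))).
    by apply: measurable_funB; apply: measurable_funM.
  by apply/funext => x; case: (f x) (g x) => a b [c e].
rewrite (_ : (fun _ => _) = (fun x =>
  complex.Re (f x) * complex.Im (g x) + complex.Im (f x) * complex.Re (g x))).
  by apply: measurable_funD; apply: measurable_funM.
by apply/funext => x; case: (f x) (g x) => a b [c e].
Qed.

Lemma cmeasurableZ D (z : R[i]) f : cmeasurable D f ->
  cmeasurable D (fun x => z * f x).
Proof. by move=> mf; apply: cmeasurableM => //; exact: cmeasurable_cst. Qed.

Lemma cmeasurableN D f : cmeasurable D f -> cmeasurable D (fun x => - f x).
Proof.
by move=> mf; under eq_fun do rewrite -mulN1r; exact: cmeasurableZ.
Qed.

Lemma cmeasurableB D f g : cmeasurable D f -> cmeasurable D g ->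
  cmeasurable D (fun x => f x - g x).
Proof. by move=> mf mg; apply: cmeasurableD => //; exact: cmeasurableN. Qed.

Lemma ReJ (z : R[i]) : complex.Re z^J = complex.Re z. Proof. by case: z. Qed.
Lemma ImJ (z : R[i]) : complex.Im z^J = - complex.Im z. Proof. by case: z. Qed.

Lemma cmeasurableJ D f : cmeasurable D f -> cmeasurable D (fun x => (f x)^J).
Proof.
move=> [f1 f2]; split; first by under eq_fun do rewrite ReJ.
by under eq_fun do rewrite ImJ; exact: measurable_funN.
Qed.

Lemma cmeasurableS D E f : measurable E -> D `<=` E ->
  cmeasurable E f -> cmeasurable D f.
Proof. by move=> mE DE [f1 f2]; split; apply: measurable_funS mE DE _. Qed.

Lemma cmeasurableTS D f : cmeasurable setT f -> cmeasurable D f.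
Proof. exact: cmeasurableS. Qed.

Lemma measurable_normc_sqr D f : cmeasurable D f ->
  measurable_fun D (fun x => normc (f x) ^+ 2).
Proof.
move=> [f1 f2]; under eq_fun do rewrite sqr_normc.
by apply: measurable_funD; apply: measurable_funX.
Qed.

Lemma measurable_normc D f : cmeasurable D f ->
  measurable_fun D (fun x => normc (f x)).
Proof.
move=> /measurable_normc_sqr mf.
under eq_fun do rewrite -[normc _]ger0_norm ?normc_ge0// -sqrtr_sqr.
by apply: measurableT_comp mf; apply: continuous_measurable_fun;
  exact: sqrt_continuous.
Qed.

Lemma cmeasurable_expi D (g : T -> R) : measurable_fun D g ->
  cmeasurable D (fun x => expi (g x)).
Proof.
move=> mg; split => /=; apply: measurableT_comp => //;
  apply: continuous_measurable_fun.
  exact: continuous_cos.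
exact: continuous_sin.
Qed.

End cmeasurable.

Lemma cmeasurableT_comp d1 d2 (T1 : measurableType d1) (T2 : measurableType d2)
  (R : realType) (D : set T1) (f : T2 -> R[i]) (g : T1 -> T2) :
  cmeasurable setT f -> measurable_fun D g -> cmeasurable D (fun x => f (g x)).
Proof.
move=> [f1 f2] mg; split.
  exact: (measurableT_comp f1 mg).
exact: (measurableT_comp f2 mg).
Qed.

Section cintegral.
Context {d : measure_display} {T : measurableType d} {R : realType}.
Implicit Types (mu : {measure set T -> \bar R}) (D : set T) (f g : T -> R[i]).

Lemma cintegrable_measurable mu D f : cintegrable mu D f -> cmeasurable D f.
Proof.
by move=> [/measurable_int/measurable_EFinP m1 /measurable_int/measurable_EFinP].
Qed.

Lemma le_cintegrable mu D f (g : T -> R) : measurable D -> cmeasurable D f ->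
  (forall x, D x -> normc (f x) <= g x) ->
  mu.-integrable D (EFin \o g) -> cintegrable mu D f.
Proof.
move=> mD [m1 m2] fg ig; split; apply: le_integrable ig => //.
- exact/measurable_EFinP.
- move=> x Dx /=; rewrite lee_fin (le_trans (normr_Re_le _))//.
  by rewrite (le_trans (fg _ Dx))// ler_norm.
- exact/measurable_EFinP.
- move=> x Dx /=; rewrite lee_fin (le_trans (normr_Im_le _))//.
  by rewrite (le_trans (fg _ Dx))// ler_norm.
Qed.

Lemma cintegrable_normc mu D f : measurable D -> cintegrable mu D f ->
  mu.-integrable D (fun x => (normc (f x))%:E).
Proof.
move=> mD fi; have mf := cintegrable_measurable fi; case: fi => i1 i2.
apply: (@le_integrable _ _ _ _ _ mD _
    (fun x => (`|complex.Re (f x)|%:E + `|complex.Im (f x)|%:E)%E)).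
- exact/measurable_EFinP/measurable_normc.
- move=> x Dx; rewrite -EFinD/= lee_fin.
  by rewrite ger0_norm ?normc_ge0// (le_trans (normc_le_ReIm _))// ler_norm.
- apply: integrableD => //.
    exact: (integrable_norm i1).
  exact: (integrable_norm i2).
Qed.

Lemma cintegrableP mu D f : measurable D ->
  cintegrable mu D f <->
  cmeasurable D f /\ (\int[mu]_(x in D) (normc (f x))%:E < +oo)%E.
Proof.
move=> mD; split.
  move=> fi; split; first exact: cintegrable_measurable fi.
  exact: integrable_lty (cintegrable_normc mD fi).
move=> [mf fi]; apply: (@le_cintegrable _ _ _ (fun x => normc (f x))) => //.
apply/integrableP; split; first exact/measurable_EFinP/measurable_normc.
under eq_integral do rewrite /= ger0_norm ?normc_ge0//.
exact: fi.
Qed.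

Lemma eq_cintegral mu D f g : {in D, f =1 g} ->
  cintegral mu D f = cintegral mu D g.
Proof.
by move=> fg; rewrite /cintegral; congr (_ +i* _); apply: eq_Rintegral => x /fg ->.
Qed.

Lemma cintegrableD mu D f g : measurable D ->
  cintegrable mu D f -> cintegrable mu D g ->
  cintegrable mu D (fun x => f x + g x).
Proof.
move=> mD [f1 f2] [g1 g2]; split.
  by under eq_fun do rewrite raddfD EFinD; exact: integrableD.
by under eq_fun do rewrite raddfD EFinD; exact: integrableD.
Qed.

Lemma Re_mulc (u v : R[i]) : complex.Re (u * v) =
  complex.Re u * complex.Re v - complex.Im u * complex.Im v.
Proof. by case: u v => a b [c e]. Qed.

Lemma Im_mulc (u v : R[i]) : complex.Im (u * v) =
  complex.Re u * complex.Im v + complex.Im u * complex.Re v.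
Proof. by case: u v => a b [c e]. Qed.

Lemma cintegrableZ mu D (z : R[i]) f : measurable D ->
  cintegrable mu D f -> cintegrable mu D (fun x => z * f x).
Proof.
move=> mD [f1 f2]; split.
  under eq_fun do rewrite Re_mulc EFinB EFinM [in X in (_ - X)%E]EFinM.
  by apply: integrableB => //; exact: integrableZl.
under eq_fun do rewrite Im_mulc EFinD EFinM [in X in (_ + X)%E]EFinM.
by apply: integrableD => //; exact: integrableZl.
Qed.

Lemma cintegrableN mu D f : measurable D ->
  cintegrable mu D f -> cintegrable mu D (fun x => - f x).
Proof. by move=> mD fi; under eq_fun do rewrite -mulN1r; exact: cintegrableZ. Qed.

Lemma cintegrableB mu D f g : measurable D ->
  cintegrable mu D f -> cintegrable mu D g ->
  cintegrable mu D (fun x => f x - g x).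
Proof. by move=> mD fi gi; apply: cintegrableD => //; exact: cintegrableN. Qed.

Lemma cintegrableJ mu D f : measurable D ->
  cintegrable mu D f -> cintegrable mu D (fun x => (f x)^J).
Proof.
move=> mD [f1 f2]; split; first by under eq_fun do rewrite ReJ.
by under eq_fun do rewrite ImJ EFinN; exact: integrableN.
Qed.

Lemma cintegralD mu D f g : measurable D ->
  cintegrable mu D f -> cintegrable mu D g ->
  cintegral mu D (fun x => f x + g x) = cintegral mu D f + cintegral mu D g.
Proof.
move=> mD [f1 f2] [g1 g2]; rewrite /cintegral.
under [in LHS]eq_Rintegral do rewrite raddfD.
under [in X in _ +i* X]eq_Rintegral do rewrite raddfD.
by rewrite !RintegralD.
Qed.

Lemma cintegralZ mu D (z : R[i]) f : measurable D -> cintegrable mu D f ->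
  cintegral mu D (fun x => z * f x) = z * cintegral mu D f.
Proof.
move=> mD [f1 f2]; apply/eqP; rewrite eq_complex Re_mulc Im_mulc /cintegral/=.
have iZ (r : R) (h : T -> R) : mu.-integrable D (fun x => (h x)%:E) ->
  mu.-integrable D (EFin \o (fun x => r * h x)).
  by move=> ih; exact: (integrableZl mD r ih).
under eq_Rintegral do rewrite Re_mulc.
under [X in _ && (X == _)]eq_Rintegral do rewrite Im_mulc.
rewrite RintegralB ?RintegralD; do ?[exact: iZ|done].
by rewrite !RintegralZl// !eqxx.
Qed.

Lemma cintegralN mu D f : measurable D -> cintegrable mu D f ->
  cintegral mu D (fun x => - f x) = - cintegral mu D f.
Proof.
move=> mD fi; under eq_cintegral do rewrite -mulN1r.
by rewrite cintegralZ// mulN1r.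
Qed.

Lemma cintegralB mu D f g : measurable D ->
  cintegrable mu D f -> cintegrable mu D g ->
  cintegral mu D (fun x => f x - g x) = cintegral mu D f - cintegral mu D g.
Proof.
by move=> mD fi gi; rewrite cintegralD ?cintegralN//; exact: cintegrableN.
Qed.

Lemma cintegralJ mu D f : measurable D -> cintegrable mu D f ->
  cintegral mu D (fun x => (f x)^J) = (cintegral mu D f)^J.
Proof.
move=> mD [f1 f2]; apply/eqP; rewrite eq_complex ReJ ImJ /cintegral/=.
under eq_Rintegral do rewrite ReJ.
under [X in _ && (X == _)]eq_Rintegral do rewrite ImJ -mulN1r.
by rewrite RintegralZl// mulN1r !eqxx.
Qed.

Lemma Re_cintegral mu D f :
  complex.Re (cintegral mu D f) = \int[mu]_(x in D) complex.Re (f x).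
Proof. by []. Qed.

Lemma le_normc_cintegral mu D f : measurable D -> cintegrable mu D f ->
  normc (cintegral mu D f) <= \int[mu]_(x in D) normc (f x).
Proof.
move=> mD fi; set z := cintegral mu D f.
have [->|z0] := eqVneq (normc z) 0.
  by apply: Rintegral_ge0 => x _; exact: normc_ge0.
have zgt0 : 0 < normc z by rewrite lt_def z0 normc_ge0.
have ni := cintegrable_normc mD fi.
(* rotate the integral onto the positive real axis *)
suff : normc z * normc z <= normc z * \int[mu]_(x in D) normc (f x).
  by rewrite ler_pM2l.
have -> : normc z * normc z = complex.Re (z^J * z) by
  rewrite [_^J * _]mulrC mulcJ -expr2.
rewrite -cintegralZ// Re_cintegral -RintegralZl//.
have [zi _] := cintegrableZ z^J mD fi.
apply: le_Rintegral => //.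
  exact: (integrableZl mD _ ni).
move=> x Dx; suff : complex.Re (z^J * f x) <= normc z * normc (f x) by [].
rewrite -(normc_conj z) -normc_mul.
exact: le_trans (ler_norm _) (normr_Re_le _).
Qed.

Lemma EFin_Rintegral mu D (g : T -> R) : measurable D -> mu.-integrable D (EFin \o g) ->
  (\int[mu]_(x in D) g x)%:E = (\int[mu]_(x in D) (g x)%:E)%E.
Proof. by move=> mD gi; rewrite /Rintegral fineK//; exact: integrable_fin_num. Qed.

(** Integrability is not assumed: when the modulus has infinite integral the bound is trivial. *)
Lemma le_normc_cintegral_lee mu D f : measurable D -> cmeasurable D f ->
  ((normc (cintegral mu D f))%:E <= \int[mu]_(x in D) (normc (f x))%:E)%E.
Proof.
move=> mD mf.
have [foo|] := ltP (\int[mu]_(x in D) (normc (f x))%:E)%E +oo%E; last first.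
  by rewrite leye_eq => /eqP ->; rewrite leey.
have fi : cintegrable mu D f by exact/cintegrableP.
rewrite -EFin_Rintegral ?lee_fin//; first exact: le_normc_cintegral.
exact: cintegrable_normc.
Qed.

Lemma cintegral_mkcond mu D f :
  cintegral mu D f = cintegral mu setT (fun x => (\1_D x)%:C * f x).
Proof.
rewrite /cintegral; congr (_ +i* _); rewrite Rintegral_mkcond;
  apply: eq_Rintegral => x _; rewrite patchE indicE; case: ifPn => _.
- by rewrite mul1r.
- by rewrite mul0r.
- by rewrite mul1r.
- by rewrite mul0r.
Qed.

Lemma cintegrable_mkcond mu D f : measurable D ->
  cintegrable mu D f <-> cintegrable mu setT (fun x => (\1_D x)%:C * f x).
Proof.
move=> mD; rewrite /cintegrable.
rewrite !(@integrable_mkcond _ _ _ mu D) //.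
rewrite (_ : (_ \_ D) =
  fun x => (complex.Re ((\1_D x)%:C * f x))%:E); last first.
  by apply/funext => x; rewrite patchE indicE; case: ifPn => _; rewrite ?mul1r ?mul0r.
rewrite (_ : (_ \_ D) =
  fun x => (complex.Im ((\1_D x)%:C * f x))%:E) //.
by apply/funext => x; rewrite patchE indicE; case: ifPn => _; rewrite ?mul1r ?mul0r.
Qed.

(** Convergence of complex values is phrased as [normc] of the difference tending to 0, so that only
    limits of real numbers occur. *)
Lemma cintegral_dominated mu D (f_ : nat -> T -> R[i]) f (g : T -> R) :
  measurable D -> (forall n, cmeasurable D (f_ n)) -> cmeasurable D f ->
  (forall x, D x -> normc (f_ n x - f x) @[n --> \oo] --> 0) ->
  mu.-integrable D (EFin \o g) ->
  (forall n x, D x -> normc (f_ n x) <= g x) ->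
  normc (cintegral mu D (f_ n) - cintegral mu D f) @[n --> \oo] --> 0.
Proof.
move=> mD mf_ mf f_f ig f_g.
(* Real dominated convergence, once for both coordinates: [c] is either [complex.Re] or
   [complex.Im]. *)
have aux (c : R[i] -> R) (hc : forall z, `|c z| <= normc z)
    (cB : forall a b, c (a - b) = c a - c b)
    (mc : forall h, cmeasurable D h -> measurable_fun D (fun x => c (h x))) :
    \int[mu]_(x in D) c (f_ n x) @[n --> \oo] --> \int[mu]_(x in D) c (f x).
  have [] := @dominated_convergence _ _ _ mu D mD (fun n x => (c (f_ n x))%:E)
    (fun x => (c (f x))%:E) (EFin \o g).
  - by move=> n; apply/measurable_EFinP/mc.
  - by apply/measurable_EFinP/mc.
  - apply: aeW => x Dx; apply: cvg_EFin; first by near=> n.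
    have := f_f _ Dx => /cvgrPdist_le /= h.
    apply/cvgrPdist_le => /= e e0; have := h e e0; apply: filterS => n.
    rewrite sub0r normrN ger0_norm ?normc_ge0// => /(le_trans _); apply.
    by rewrite -cB (le_trans (hc _))// normc_distC.
  - by [].
  - apply: aeW => x n Dx /=; rewrite lee_fin.
    exact: le_trans (hc _) (f_g _ _ Dx).
  move=> fi _ h; apply: fine_cvg; rewrite fineK//.
  exact: integrable_fin_num.
have h1 := aux _ normr_Re_le (raddfB _) (fun h mh => mh.1).
have h2 := aux _ normr_Im_le (raddfB _) (fun h mh => mh.2).
apply: (@squeeze_cvgr _ _ _ _ (fun=> 0) (fun n =>
   `|\int[mu]_(x in D) complex.Re (f_ n x) - \int[mu]_(x in D) complex.Re (f x)|
 + `|\int[mu]_(x in D) complex.Im (f_ n x) - \int[mu]_(x in D) complex.Im (f x)|)).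
- by apply: nearW => n; rewrite normc_ge0 (le_trans (normc_le_ReIm _))// !raddfB.
- exact: cvg_cst.
- rewrite -[X in _ --> X](addr0 0); apply: cvgD; rewrite -(@normr0 _ R);
    apply: cvg_norm; apply/subr_cvg0.
    exact: h1.
  exact: h2.
Unshelve. all: by end_near. Qed.

End cintegral.

(** * Product measures and limits of integrals *)

Section product_integrals.
Context {d1 d2 : measure_display} {T1 : measurableType d1}
  {T2 : measurableType d2} {R : realType}.
Variables (m1 : {sigma_finite_measure set T1 -> \bar R})
  (m2 : {sigma_finite_measure set T2 -> \bar R}).

(** Tonelli is applied to the positive and negative parts, so the sections of [g] may fail to be
    integrable. *)
Lemma measurable_Rintegral (g : T1 * T2 -> R) : measurable_fun setT g ->
  measurable_fun setT (fun x => \int[m2]_y g (x, y)).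
Proof.
move=> mg; apply: measurableT_comp; first exact: fine_measurable.
have mG : measurable_fun setT (EFin \o g) by exact/measurable_EFinP.
rewrite (_ : (fun x => _) =
    (fun x => fubini_F m2 (EFin \o g)^\+ x - fubini_F m2 (EFin \o g)^\- x)%E).
  apply: emeasurable_funB; apply: measurable_fun_fubini_tonelli_F => //.
    exact: measurable_funepos.
  exact: measurable_funeneg.
apply/funext => x; rewrite integralE /fubini_F.
by congr (_ - _)%E; apply: eq_integral => y _; rewrite ?funeposE ?funenegE.
Qed.

Lemma cmeasurable_cintegral (F : T1 * T2 -> R[i]) : cmeasurable setT F ->
  cmeasurable setT (fun x => cintegral m2 setT (fun y => F (x, y))).
Proof.
move=> [mF1 mF2]; split => /=.
  exact: (measurable_Rintegral mF1).
exact: (measurable_Rintegral mF2).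
Qed.

(** The inner integral is finite only for almost every [x], so taking [fine] of it preserves the
    outer integral by almost-everywhere equality. *)
Lemma Rintegral_prod1 (g : T1 * T2 -> R) :
  (m1 \x m2)%E.-integrable setT (EFin \o g) ->
  \int[m1]_x \int[m2]_y g (x, y) = \int[(m1 \x m2)%E]_z g z.
Proof.
move=> ig; rewrite /Rintegral -(integral12_prod_meas1 ig); congr fine.
have iF := integrable_fubini_F ig.
apply: ae_eq_integral => //.
- apply/measurable_EFinP/measurable_Rintegral.
  by apply/measurable_EFinP; exact: measurable_int _ ig.
- exact: measurable_int _ iF.
- apply: filterS (integrable_ae measurableT iF) => x /(_ I) h _.
  by rewrite fineK.
Qed.

Lemma Rintegral_prod2 (g : T1 * T2 -> R) :
  (m1 \x m2)%E.-integrable setT (EFin \o g) ->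
  \int[m2]_y \int[m1]_x g (x, y) = \int[(m1 \x m2)%E]_z g z.
Proof.
move=> ig; rewrite /Rintegral -(integral21_prod_meas1 ig); congr fine.
have mG := measurable_fubini_G ig.
apply: ae_eq_integral => //.
- by apply/measurable_EFinP/measurableT_comp; first exact: fine_measurable.
- apply: filterS (ae_integrable2 ig) => y h _.
  by rewrite fineK//; exact: integrable_fin_num h.
Qed.

Lemma cintegral_prod1 (F : T1 * T2 -> R[i]) : cintegrable (m1 \x m2)%E setT F ->
  cintegral m1 setT (fun x => cintegral m2 setT (fun y => F (x, y))) =
  cintegral (m1 \x m2)%E setT F.
Proof.
by move=> [i1 i2]; rewrite /cintegral; congr (_ +i* _); exact: Rintegral_prod1.
Qed.

Lemma cintegral_prod2 (F : T1 * T2 -> R[i]) : cintegrable (m1 \x m2)%E setT F ->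
  cintegral m2 setT (fun y => cintegral m1 setT (fun x => F (x, y))) =
  cintegral (m1 \x m2)%E setT F.
Proof.
by move=> [i1 i2]; rewrite /cintegral; congr (_ +i* _); exact: Rintegral_prod2.
Qed.

Lemma cFubini (F : T1 * T2 -> R[i]) : cintegrable (m1 \x m2)%E setT F ->
  cintegral m1 setT (fun x => cintegral m2 setT (fun y => F (x, y))) =
  cintegral m2 setT (fun y => cintegral m1 setT (fun x => F (x, y))).
Proof. by move=> iF; rewrite cintegral_prod1// cintegral_prod2. Qed.

Lemma cintegrable_prodP (F : T1 * T2 -> R[i]) : cmeasurable setT F ->
  (\int[m1]_x \int[m2]_y (normc (F (x, y)))%:E < +oo)%E ->
  cintegrable (m1 \x m2)%E setT F.
Proof.
move=> mF Foo; apply/cintegrableP => //; split => //.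
rewrite fubini_tonelli1//.
  exact/measurable_EFinP/measurable_normc.
by move=> z; rewrite lee_fin normc_ge0.
Qed.

End product_integrals.

(** * Fatou's lemma, Cauchy-Schwarz and limits of squared norms *)

Section limits.
Context {d : measure_display} {T : measurableType d} {R : realType}.
Variable mu : {measure set T -> \bar R}.

Lemma fatou_cvg_le (D : set T) (g_ : nat -> T -> R) (g : T -> R) (C : \bar R) :
  measurable D -> (forall n, measurable_fun D (g_ n)) ->
  (forall n x, D x -> 0 <= g_ n x) ->
  (forall x, D x -> g_ n x @[n --> \oo] --> g x) ->
  (\forall n \near \oo, (\int[mu]_(x in D) (g_ n x)%:E <= C)%E) ->
  (\int[mu]_(x in D) (g x)%:E <= C)%E.
Proof.
move=> mD mg g0 gg [N _ gC].
(* The shift by [N] turns the eventual bound into one that holds from index 0. *)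
pose h n x := (g_ (n + N)%N x)%:E.
have hN x : D x -> (limn_einf (h ^~ x) = (g x)%:E)%E.
  move=> Dx; apply: (cvg_limn_einf_sup _).1.
  apply: cvg_EFin; first by near=> n.
  by rewrite /h/=; move: (gg _ Dx); rewrite -(cvg_shiftn N).
have -> : (\int[mu]_(x in D) (g x)%:E = \int[mu]_(x in D) limn_einf (h ^~ x))%E.
  by apply: eq_integral => x; rewrite inE => /hN ->.
apply: le_trans (@fatou _ _ _ mu D mD h _ _) _.
- by move=> n; exact/measurable_EFinP.
- by move=> n x Dx; rewrite lee_fin g0.
- rewrite limn_einf_lim; apply: lime_le; first exact: is_cvg_einfs.
  apply: nearW => n; apply: ereal_inf_le; exists (\int[mu]_(x in D) h n x)%E.
    by exists n => /=.
  by apply: gC; rewrite /= leq_addl.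
Unshelve. all: by end_near. Qed.

(** The right side minus the left side is [e * |u - v / e|^2]. This weighted inequality takes the
    place of the triangle inequality of L^2, which would bring in square roots of integrals. *)
Lemma sqr_normcD_eps (u v : R[i]) (e : R) : 0 < e ->
  normc (u + v) ^+ 2 <= (1 + e) * normc u ^+ 2 + (1 + e^-1) * normc v ^+ 2.
Proof.
move=> e0; rewrite !sqr_normc; case: u v => a b [c k] /=.
rewrite -subr_ge0; set w := (X in 0 <= X).
have -> : w = e * ((a - c / e) ^+ 2 + (b - k / e) ^+ 2).
  by rewrite /w; field; rewrite gt_eqF.
by rewrite mulr_ge0 ?addr_ge0 ?sqr_ge0 ?ltW.
Qed.

(** Only weights [e <= 1] are demanded, so that [e ^+ 2] can be bounded by [e] when the premise is
    checked. *)
Lemma ler_addM_small (x y K : R) : 0 <= K ->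
  (forall e : R, 0 < e -> e <= 1 -> x <= y + e * K) -> x <= y.
Proof.
move=> K0 h; apply/ler_addgt0Pr => e e0.
have eK : 0 < Num.min 1 (e / (K + 1)).
  by rewrite lt_min ltr01 divr_gt0// ltr_wpDl.
apply: le_trans (h _ eK _) _; first by rewrite ge_min lexx.
rewrite lerD2l.
have : Num.min 1 (e / (K + 1)) * K <= e / (K + 1) * K.
  by rewrite ler_wpM2r// ge_min lexx orbT.
move=> /le_trans; apply; rewrite mulrAC ler_pdivrMr ?ltr_wpDl//.
by rewrite ler_pM2l// lerDl.
Qed.

Lemma cvg_normc_sqrB (u_ : nat -> R[i]) (u v : R[i]) :
  normc (u_ n - u) @[n --> \oo] --> 0 ->
  normc (u_ n - v) ^+ 2 @[n --> \oo] --> normc (u - v) ^+ 2.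
Proof.
move=> h.
have aux (c : R[i] -> R) (hc : forall z, `|c z| <= normc z)
    (cB : forall a b, c (a - b) = c a - c b) :
    c (u_ n) @[n --> \oo] --> c u.
  apply/cvgrPdist_le => /= e e0; have /cvgrPdist_le := h => /(_ e e0).
  apply: filterS => n; rewrite sub0r normrN ger0_norm ?normc_ge0//.
  by apply: le_trans; rewrite -cB (le_trans (hc _))// normc_distC.
have h1 := aux _ normr_Re_le (raddfB _).
have h2 := aux _ normr_Im_le (raddfB _).
under eq_fun do rewrite sqr_normc !raddfB.
rewrite sqr_normc !raddfB; apply: cvgD; rewrite expr2.
  by under eq_fun do rewrite expr2; apply: cvgM; apply: cvgB => //; exact: cvg_cst.
by under eq_fun do rewrite expr2; apply: cvgM; apply: cvgB => //; exact: cvg_cst.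
Qed.

Lemma integral_sqr_normcD_le (D : set T) (u v : T -> R[i]) (e a b : R) :
  measurable D -> 0 < e -> cmeasurable D u -> cmeasurable D v ->
  (\int[mu]_(x in D) (normc (u x) ^+ 2)%:E <= a%:E)%E ->
  (\int[mu]_(x in D) (normc (v x) ^+ 2)%:E <= b%:E)%E ->
  (\int[mu]_(x in D) (normc (u x + v x) ^+ 2)%:E <=
   ((1 + e) * a + (1 + e^-1) * b)%:E)%E.
Proof.
move=> mD e0 mu_ mv ua vb.
have c0 : 0 <= 1 + e by rewrite addr_ge0// ltW.
have c1 : 0 <= 1 + e^-1 by rewrite addr_ge0// invr_ge0 ltW.
apply: (@le_trans _ _ (\int[mu]_(x in D)
    ((1 + e)%:E * (normc (u x) ^+ 2)%:E +
     (1 + e^-1)%:E * (normc (v x) ^+ 2)%:E))%E).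
  apply: ge0_le_integral => //.
  - by move=> x _; rewrite lee_fin sqr_ge0.
  - apply/measurable_EFinP; apply: measurable_normc_sqr.
    exact: cmeasurableD.
  - apply: emeasurable_funD; apply: measurable_funeM;
      exact/measurable_EFinP/measurable_normc_sqr.
  - by move=> x _; rewrite lee_fin sqr_normcD_eps.
rewrite ge0_integralD//; first last.
- by apply: measurable_funeM; exact/measurable_EFinP/measurable_normc_sqr.
- by move=> x _; rewrite lee_fin mulr_ge0// sqr_ge0.
- by apply: measurable_funeM; exact/measurable_EFinP/measurable_normc_sqr.
- by move=> x _; rewrite lee_fin mulr_ge0// sqr_ge0.
rewrite !ge0_integralZl//; first last.
- by move=> x _; rewrite lee_fin sqr_ge0.
- exact/measurable_EFinP/measurable_normc_sqr.
- by move=> x _; rewrite lee_fin sqr_ge0.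
- exact/measurable_EFinP/measurable_normc_sqr.
by rewrite [leRHS]EFinD 2!EFinM; apply: leeD; apply: lee_pmul => //;
  rewrite ?lee_fin//; apply: integral_ge0 => x _; rewrite lee_fin sqr_ge0.
Qed.

(** Fatou's lemma in [m], with [n] fixed, turns the Cauchy property into L^2 convergence of [u_] to
    its pointwise limit; squared norms then converge by the weighted inequality used in both
    directions. *)
Lemma cauchy_sqr_integral_lim (D : set T) (u_ : nat -> T -> R[i]) (u : T -> R[i])
    (L : R) : measurable D ->
  (forall n, cmeasurable D (u_ n)) -> cmeasurable D u ->
  (forall x, D x -> normc (u_ n x - u x) @[n --> \oo] --> 0) ->
  (forall e : R, 0 < e -> exists N, forall n m, (N <= n)%N -> (N <= m)%N ->
     (\int[mu]_(x in D) (normc (u_ n x - u_ m x) ^+ 2)%:E <= e%:E)%E) ->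
  (\int[mu]_(x in D) (normc (u_ n x) ^+ 2)%:E)%E @[n --> \oo] --> L%:E ->
  (\int[mu]_(x in D) (normc (u x) ^+ 2)%:E = L%:E)%E.
Proof.
move=> mD mu_ mu0 uu uC uL.
have I0 (v : T -> R[i]) : (0 <= \int[mu]_(x in D) (normc (v x) ^+ 2)%:E)%E.
  by apply: integral_ge0 => x _; rewrite lee_fin sqr_ge0.
move/fine_cvgP : uL => [uLfin uL].
have uLe (e : R) : 0 < e -> \forall n \near \oo,
    exists2 a : R, (\int[mu]_(x in D) (normc (u_ n x) ^+ 2)%:E = a%:E)%E &
      (0 <= a) && (`|L - a| <= e).
  move=> e0; move/cvgrPdist_le : uL => /(_ e e0) h; near=> n.
  exists (fine (\int[mu]_(x in D) (normc (u_ n x) ^+ 2)%:E)%E).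
    by rewrite fineK//; near: n.
  by rewrite fine_ge0//=; near: n.
have uC' (e : R) : 0 < e -> \forall n \near \oo,
    (\int[mu]_(x in D) (normc (u_ n x - u x) ^+ 2)%:E <= e%:E)%E.
  move=> e0; have [N hN] := uC e e0; exists N => // n /= Nn.
  apply: (@fatou_cvg_le _ (fun m x => normc (u_ n x - u_ m x) ^+ 2)) => //.
  - by move=> m; apply: measurable_normc_sqr; exact: cmeasurableB.
  - by move=> m x _; exact: sqr_ge0.
  - move=> x Dx; rewrite normc_distC.
    under eq_fun do rewrite normc_distC.
    exact: cvg_normc_sqrB (uu _ Dx).
  - by exists N => // m /= Nm; exact: hN.
(* The distance from [u_ n] to [u] is taken below [e ^+ 2], because the weighted inequality
   multiplies it by [1 + e^-1] and leaves [e ^+ 2 + e]. *)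
have upper (e : R) : 0 < e ->
    (\int[mu]_(x in D) (normc (u x) ^+ 2)%:E <=
     ((1 + e) * (L + e) + (1 + e^-1) * e ^+ 2)%:E)%E.
  move=> e0; near \oo => n.
  have [a aE /andP[a0 La]] : exists2 a : R,
      (\int[mu]_(x in D) (normc (u_ n x) ^+ 2)%:E = a%:E)%E &
      (0 <= a) && (`|L - a| <= e) by near: n; exact: uLe.
  under eq_integral => x _ do
    rewrite -[u x](subKr (u_ n x)) -[_ - (_ - _)]/(_ + _).
  apply: integral_sqr_normcD_le => //.
  - by apply: cmeasurableN; exact: cmeasurableB.
  - by rewrite aE lee_fin; move: La; rewrite ler_distlC; lra.
  - under eq_integral do rewrite normcN.
    by near: n; apply: uC'; rewrite exprn_gt0.
have [U UE] : exists U : R,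
    (\int[mu]_(x in D) (normc (u x) ^+ 2)%:E = U%:E)%E.
  exists (fine (\int[mu]_(x in D) (normc (u x) ^+ 2)%:E)%E).
  rewrite fineK// ge0_fin_numE// (le_lt_trans (upper 1 ltr01))//.
  exact: ltry.
have U0 : 0 <= U by rewrite -lee_fin -UE.
have lower (e : R) : 0 < e -> L <= (1 + e) * U + (1 + e^-1) * e ^+ 2 + e.
  move=> e0; near \oo => n.
  have [a aE /andP[a0 La]] : exists2 a : R,
      (\int[mu]_(x in D) (normc (u_ n x) ^+ 2)%:E = a%:E)%E &
      (0 <= a) && (`|L - a| <= e) by near: n; exact: uLe.
  suff : a <= (1 + e) * U + (1 + e^-1) * e ^+ 2.
    by move: La; rewrite ler_distlC; lra.
  rewrite -lee_fin -aE.
  under eq_integral => x _ do rewrite -[u_ n x](subrK (u x)) addrC.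
  apply: integral_sqr_normcD_le => //.
  - exact: cmeasurableB.
  - by rewrite UE.
  - by near: n; apply: uC'; rewrite exprn_gt0.
have L0 : 0 <= L.
  apply/ler_addgt0Pr => e e0; near \oo => n.
  have [a _ /andP[a0 La]] : exists2 a : R,
      (\int[mu]_(x in D) (normc (u_ n x) ^+ 2)%:E = a%:E)%E &
      (0 <= a) && (`|L - a| <= e) by near: n; exact: uLe.
  by move: La; rewrite ler_distlC; lra.
have eE (e : R) : 0 < e -> (1 + e^-1) * e ^+ 2 = e ^+ 2 + e.
  by move=> e0; field; rewrite gt_eqF.
rewrite UE; congr EFin; apply/eqP; rewrite eq_le; apply/andP; split.
  apply: (@ler_addM_small _ _ (L + 4)) => [|e e0 e1]; first by rewrite addr_ge0.
  move: (upper e e0); rewrite UE lee_fin eE//.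
  have : e ^+ 2 <= e by rewrite expr2 ler_piMr// ltW.
  by rewrite !mulrDl !mulrDr !mul1r -expr2; lra.
apply: (@ler_addM_small _ _ (U + 3)) => [|e e0 e1]; first by rewrite addr_ge0.
move: (lower e e0); rewrite eE//.
have : e ^+ 2 <= e by rewrite expr2 ler_piMr// ltW.
by rewrite !mulrDl !mulrDr !mul1r; lra.
Unshelve. all: by end_near. Qed.

(** The best weight is [e = I / a]. For [a = 0] the weight [(b + 1) / I] would give
    [2 * (b + 1) <= b], which is absurd. *)
Lemma sqr_le_of_AMGM (I a b : R) : 0 <= I -> 0 <= a -> 0 <= b ->
  (forall e : R, 0 < e -> 2 * e * I <= e ^+ 2 * a + b) -> I ^+ 2 <= a * b.
Proof.
move=> I0 a0 b0 h; have [->|In0] := eqVneq I 0.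
  by rewrite expr0n/= mulr_ge0.
have Igt0 : 0 < I by rewrite lt_def In0.
have [az|an0] := eqVneq a 0.
  have := h ((b + 1) / I) _; rewrite divr_gt0 ?ltr_wpDl// => /(_ isT).
  by rewrite az mulr0 add0r -mulrA divfK//; lra.
have agt0 : 0 < a by rewrite lt_def an0.
have := h (I / a) (divr_gt0 Igt0 agt0).
rewrite -(ler_pM2r agt0).
have -> : 2 * (I / a) * I * a = 2 * I ^+ 2 by field.
have -> : ((I / a) ^+ 2 * a + b) * a = I ^+ 2 + a * b by field.
lra.
Qed.

(** Pointwise AM-GM with weight [e]. The weight stays free so that [cauchy_schwarz] can optimize
    it. *)
Lemma integral_normcM_le (D : set T) (f g : T -> R[i]) (a b : R) :
  measurable D -> cmeasurable D f -> cmeasurable D g ->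
  (\int[mu]_(x in D) (normc (f x) ^+ 2)%:E <= a%:E)%E ->
  (\int[mu]_(x in D) (normc (g x) ^+ 2)%:E <= b%:E)%E ->
  forall e : R, 0 < e ->
  (\int[mu]_(x in D) (normc (f x * g x))%:E <=
    ((e * a + e^-1 * b) / 2)%:E)%E.
Proof.
move=> mD mf mg fa gb e e0.
have ce0 : 0 <= e / 2 by rewrite divr_ge0 ?ltW.
have cf0 : 0 <= e^-1 / 2 by rewrite divr_ge0 ?invr_ge0 ?ltW.
apply: (@le_trans _ _ (\int[mu]_(x in D)
    ((e / 2)%:E * (normc (f x) ^+ 2)%:E +
     (e^-1 / 2)%:E * (normc (g x) ^+ 2)%:E))%E).
  apply: ge0_le_integral => //.
  - by move=> x _; rewrite lee_fin normc_ge0.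
  - by apply/measurable_EFinP; apply: measurable_normc; exact: cmeasurableM.
  - apply: emeasurable_funD; apply: measurable_funeM;
      exact/measurable_EFinP/measurable_normc_sqr.
  - move=> x _; rewrite lee_fin normc_mul -subr_ge0.
    set w := (X in 0 <= X).
    have -> : w = e / 2 * (normc (f x) - normc (g x) / e) ^+ 2.
      by rewrite /w; field; rewrite gt_eqF.
    by rewrite mulr_ge0// sqr_ge0.
rewrite ge0_integralD//; first last.
- by apply: measurable_funeM; exact/measurable_EFinP/measurable_normc_sqr.
- by move=> x _; rewrite lee_fin mulr_ge0// sqr_ge0.
- by apply: measurable_funeM; exact/measurable_EFinP/measurable_normc_sqr.
- by move=> x _; rewrite lee_fin mulr_ge0// sqr_ge0.
rewrite !ge0_integralZl//; first last.
- by move=> x _; rewrite lee_fin sqr_ge0.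
- exact/measurable_EFinP/measurable_normc_sqr.
- by move=> x _; rewrite lee_fin sqr_ge0.
- exact/measurable_EFinP/measurable_normc_sqr.
have -> : (e * a + e^-1 * b) / 2 = e / 2 * a + e^-1 / 2 * b by field; rewrite gt_eqF.
by rewrite [leRHS]EFinD (EFinM _ a) (EFinM _ b); apply: leeD; apply: lee_pmul => //;
  rewrite ?lee_fin//; apply: integral_ge0 => x _; rewrite lee_fin sqr_ge0.
Qed.

Lemma cintegrableM_sqr (D : set T) (f g : T -> R[i]) :
  measurable D -> cmeasurable D f -> cmeasurable D g ->
  (\int[mu]_(x in D) (normc (f x) ^+ 2)%:E < +oo)%E ->
  (\int[mu]_(x in D) (normc (g x) ^+ 2)%:E < +oo)%E ->
  cintegrable mu D (fun x => f x * g x).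
Proof.
move=> mD mf mg foo goo.
have I0 (v : T -> R[i]) : (0 <= \int[mu]_(x in D) (normc (v x) ^+ 2)%:E)%E.
  by apply: integral_ge0 => x _; rewrite lee_fin sqr_ge0.
apply/cintegrableP => //; split; first exact: cmeasurableM.
apply: le_lt_trans (ltry _).
apply: (@integral_normcM_le _ _ _ (fine (\int[mu]_(x in D) (normc (f x) ^+ 2)%:E)%E)
  (fine (\int[mu]_(x in D) (normc (g x) ^+ 2)%:E)%E) _ _ _ _ _ 1) => //.
  by rewrite fineK// ge0_fin_numE.
by rewrite fineK// ge0_fin_numE.
Qed.

Lemma cauchy_schwarz (D : set T) (f g : T -> R[i]) (a b : R) :
  measurable D -> cmeasurable D f -> cmeasurable D g -> 0 <= a -> 0 <= b ->
  (\int[mu]_(x in D) (normc (f x) ^+ 2)%:E <= a%:E)%E ->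
  (\int[mu]_(x in D) (normc (g x) ^+ 2)%:E <= b%:E)%E ->
  normc (cintegral mu D (fun x => f x * g x)) ^+ 2 <= a * b.
Proof.
move=> mD mf mg a0 b0 fa gb.
apply: sqr_le_of_AMGM => //; first exact: normc_ge0.
move=> e e0.
have fg : cmeasurable D (fun x => f x * g x) by exact: cmeasurableM.
have := le_trans (le_normc_cintegral_lee mu mD fg)
  (integral_normcM_le mD mf mg fa gb e0).
rewrite lee_fin -(ler_pM2l (mulr_gt0 (ltr0Sn R 1) e0)) => /le_trans; apply.
rewrite le_eqVlt; apply/orP; left; apply/eqP.
by field; rewrite gt_eqF.
Qed.

End limits.

Lemma ae_lebesgueS (R : realType) (P Q : set R) : P `<=` Q ->
  {ae @lebesgue_measure R, forall x, P x} ->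
  {ae @lebesgue_measure R, forall x, Q x}.
Proof.
move=> PQ [N [mN N0 PN]]; exists N; split => // x /= nQ.
by apply: PN => /PQ.
Qed.

(** * Affine changes of variable for Lebesgue measure *)

Section affine.
Context {R : realType}.
Local Notation mu := (@lebesgue_measure R).
Variables (a b : R).
Hypothesis a0 : a != 0.

Let phi (x : measurableTypeR R) : measurableTypeR R := a * x + b.

Let mphi : measurable_fun setT phi.
Proof. by apply: measurable_funD => //; exact: measurable_funM. Qed.

Let nu : {measure set (measurableTypeR R) -> \bar R} :=
  measure_function_pushforward__canonical__measure_function_Measure mu mphi.

(** By uniqueness of Lebesgue measure it is enough to compare [|a|] times the push-forward along
    [phi] with length on half-open intervals. For [a < 0] the preimage is half-open on the other
    side, which does not change its length. *)
Lemma lebesgue_measure_affine (A : set (measurableTypeR R)) : measurable A ->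
  mu (phi @^-1` A) = ((`|a|^-1)%:E * mu A)%E.
Proof.
move=> mA; have na0 : 0 < `|a| by rewrite normr_gt0.
pose k : {nonneg R} := NngNum (ltW na0).
suff -> : mu A = mscale k nu A.
  by rewrite /mscale/= muleA -EFinM mulVf ?mul1e// gt_eqF.
move: A mA; apply: (lebesgue_measure_unique (mu := mscale k nu)) => //= _ [[c e]] _ <-.
rewrite /mscale /nu/= /pushforward.
have [agt0|] := ltP 0 a.
  have -> : phi @^-1` `]c, e] = `](c - b) / a, (e - b) / a]%classic.
    apply/seteqP; split => x /=; rewrite !in_itv/= /phi ltr_pdivrMr//
      ler_pdivlMr// ltrBlDr lerBrDr mulrC//.
  rewrite !lebesgue_measure_itv/= !lte_fin ltr_pM2r ?invr_gt0// ltrD2r.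
  case: ifPn => _; last by rewrite mule0.
  by rewrite gtr0_norm// -!EFinB -EFinM; congr EFin; field.
rewrite le_eqVlt (negbTE a0)/= => alt0.
have -> : phi @^-1` `]c, e] = `[(e - b) / a, (c - b) / a[%classic.
  apply/seteqP; split => x /=; rewrite !in_itv/= /phi ltr_ndivlMr//
    ler_ndivrMr// ltrBlDr lerBrDr mulrC andbC//.
rewrite !lebesgue_measure_itv/= !lte_fin ltr_nM2r ?invr_lt0// ltrD2r.
case: ifPn => _; last by rewrite mule0.
by rewrite ltr0_norm// -!EFinB -EFinM; congr EFin; field.
Qed.

Lemma ge0_integral_affine (F : R -> \bar R) : measurable_fun setT F ->
  (forall x, 0 <= F x)%E ->
  (\int[mu]_x F (a * x + b)%R = (`|a|^-1)%:E * \int[mu]_x F x)%E.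
Proof.
move=> mF F0; have na0 : 0 < `|a| by rewrite normr_gt0.
pose k : {nonneg R} := NngNum (ltW na0).
have -> : (\int[mu]_x F x = \int[mscale k nu]_x F x)%E.
  apply: eq_measure_integral => A mA _.
  transitivity (`|a|%:E * nu A)%E; last by [].
  rewrite [nu A](lebesgue_measure_affine mA) muleA -EFinM.
  by rewrite divff ?mul1e// gt_eqF.
rewrite ge0_integral_mscale// (ge0_integral_pushforward mphi)//.
by rewrite preimage_setT muleA -EFinM mulVf ?mul1e// gt_eqF.
Qed.

Lemma cintegrable_affine (f : R -> R[i]) : cintegrable mu setT f ->
  cintegrable mu setT (fun x => f (a * x + b)).
Proof.
move=> fi; have mf := cintegrable_measurable fi.
apply/cintegrableP => //; split; first exact: (cmeasurableT_comp mf mphi).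
rewrite (@ge0_integral_affine (fun x => (normc (f x))%:E)).
- rewrite lte_mul_pinfty ?lee_fin ?invr_ge0//.
  by have /cintegrableP[] := fi.
- exact/measurable_EFinP/measurable_normc.
- by move=> x; rewrite lee_fin normc_ge0.
Qed.

Lemma Rintegral_affine (f : R -> R) : mu.-integrable setT (EFin \o f) ->
  \int[mu]_x f (a * x + b) = `|a|^-1 * \int[mu]_x f x.
Proof.
move=> fi; have mf := measurable_int _ fi.
have mp := measurable_funepos mf; have mn := measurable_funeneg mf.
rewrite /Rintegral integralE [in RHS]integralE.
have -> : (\int[mu]_x ((fun x => (f (a * x + b)%R)%:E)^\+ x) =
  (`|a|^-1)%:E * \int[mu]_x (EFin \o f)^\+ x)%E.
  by rewrite -ge0_integral_affine//; apply: eq_integral => x _; rewrite !funeposE.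
have -> : (\int[mu]_x ((fun x => (f (a * x + b)%R)%:E)^\- x) =
  (`|a|^-1)%:E * \int[mu]_x (EFin \o f)^\- x)%E.
  by rewrite -ge0_integral_affine//; apply: eq_integral => x _; rewrite !funenegE.
have := integrable_pos_fin_num measurableT fi.
have := integrable_neg_fin_num measurableT fi.
move: (\int[mu]_x (EFin \o f)^\+ x)%E (\int[mu]_x (EFin \o f)^\- x)%E.
by case=> [r| |]// [s| |]//= _ _; rewrite mulrBr.
Qed.

Lemma cintegral_affine (f : R -> R[i]) : cintegrable mu setT f ->
  cintegral mu setT (fun x => f (a * x + b)) =
  (`|a|^-1)%:C * cintegral mu setT f.
Proof.
move=> [f1 f2]; rewrite /cintegral (Rintegral_affine f1) (Rintegral_affine f2).
by apply/eqP; rewrite eq_complex /= !mul0r subr0 addr0 !eqxx.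
Qed.

Lemma ae_affine (P : set R) : {ae mu, forall x, P x} ->
  {ae mu, forall x, P (a * x + b)}.
Proof.
move=> [N [mN N0 PN]]; exists (phi @^-1` N); split.
- by rewrite -[X in measurable X]setTI; exact: mphi.
- by rewrite lebesgue_measure_affine// N0 mule0.
- by move=> x /= Px; exact: PN.
Qed.

End affine.

(** * Fourier transform and Plancherel's formula *)

Section abel_kernel.
Context {R : realType}.
Local Notation mu := (@lebesgue_measure R).

Definition abel (x : R) : R := expR (- `|x|).

Lemma abel_ge0 x : 0 <= abel x. Proof. exact: expR_ge0. Qed.

Lemma abelN x : abel (- x) = abel x. Proof. by rewrite /abel normrN. Qed.

Lemma continuous_abel : continuous abel.
Proof.
move=> x; apply: (@continuous_comp _ _ _ (fun y : R => - `|y|)).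
  by apply: continuousN; exact: norm_continuous.
exact: continuous_expR.
Qed.

Let prim (u x : R) :=
  expR (- x) * ((u * sin (u * x) - cos (u * x)) / (1 + u ^+ 2) - 1).

Let u2 (u : R) : 1 + u ^+ 2 != 0.
Proof. by rewrite gt_eqF// ltr_pwDl// sqr_ge0. Qed.

Let is_derive_prim (u x : R) :
  is_derive x (1 : R) (prim u) (expR (- x) * (1 + cos (u * x))).
Proof.
rewrite /prim; apply: is_derive_eq.
rewrite /GRing.scale/=.
by field.
Qed.

Let cvg_prim (u : R) : prim u x @[x --> +oo] --> 0.
Proof.
have h : expR (- x) * (`|u| + 2) @[x --> +oo] --> (0 : R).
  rewrite -[X in _ --> X](mul0r (`|u| + 2)); apply: cvgM; last exact: cvg_cst.
  exact: cvgr_expR.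
apply: norm_cvg0.
apply: squeeze_cvgr (cvg_cst 0) h; apply: nearW => x.
rewrite normr_ge0 /prim normrM ger0_norm ?expR_ge0// ler_pM2l ?expR_gt0//.
rewrite (le_trans (ler_normB _ _))// normr1 -[2]/(1 + 1) addrA lerD2r.
rewrite normrM [X in _ * X]ger0_norm ?invr_ge0 ?addr_ge0 ?sqr_ge0//.
rewrite ler_pdivrMr ?ltr_pwDl ?sqr_ge0//.
rewrite (le_trans (ler_normB _ _))// normrM.
have s1 : `|u| * `|sin (u * x)| <= `|u|.
  by rewrite ler_piMr// ler_norml sin_geN1 sin_le1.
have c1 : `|cos (u * x)| <= 1 by rewrite ler_norml cos_geN1 cos_le1.
apply: (le_trans (lerD s1 c1)); rewrite ler_peMr ?addr_ge0//.
by rewrite lerDl sqr_ge0.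
Qed.

(** The summand 1 keeps the integrand nonnegative, as the symmetrization and the improper
    fundamental theorem require. The case [u = 0] gives [integral_abel], with which the summand is
    removed again in [fourier_abel]. *)
Lemma integral_abel_cos (u : R) :
  (\int[mu]_x (abel x * (1 + cos (u * x)))%:E =
   (2 * (1 + (1 + u ^+ 2)^-1))%:E)%E.
Proof.
have cos1 x : 0 <= 1 + cos (u * x) by have := cos_geN1 (u * x); lra.
rewrite ge0_symfun_integralT; first last.
- by move=> x /=; rewrite abelN mulrN cosN.
- move=> x; apply: cvgM; first exact: continuous_abel.
  apply: cvgD; first exact: cvg_cst.
  apply: (continuous_comp (f := fun y => u * y) (g := cos)).
    exact: mulrl_continuous.
  exact: continuous_cos.
- by move=> x; rewrite mulr_ge0 ?abel_ge0.
rewrite EFinM; congr (_ * _)%E.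
rewrite -set_itvcy.
transitivity (\int[mu]_(x in `[0%R, +oo[) (expR (- x) * (1 + cos (u * x)))%:E)%E.
  apply: eq_integral => x; rewrite inE/= in_itv/= andbT => x0.
  by rewrite /abel ger0_norm.
rewrite (@ge0_continuous_FTC2y _ _ (prim u) 0 0).
- rewrite -EFinB; congr EFin; rewrite /prim mulr0 oppr0 expR0 sin0 cos0.
  by field.
- by move=> x x0; rewrite mulr_ge0 ?expR_ge0.
- apply: continuous_subspaceT => x; apply: cvgM.
    apply: (continuous_comp (f := fun y => - y) (g := expR)).
      exact: oppr_continuous.
    exact: continuous_expR.
  apply: cvgD; first exact: cvg_cst.
  apply: (continuous_comp (f := fun y => u * y) (g := cos)).
    exact: mulrl_continuous.
  exact: continuous_cos.
- exact: cvg_prim.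
- by move=> x x0; have := is_derive_prim u x => - [].
- apply: cvg_at_right_filter.
  have : derivable (prim u) 0 1 by have := is_derive_prim u 0 => - [].
  by move/derivable1_diffP/differentiable_continuous.
- by move=> x _; rewrite derive1E; have := is_derive_prim u x => - [].
Qed.

Lemma integral_abel : (\int[mu]_x (abel x)%:E = 2%:E)%E.
Proof.
have := integral_abel_cos 0.
under eq_integral do rewrite mul0r cos0 mulrC EFinM.
rewrite ge0_integralZl//; first last.
- by move=> x _; rewrite lee_fin abel_ge0.
- by apply/measurable_EFinP; apply: continuous_measurable_fun; exact: continuous_abel.
have -> : (2 * (1 + (1 + 0 ^+ 2)^-1))%R = (1 + 1) * 2 :> R.
  by rewrite expr0n/= addr0 invr1; ring.
rewrite EFinM => /(congr1 (fun z => ((1 + 1)^-1%R)%:E * z)%E).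
rewrite !muleA -!EFinM (_ : (1 + 1)^-1 * (1 + 1) = 1 :> R); last by field.
by rewrite mul1e mul1r.
Qed.

Lemma measurable_abel (D : set R) : measurable_fun D abel.
Proof.
by apply: measurable_funTS; apply: continuous_measurable_fun; exact: continuous_abel.
Qed.

Lemma integrable_abel : mu.-integrable setT (EFin \o abel).
Proof.
apply/integrableP; split; first by apply/measurable_EFinP; exact: measurable_abel.
under eq_integral do rewrite /= ger0_norm ?abel_ge0//.
by rewrite integral_abel ltry.
Qed.

Lemma continuous_poisson : continuous (fun x : R => 2 * (1 + x ^+ 2)^-1).
Proof. by move=> x; apply: cvgM; [exact: cvg_cst|exact: continuous_oneDsqrV]. Qed.

(** This total mass is the origin of the factor [2 * pi] in [plancherel]. *)
Lemma integral_poisson : (\int[mu]_x (2 * (1 + x ^+ 2)^-1)%:E = (2 * pi)%:E)%E.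
Proof.
rewrite ge0_symfun_integralT.
- rewrite -set_itvcy; under eq_integral do rewrite EFinM.
  rewrite ge0_integralZl//; first last.
  + by move=> x _; rewrite lee_fin invr_ge0 addr_ge0// sqr_ge0.
  + apply/measurable_EFinP; apply: measurable_funTS.
    by apply: continuous_measurable_fun; exact: continuous_oneDsqrV.
  by rewrite integral0y_oneDsqr -!EFinM; congr EFin; field.
- by move=> x; rewrite mulr_ge0// invr_ge0 addr_ge0// sqr_ge0.
- exact: continuous_poisson.
- by move=> x; rewrite /= sqrrN.
Qed.

Lemma integrable_poisson :
  mu.-integrable setT (fun x => (2 * (1 + x ^+ 2)^-1)%:E).
Proof.
apply/integrableP; split.
  apply/measurable_EFinP; apply: continuous_measurable_fun.
  exact: continuous_poisson.
under eq_integral do rewrite /= ger0_norm ?mulr_ge0 ?invr_ge0 ?addr_ge0 ?sqr_ge0//.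
by rewrite integral_poisson ltry.
Qed.

End abel_kernel.

Lemma cintegrable_cintegral d1 d2 (T1 : measurableType d1)
  (T2 : measurableType d2) (R : realType)
  (m1 : {sigma_finite_measure set T1 -> \bar R})
  (m2 : {sigma_finite_measure set T2 -> \bar R}) (F : T1 * T2 -> R[i]) :
  cintegrable (m1 \x m2)%E setT F ->
  cintegrable m1 setT (fun x => cintegral m2 setT (fun y => F (x, y))).
Proof.
move=> iF; have mF := cintegrable_measurable iF.
have [_ Foo] := (cintegrableP _ F measurableT).1 iF.
apply/cintegrableP => //; split; first exact: cmeasurable_cintegral.
rewrite fubini_tonelli1 in Foo; first last.
- by move=> z; rewrite lee_fin normc_ge0.
- exact/measurable_EFinP/measurable_normc.
apply: le_lt_trans Foo; apply: ge0_le_integral => //.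
- by move=> x _; rewrite lee_fin normc_ge0.
- by apply/measurable_EFinP; apply: measurable_normc; exact: cmeasurable_cintegral.
- apply: (measurable_fun_fubini_tonelli_F (fun z => (normc (F z))%:E)).
    exact/measurable_EFinP/measurable_normc.
  by move=> z; rewrite lee_fin normc_ge0.
- move=> x _; apply: le_normc_cintegral_lee => //.
  exact: (cmeasurableT_comp mF (pair1_measurable x)).
Qed.

Lemma conjc_mul (R : realType) (u v : R[i]) : (u * v)^J = u^J * v^J.
Proof. exact: (rmorphM (@conjc R)). Qed.

Lemma cintegrableM_bounded d (T : measurableType d) (R : realType)
  (mu : {measure set T -> \bar R}) (D : set T) (f g : T -> R[i]) (M : R) :
  measurable D -> cintegrable mu D f -> cmeasurable D g ->
  (forall x, D x -> normc (g x) <= M) -> cintegrable mu D (fun x => f x * g x).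
Proof.
move=> mD fi mg gM; have mf := cintegrable_measurable fi.
apply: (@le_cintegrable _ _ _ mu D _ (fun x => M * normc (f x)) mD).
- exact: cmeasurableM.
- by move=> x Dx; rewrite normc_mul mulrC ler_wpM2r ?normc_ge0// gM.
- exact: (integrableZl mD M (cintegrable_normc mD fi)).
Qed.

(** * Fourier transform and correlation of integrable functions *)

Section fourier.
Context {R : realType}.
Local Notation mu := (@lebesgue_measure R).
Implicit Types (f g h phi : R -> R[i]).

Definition fourier f (w : R) : R[i] :=
  cintegral mu setT (fun x => f x * expi (- (w * x))).

(** Correlation serves twice: the wavelet transform at a fixed scale is one up to a factor, and
    [corr k k] has Fourier transform [|fourier k|^2] and value the squared norm of [k] at 0, which
    leads to Plancherel. *)
Definition corr h phi (t : R) : R[i] :=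
  cintegral mu setT (fun y => h (y + t) * (phi y)^J).

Lemma cintegrable_translate f (b : R) : cintegrable mu setT f ->
  cintegrable mu setT (fun x => f (x + b)).
Proof.
by move=> /(cintegrable_affine b (oner_neq0 R)); under eq_fun do rewrite mul1r.
Qed.

Lemma cintegral_translate f (b : R) : cintegrable mu setT f ->
  cintegral mu setT (fun x => f (x + b)) = cintegral mu setT f.
Proof.
move=> /(cintegral_affine b (oner_neq0 R)); under eq_fun do rewrite mul1r.
by rewrite normr1 invr1 mul1r.
Qed.

Lemma ge0_integral_translate (F : R -> \bar R) (b : R) :
  measurable_fun setT F -> (forall x, 0 <= F x)%E ->
  (\int[mu]_x F (x + b)%R = \int[mu]_x F x)%E.
Proof.
move=> mF F0; have := ge0_integral_affine b (oner_neq0 R) mF F0.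
by under eq_integral do rewrite mul1r; rewrite normr1 invr1 mul1e.
Qed.

Lemma cintegrable_fourier_kernel f (w : R) : cintegrable mu setT f ->
  cintegrable mu setT (fun x => f x * expi (- (w * x))).
Proof.
move=> fi; apply: (cintegrableM_bounded (M := 1)) => //.
- apply: cmeasurable_expi; apply: measurableT_comp => //.
- by move=> x _; rewrite normc_expi.
Qed.

Lemma cmeasurable_fourier f : cmeasurable setT f ->
  cmeasurable setT (fourier f).
Proof.
move=> mf; apply: (cmeasurable_cintegral mu
  (F := fun z : R * R => f z.2 * expi (- (z.1 * z.2)))).
apply: cmeasurableM.
  exact: (cmeasurableT_comp mf measurable_snd).
apply: cmeasurable_expi; apply: measurableT_comp => //.
exact: measurable_funM.
Qed.

Lemma normc_fourier_le f (w : R) : cintegrable mu setT f ->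
  normc (fourier f w) <= \int[mu]_x normc (f x).
Proof.
move=> fi; have := le_normc_cintegral measurableT (cintegrable_fourier_kernel w fi).
by under eq_Rintegral do rewrite normc_mul normc_expi mulr1.
Qed.

Lemma cintegrable_corr_kernel h phi : cintegrable mu setT h ->
  cintegrable mu setT phi -> cintegrable (mu \x mu)%E setT
    (fun z : R * R => h (z.2 + z.1) * (phi z.2)^J).
Proof.
move=> hi phii; have mh := cintegrable_measurable hi.
have mphi := cintegrable_measurable phii.
have mF : cmeasurable setT (fun z : R * R => h (z.2 + z.1) * (phi z.2)^J).
  apply: cmeasurableM.
    by apply: (cmeasurableT_comp mh); exact: measurable_funD.
  by apply: cmeasurableJ; exact: (cmeasurableT_comp mphi measurable_snd).
apply/cintegrableP => //; split => //.
(* Integrating in [t] first, translation invariance makes the double integral factor. *)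
rewrite fubini_tonelli2/=; first last.
- by move=> z; rewrite lee_fin normc_ge0.
- exact/measurable_EFinP/measurable_normc.
have [_ hoo] := (cintegrableP mu h measurableT).1 hi.
have [_ phoo] := (cintegrableP mu phi measurableT).1 phii.
have mnh : measurable_fun setT (fun x => (normc (h x))%:E).
  exact/measurable_EFinP/measurable_normc.
have mnp : measurable_fun setT (fun x => (normc (phi x))%:E).
  exact/measurable_EFinP/measurable_normc.
rewrite (_ : (\int[mu]_y _)%E =
  (\int[mu]_x (normc (h x))%:E * \int[mu]_y (normc (phi y))%:E)%E).
  by rewrite lte_mul_pinfty// ?integral_ge0// ?ge0_fin_numE//
     ?integral_ge0// => x _; rewrite lee_fin normc_ge0.
rewrite -ge0_integralZl//; first last.
- by apply: integral_ge0 => x _; rewrite lee_fin normc_ge0.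
- by move=> x _; rewrite lee_fin normc_ge0.
apply: eq_integral => y _; rewrite /fubini_G/=.
under eq_integral do rewrite normc_mul normc_conj mulrC EFinM addrC.
rewrite ge0_integralZl//; first last.
- by rewrite lee_fin normc_ge0.
- by move=> x _; rewrite lee_fin normc_ge0.
- apply/measurable_EFinP; apply: measurable_normc.
  by apply: (cmeasurableT_comp mh); exact: measurable_funD.
rewrite muleC; congr (_ * _)%E.
apply: (ge0_integral_translate (F := fun x => (normc (h x))%:E)) => //.
by move=> x; rewrite lee_fin normc_ge0.
Qed.

Lemma cintegrable_corr h phi : cintegrable mu setT h ->
  cintegrable mu setT phi -> cintegrable mu setT (corr h phi).
Proof.
by move=> hi phii; exact: cintegrable_cintegral (cintegrable_corr_kernel hi phii).
Qed.

Lemma cintegrable_corr_section h phi (M t : R) : cmeasurable setT h ->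
  (forall x, normc (h x) <= M) -> cintegrable mu setT phi ->
  cintegrable mu setT (fun y => h (y + t) * (phi y)^J).
Proof.
move=> mh hM phii; under eq_fun do rewrite mulrC.
apply: (cintegrableM_bounded (M := M)) => //; first exact: cintegrableJ.
by apply: (cmeasurableT_comp mh); exact: measurable_funD.
Qed.

(** Fubini, after the character is split along [t = (t + y) - y]; the part in [y] is absorbed by the
    conjugate transform of [phi]. *)
Lemma fourier_corr h phi (M w : R) : cintegrable mu setT h ->
  (forall x, normc (h x) <= M) -> cintegrable mu setT phi ->
  fourier (corr h phi) w = fourier h w * (fourier phi w)^J.
Proof.
move=> hi hM phii; have mh := cintegrable_measurable hi.
have mphi := cintegrable_measurable phii.
have iK := cintegrable_corr_kernel hi phii.
have iKe : cintegrable (mu \x mu)%E setT (fun z : R * R =>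
    h (z.2 + z.1) * (phi z.2)^J * expi (- (w * z.1))).
  apply: (cintegrableM_bounded (M := 1)) => //.
    by apply: cmeasurable_expi; apply: measurableT_comp => //; exact: measurableT_comp.
  by move=> x _; rewrite normc_expi.
transitivity (cintegral mu setT (fun t => cintegral mu setT (fun y =>
    h (y + t) * (phi y)^J * expi (- (w * t))))).
  apply: eq_cintegral => t _; rewrite /corr mulrC.
  rewrite -cintegralZ//; last exact: cintegrable_corr_section hM phii.
  by apply: eq_cintegral => y _; exact: mulrC.
rewrite (cFubini iKe)/=.
have wE t y : h (y + t) * (phi y)^J * expi (- (w * t)) =
    (phi y * expi (- (w * y)))^J * (h (t + y) * expi (- (w * (t + y)))).

  rewrite conjc_mul -expiN opprK (addrC y).
  have -> : expi (- (w * t)) = expi (w * y) * expi (- (w * (t + y))) :> R[i].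
    by rewrite -expiD; congr expi; ring.
  by rewrite !mulrA; congr (_ * _); rewrite -!mulrA mulrC -!mulrA.
transitivity (cintegral mu setT (fun y =>
    fourier h w * (phi y * expi (- (w * y)))^J)).
  apply: eq_cintegral => y _.
  under eq_cintegral do rewrite wE.
  have hw := cintegrable_fourier_kernel w hi.
  rewrite cintegralZ//; last exact: (cintegrable_translate y hw).
  by rewrite (cintegral_translate y hw) mulrC.
have pw := cintegrable_fourier_kernel w phii.
rewrite cintegralZ//; last exact: cintegrableJ.
by rewrite cintegralJ.
Qed.
End fourier.

Section plancherel.
Context {R : realType}.
Local Notation mu := (@lebesgue_measure R).
Implicit Types (f g h phi k : R -> R[i]).

(** Continuity enters only through dominated convergence along sequences, so the sequential form
    suffices; written with [normc] it involves no topology on [R[i]]. *)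
Definition seq_continuous f := forall (s : nat -> R) x,
  s n @[n --> \oo] --> x -> normc (f (s n) - f x) @[n --> \oo] --> 0.

Lemma corr_le h phi (M t : R) : cmeasurable setT h ->
  (forall x, normc (h x) <= M) -> cintegrable mu setT phi ->
  normc (corr h phi t) <= M * \int[mu]_x normc (phi x).
Proof.
move=> mh hM phii.
have hi := cintegrable_corr_section t mh hM phii.
have pn := cintegrable_normc measurableT phii.
apply: le_trans (le_normc_cintegral measurableT hi) _.
rewrite -RintegralZl//; apply: le_Rintegral => //.
- exact: cintegrable_normc.
- exact: (integrableZl measurableT M pn).
- by move=> x _; rewrite normc_mul normc_conj ler_wpM2r ?normc_ge0.
Qed.

Lemma seq_continuous_corr h phi (M : R) : cmeasurable setT h ->
  (forall x, normc (h x) <= M) -> seq_continuous h -> cintegrable mu setT phi ->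
  seq_continuous (corr h phi).
Proof.
move=> mh hM hc phii s t st; have mphi := cintegrable_measurable phii.
have pn := cintegrable_normc measurableT phii.
have mF (r : R) : cmeasurable setT (fun y : R => h (y + r) * (phi y)^J).
  apply: cmeasurableM; last exact: cmeasurableJ.
  by apply: (cmeasurableT_comp mh); exact: measurable_funD.
apply: (@cintegral_dominated _ _ _ mu setT
    (fun n (y : R) => h (y + s n) * (phi y)^J) (fun y : R => h (y + t) * (phi y)^J)
    (fun y => M * normc (phi y))) => //.
- by move=> n; exact: mF.
- exact: mF.
- move=> y _.
  have -> : (fun n => normc (h (y + s n) * (phi y)^J - h (y + t) * (phi y)^J)) =
      (fun n => normc (h (y + s n) - h (y + t)) * normc (phi y)^J).
    by apply/funext => n; rewrite -mulrBl normc_mul.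
  rewrite -[X in _ --> X](mul0r (normc (phi y)^J)).
  apply: cvgM; last exact: cvg_cst.
  by apply: (hc (fun n => y + s n)); apply: cvgD => //; exact: cvg_cst.
- exact: (integrableZl measurableT M pn).
- by move=> n y _; rewrite normc_mul normc_conj ler_wpM2r ?normc_ge0.
Qed.

(** The multiplication formula: both sides are iterated integrals of [F], which is integrable on the
    product because the kernel is unimodular. *)
Lemma cintegral_fourier_swap f g : cintegrable mu setT f ->
  cintegrable mu setT g ->
  cintegral mu setT (fun w => fourier f w * g w) =
  cintegral mu setT (fun x => f x * fourier g x).
Proof.
move=> fi gi; have mf := cintegrable_measurable fi.
have mg := cintegrable_measurable gi.
pose F (z : R * R) : R[i] := f z.2 * g z.1 * expi (- (z.1 * z.2)).
have mF : cmeasurable setT F.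
  apply: cmeasurableM; first apply: cmeasurableM.
  - exact: (cmeasurableT_comp mf measurable_snd).
  - exact: (cmeasurableT_comp mg measurable_fst).
  - apply: cmeasurable_expi; apply: measurableT_comp => //.
    exact: measurable_funM.
have iF : cintegrable (mu \x mu)%E setT F.
  apply: cintegrable_prodP => //.
  have [_ foo] := (cintegrableP mu f measurableT).1 fi.
  have [_ goo] := (cintegrableP mu g measurableT).1 gi.
  rewrite (_ : (\int[mu]_y _)%E =
    (\int[mu]_x (normc (f x))%:E * \int[mu]_y (normc (g y))%:E)%E).
    by rewrite lte_mul_pinfty// ?integral_ge0// ?ge0_fin_numE//
       ?integral_ge0// => x _; rewrite lee_fin normc_ge0.
  rewrite -ge0_integralZl//; first last.
  - by apply: integral_ge0 => x _; rewrite lee_fin normc_ge0.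
  - by move=> x _; rewrite lee_fin normc_ge0.
  - exact/measurable_EFinP/measurable_normc.
  apply: eq_integral => w _.
  under eq_integral do rewrite /F/= 2!normc_mul normc_expi mulr1 mulrC EFinM.
  rewrite ge0_integralZl//; first by rewrite muleC.
  - exact/measurable_EFinP/measurable_normc.
  - by move=> x _; rewrite lee_fin normc_ge0.
  - by rewrite lee_fin normc_ge0.
transitivity (cintegral mu setT (fun w => cintegral mu setT (fun x => F (w, x)))).
  apply: eq_cintegral => w _; rewrite mulrC -cintegralZ//.
    by apply: eq_cintegral => x _; rewrite /F/= mulrCA mulrA.
  exact: cintegrable_fourier_kernel.
rewrite (cFubini iF).
apply: eq_cintegral => x _; rewrite -cintegralZ//.
  by apply: eq_cintegral => w _; rewrite /F/= mulrA (mulrC w).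
exact: cintegrable_fourier_kernel.
Qed.

Lemma cintegral_real (f : R -> R) :
  cintegral mu setT (fun x => (f x)%:C) = (\int[mu]_x f x)%:C.
Proof.
apply/eqP; rewrite eq_complex /= eqxx/=; apply/eqP.
by rewrite /Rintegral integral0.
Qed.

Lemma cintegrable_real (f : R -> R) : mu.-integrable setT (EFin \o f) ->
  cintegrable mu setT (fun x => (f x)%:C).
Proof. by move=> fi; split => //=; exact: integrable0. Qed.

Lemma fourier_abel (u : R) :
  fourier (fun x => (abel x)%:C) u = (2 * (1 + u ^+ 2)^-1)%:C.
Proof.
have ia := @integrable_abel R.
have iac : cintegrable mu setT (fun x => (abel x)%:C) by exact: cintegrable_real.
have [i1 i2] := cintegrable_fourier_kernel u iac.
have E1 x : complex.Re ((abel x)%:C * expi (- (u * x))) = abel x * cos (u * x).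
  by rewrite /= mul0r subr0 cosN.
have E2 x : complex.Im ((abel x)%:C * expi (- (u * x))) = - (abel x * sin (u * x)).
  by rewrite /= mul0r addr0 sinN mulrN.
have j1 : mu.-integrable setT (EFin \o (fun x => abel x * cos (u * x))).
  by apply: eq_integrable i1 => // x _; rewrite E1.
have j2 : mu.-integrable setT (EFin \o (fun x => - (abel x * sin (u * x)))).
  by apply: eq_integrable i2 => // x _; rewrite E2.
rewrite /fourier /cintegral; apply/eqP; rewrite eq_complex.
apply/andP; split; apply/eqP.
- transitivity (\int[mu]_x (abel x * cos (u * x))).
    by apply: eq_Rintegral => x _; rewrite E1.
  have : \int[mu]_x (abel x * (1 + cos (u * x))) = 2 * (1 + (1 + u ^+ 2)^-1).
    by rewrite /Rintegral integral_abel_cos.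
  under eq_Rintegral do rewrite mulrDr mulr1.
  rewrite RintegralD// [X in X + _](_ : _ = 2); last first.
    by rewrite /Rintegral integral_abel.
  by rewrite mulrDr mulr1 => /addrI.
- transitivity (\int[mu]_x (- (abel x * sin (u * x)))).
    by apply: eq_Rintegral => x _; rewrite E2.
  (* The imaginary part is the integral of an odd function; the substitution by [- x] shows that it
     is its own opposite. *)
  have m1 : -1 != 0 :> R by rewrite oppr_eq0 oner_eq0.
  have := Rintegral_affine 0 m1 j2.
  rewrite normrN1 invr1 mul1r.
  have -> : \int[mu]_x - (abel (-1 * x + 0) * sin (u * (-1 * x + 0))) =
      - \int[mu]_x - (abel x * sin (u * x)).
    rewrite -[RHS]mulN1r -RintegralZl//.
    apply: eq_Rintegral => x _.
    by rewrite addr0 mulN1r abelN mulrN sinN mulN1r mulrN.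
  by set I := Rintegral _ _ _; move=> h; rewrite /=; lra.
Qed.

End plancherel.

(** * Plancherel's formula by Abel summation *)

Section plancherel.
Context {R : realType}.
Local Notation mu := (@lebesgue_measure R).
Variables (k : R -> R[i]) (M : R).
Hypothesis ki : cintegrable mu setT k.
Hypothesis kM : forall x, normc (k x) <= M.
Hypothesis kc : seq_continuous k.

Let r := corr k k.
Let mk : cmeasurable setT k. Proof. exact: cintegrable_measurable ki. Qed.
Let ri : cintegrable mu setT r. Proof. exact: cintegrable_corr. Qed.
Let mr : cmeasurable setT r. Proof. exact: cintegrable_measurable ri. Qed.
Let N := M * \int[mu]_x normc (k x).
Let rN x : normc (r x) <= N. Proof. exact: corr_le. Qed.
Let fk w := normc (fourier k w) ^+ 2.
Let mfk : measurable_fun setT fk.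
Proof. by apply: measurable_normc_sqr; exact: cmeasurable_fourier. Qed.
Let fourier_r w : fourier r w = (fk w)%:C.
Proof. by rewrite /r (fourier_corr w ki kM ki) mulcJ. Qed.

(** Abel means of [|fourier k|^2] are Poisson means of the autocorrelation [r] at scale [e]: the
    multiplication formula is applied to the dilate of [r] and to [abel], whose transform is the
    Poisson kernel. *)
Let abelized (e : R) (e0 : 0 < e) :
  (complex.Re (cintegral mu setT
     (fun s => r (e * s + 0) * (2 * (1 + s ^+ 2)^-1)%:C)))%:E =
  (\int[mu]_w (fk w * abel (e * w))%:E)%E.
Proof.
have fk0 w : 0 <= fk w by exact: sqr_ge0.
clearbody fk.
have en0 : e != 0 by rewrite gt_eqF.
have iac : cintegrable mu setT (fun x : R => (abel x)%:C).
  exact/cintegrable_real/integrable_abel.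
pose rn x := r (e * x + 0).
have rni : cintegrable mu setT rn by exact: cintegrable_affine.
under eq_cintegral do rewrite -fourier_abel.
rewrite -[X in complex.Re X](cintegral_fourier_swap rni iac).
have frn w : fourier rn w = (e^-1 * fk (e^-1 * w + 0))%:C.
  have ie := cintegrable_fourier_kernel (e^-1 * w) ri.
  have := cintegral_affine 0 en0 ie.
  rewrite -/(fourier r _) fourier_r gtr0_norm// => h.
  rewrite addr0 rmorphM/= -h; apply: eq_cintegral => x _.
  rewrite /rn addr0; congr (_ * expi (- _)).
  by rewrite mulrACA mulVf// mul1r.
pose G w := e^-1 * fk (e^-1 * w + 0) * abel w.
have GE w : fourier rn w * (abel w)%:C = (G w)%:C by rewrite frn -rmorphM.
have iG : cintegrable mu setT (fun w => (G w)%:C).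
  under eq_fun do rewrite -GE mulrC.
  apply: (cintegrableM_bounded (M := \int[mu]_x normc (rn x)) _ iac) => //.
    by apply: cmeasurable_fourier; exact: cintegrable_measurable rni.
  by move=> w _; exact: normc_fourier_le.
under eq_cintegral do rewrite GE.
rewrite cintegral_real [complex.Re _]/= (EFin_Rintegral measurableT iG.1).
pose F w := (fk w * abel (e * w))%:E.
have mF : measurable_fun setT F.
  apply/measurable_EFinP; apply: measurable_funM => //.
  by apply: measurableT_comp; [exact: measurable_abel|].
have F0 w : (0 <= F w)%E by rewrite lee_fin mulr_ge0 ?abel_ge0.
have ei0 : e^-1 != 0 by rewrite invr_eq0.
have ei : `|e^-1|^-1 = e by rewrite normfV invrK gtr0_norm.
(* The substitution [w -> w / e] moves the dilation from [abel] to [fk]. *)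
have := ge0_integral_affine 0 ei0 mF F0; rewrite ei => FE.
transitivity ((e^-1)%:E * \int[mu]_x F (e^-1 * x + 0)%R)%E; last first.
  by rewrite FE muleA -EFinM mulVf// mul1e.
rewrite -ge0_integralZl//; last 2 first.
- by apply: (measurableT_comp mF); exact: measurable_funD.
- by rewrite lee_fin invr_ge0 ltW.
apply: eq_integral => w _; rewrite /F -EFinM /G; congr EFin.
have -> : e * (e^-1 * w + 0) = w by rewrite addr0 mulrA divff// mul1r.
by rewrite -mulrA.
Qed.

(** As [e] decreases to 0, the Poisson means tend to [2 * pi * r 0] by dominated convergence, since
    [r] is bounded and continuous, while the Abel means increase to the full integral by monotone
    convergence. Square integrability of [fourier k] is thus obtained, not assumed. *)
Lemma plancherel : (\int[mu]_w (normc (fourier k w) ^+ 2)%:E =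
  (2 * pi)%:E * \int[mu]_x (normc (k x) ^+ 2)%:E)%E.
Proof.
pose e n : R := n.+1%:R^-1.
have e0 n : 0 < e n by rewrite invr_gt0.
have er : e n @[n --> \oo] --> 0 by exact: cvg_harmonic.
pose J n := cintegral mu setT
  (fun s => r (e n * s + 0) * (2 * (1 + s ^+ 2)^-1)%:C).
have mp : cmeasurable setT (fun s : R => (2 * (1 + s ^+ 2)^-1)%:C).
  apply: cmeasurable_real; apply: continuous_measurable_fun.
  exact: continuous_poisson.
have ip := @integrable_poisson R.
have ipc : cintegrable mu setT (fun s : R => (2 * (1 + s ^+ 2)^-1)%:C).
  exact: cintegrable_real.
have p0 (s : R) : 0 <= 2 * (1 + s ^+ 2)^-1.
  by rewrite mulr_ge0// invr_ge0 addr_ge0// sqr_ge0.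
have JN : normc (J n - r 0 * (2 * pi)%:C) @[n --> \oo] --> 0.
  have -> : r 0 * (2 * pi)%:C =
      cintegral mu setT (fun s => r 0 * (2 * (1 + s ^+ 2)^-1)%:C).
    by rewrite cintegralZ// cintegral_real /Rintegral integral_poisson.
  apply: (@cintegral_dominated _ _ _ mu setT _ _
    (fun s => N * (2 * (1 + s ^+ 2)^-1))) => //.
  - move=> n; apply: cmeasurableM => //; apply: (cmeasurableT_comp mr).
    exact: measurable_funD.
  - exact: cmeasurableZ.
  - move=> s _.
    have -> : (fun n => normc (r (e n * s + 0) * (2 * (1 + s ^+ 2)^-1)%:C -
        r 0 * (2 * (1 + s ^+ 2)^-1)%:C)) =
        (fun n => normc (r (e n * s + 0) - r 0) * (2 * (1 + s ^+ 2)^-1)).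
      by apply/funext => n; rewrite -mulrBl normc_mul normc_real ger0_norm.
    rewrite -[X in _ --> X](mul0r (2 * (1 + s ^+ 2)^-1)).
    apply: cvgM; last exact: cvg_cst.
    apply: (seq_continuous_corr mk kM kc ki (s := fun n => e n * s + 0)).
    rewrite -[X in _ --> X](addr0 0) -[X in _ --> X + _](mul0r s).
    by apply: cvgD; [apply: cvgM => //; exact: cvg_cst|exact: cvg_cst].
  - exact: (integrableZl measurableT N ip).
  - move=> n s _; rewrite normc_mul normc_real ger0_norm//.
    by rewrite ler_wpM2r.
have k2 : mu.-integrable setT (EFin \o (fun y => normc (k y) ^+ 2)).
  have kk : cintegrable mu setT (fun y => k y * k y).
    by apply: (cintegrableM_bounded (M := M)).
  apply: eq_integrable (cintegrable_normc measurableT kk) => // y _ /=.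
  by rewrite normc_mul -expr2.
have r0 : r 0 = (\int[mu]_x (normc (k x) ^+ 2))%:C.
  rewrite -cintegral_real /r /corr; apply: eq_cintegral => y _.
  by rewrite addr0 mulcJ.
rewrite -(EFin_Rintegral measurableT k2) -EFinM.
have reJ : complex.Re (J n) @[n --> \oo] --> 2 * pi * \int[mu]_x (normc (k x) ^+ 2).
  apply/subr_cvg0; apply: norm_cvg0.
  apply: squeeze_cvgr (cvg_cst 0) JN; apply: nearW => n; rewrite normr_ge0/=.
  have -> : complex.Re (J n) - 2 * pi * \int[mu]_x (normc (k x) ^+ 2) =
      complex.Re (J n - r 0 * (2 * pi)%:C).
    by rewrite r0 -rmorphM raddfB /=; congr (_ - _); exact: mulrC.
  exact: normr_Re_le.
pose F n w := (fk w * abel (e n * w))%:E.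
have lim1 : (\int[mu]_w F n w)%E @[n --> \oo] -->
    (2 * pi * \int[mu]_x (normc (k x) ^+ 2))%:E.
  have -> : (fun n => (\int[mu]_w F n w)%E) = EFin \o (fun n => complex.Re (J n)).
    by apply/funext => n /=; rewrite (abelized (e0 n)).
  by apply: cvg_EFin => //; near=> n.
have lim2 : (\int[mu]_w F n w)%E @[n --> \oo] --> (\int[mu]_w (fk w)%:E)%E.
  have -> : (\int[mu]_w (fk w)%:E = \int[mu]_w limn (F ^~ w))%E.
    apply: eq_integral => w _; apply/esym/cvg_lim => //.
    apply: cvg_EFin; first by near=> n.
    rewrite -[X in _ --> X]mulr1; apply: cvgM; first exact: cvg_cst.
    have -> : 1 = abel (0 * w) :> R by rewrite /abel mul0r normr0 oppr0 expR0.
    apply: continuous_cvg; first exact: continuous_abel.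
    by apply: cvgM => //; exact: cvg_cst.
  apply: cvg_monotone_convergence => //.
  - move=> n; apply/measurable_EFinP; apply: measurable_funM => //.
    by apply: measurableT_comp; [exact: measurable_abel|].
  - by move=> n w _; rewrite lee_fin mulr_ge0 ?sqr_ge0 ?abel_ge0.
  - move=> w _ m n mn; rewrite lee_fin ler_wpM2l ?sqr_ge0// /abel ler_expR.
    rewrite lerN2 !normrM ler_wpM2r// !gtr0_norm ?e0// lef_pV2 ?posrE//.
    by rewrite ler_nat ltnS.
exact: (cvg_unique _ lim2 lim1).
Unshelve. all: by end_near. Qed.

End plancherel.

Lemma measurable_invr (R : realType) : measurable_fun [set: R] (@GRing.inv R).
Proof.
have -> : [set: R] = [set 0] `|` ~` [set 0] by rewrite setUv.
apply/measurable_funU => //; first exact: measurableC.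
split; first exact: measurable_fun_set1.
apply: open_continuous_measurable_fun; first exact: closed_openC.
move=> x; rewrite inE /= => x0; apply: cvgV => //.
exact/eqP.
Qed.

Lemma integralZl_sqr_normc d (T : measurableType d) (R : realType)
  (mu : {measure set T -> \bar R}) (D : set T) (f : T -> R[i]) (c : R) :
  measurable D -> cmeasurable D f -> 0 <= c ->
  (\int[mu]_(x in D) (c * normc (f x) ^+ 2)%:E =
   c%:E * \int[mu]_(x in D) (normc (f x) ^+ 2)%:E)%E.
Proof.
move=> mD mf c0; under eq_integral do rewrite EFinM.
rewrite ge0_integralZl//.
- exact/measurable_EFinP/measurable_normc_sqr.
- by move=> x _; rewrite lee_fin sqr_ge0.
Qed.

(** * Extension of isometries to L^2 limits *)

Section isometry_limit.
Context {d1 d2 : measure_display} {X : measurableType d1}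
  {Y : measurableType d2} {R : realType}.
Variables (mu : {measure set X -> \bar R}) (nu : {measure set Y -> \bar R}).

Lemma cvg_sqr_integral (D : set X) (v_ : nat -> X -> R[i]) (v : X -> R[i]) :
  measurable D -> (forall n, cmeasurable D (v_ n)) -> cmeasurable D v ->
  (\int[mu]_(x in D) (normc (v x) ^+ 2)%:E < +oo)%E ->
  (\int[mu]_(x in D) (normc (v_ n x - v x) ^+ 2)%:E)%E @[n --> \oo] --> 0%E ->
  (\int[mu]_(x in D) (normc (v_ n x) ^+ 2)%:E)%E @[n --> \oo] -->
  (\int[mu]_(x in D) (normc (v x) ^+ 2)%:E)%E.
Proof.
move=> mD mv_ mv voo /fine_cvgP[vvfin vv].
have I0 (w : X -> R[i]) : (0 <= \int[mu]_(x in D) (normc (w x) ^+ 2)%:E)%E.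
  by apply: integral_ge0 => x _; rewrite lee_fin sqr_ge0.
have [V VE] : exists V : R,
    (\int[mu]_(x in D) (normc (v x) ^+ 2)%:E = V%:E)%E.
  exists (fine (\int[mu]_(x in D) (normc (v x) ^+ 2)%:E)%E).
  by rewrite fineK// ge0_fin_numE.
have V0 : 0 <= V by rewrite -lee_fin -VE.
have small (e : R) : 0 < e -> \forall n \near \oo,
    (\int[mu]_(x in D) (normc (v_ n x - v x) ^+ 2)%:E <= (e ^+ 2)%:E)%E.
  move=> e0; have e20 : 0 < e ^+ 2 by rewrite exprn_gt0.
  move/cvgrPdist_le : vv => /(_ _ e20) h; near=> n.
  rewrite -[leLHS]fineK; last by near: n.
  rewrite lee_fin (le_trans (ler_norm _))// -normrN -[X in `|X|]add0r.
  by near: n.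
have eE (e : R) : 0 < e -> (1 + e^-1) * e ^+ 2 = e ^+ 2 + e.
  by move=> e0; field; rewrite gt_eqF.
(* The weighted inequality is used in both directions; since [a <= 2 * V + 2], the error
   [e * a + e ^+ 2 + e] is at most [e * (2 * V + 4)]. *)
have up (e : R) n : 0 < e -> e <= 1 ->
    (\int[mu]_(x in D) (normc (v_ n x - v x) ^+ 2)%:E <= (e ^+ 2)%:E)%E ->
    exists2 a : R, (\int[mu]_(x in D) (normc (v_ n x) ^+ 2)%:E = a%:E)%E &
      `|V - a| <= e * (2 * V + 4).
  move=> e0 e1 he.
  have ha : (\int[mu]_(x in D) (normc (v_ n x) ^+ 2)%:E <=
      ((1 + e) * V + (1 + e^-1) * e ^+ 2)%:E)%E.
    under eq_integral => x _ do rewrite -[v_ n x](subrK (v x)) addrC.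
    apply: integral_sqr_normcD_le => //; first exact: cmeasurableB.
    by rewrite VE.
  have [a aE] : exists a : R,
      (\int[mu]_(x in D) (normc (v_ n x) ^+ 2)%:E = a%:E)%E.
    exists (fine (\int[mu]_(x in D) (normc (v_ n x) ^+ 2)%:E)%E).
    by rewrite fineK// ge0_fin_numE// (le_lt_trans ha)// ltry.
  have hV : (\int[mu]_(x in D) (normc (v x) ^+ 2)%:E <=
      ((1 + e) * a + (1 + e^-1) * e ^+ 2)%:E)%E.
    under eq_integral => x _ do
      rewrite -[v x](subKr (v_ n x)) -[_ - (_ - _)]/(_ + _).
    apply: integral_sqr_normcD_le => //.
    - by apply: cmeasurableN; exact: cmeasurableB.
    - by rewrite aE.
    - by under eq_integral do rewrite normcN.
  exists a => //; move: ha hV; rewrite aE VE !lee_fin eE// => ha hV.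
  have e2 : e ^+ 2 <= e by rewrite expr2 ler_piMr// ltW.
  have eV : 0 <= e * V by rewrite mulr_ge0// ltW.
  have a0 : 0 <= a by rewrite -lee_fin -aE.
  have h1 : e * a <= e * (2 * V + 2).
    rewrite ler_pM2l//; apply: (le_trans ha).
    have : e * V <= 1 * V by rewrite ler_wpM2r.
    lra.
  move: ha hV h1; rewrite !mulrDl !mulrDr !mul1r => ha hV h1.
  rewrite ler_distlC; apply/andP; split; lra.
rewrite VE; apply/fine_cvgP; split.
  near=> n.
  have := @up 1 n ltr01 (lexx _).
  case; last by move=> a ->.
  by near: n; exact: small.
apply/cvgrPdist_le => /= e e0.
pose e' := Num.min 1 (e / (2 * V + 5)).
have K0 : 0 < 2 * V + 5 by rewrite ltr_wpDl// mulr_ge0.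
have e'0 : 0 < e' by rewrite lt_min ltr01 divr_gt0.
near=> n.
have [||a aE h] := @up e' n e'0.
- by rewrite ge_min lexx.
- by near: n; exact: small.
rewrite aE /=; apply: (le_trans h).
have : e' * (2 * V + 4) <= e / (2 * V + 5) * (2 * V + 4).
  by rewrite ler_wpM2r ?addr_ge0 ?mulr_ge0// ge_min lexx orbT.
move=> /le_trans; apply; rewrite mulrAC ler_pdivrMr// ler_pM2l//; lra.
Unshelve. all: by end_near. Qed.

(** Used to pass from truncated windows to the full one, and from nice signals to all of L^2. On the
    side of [u_] the limit is identified only pointwise; the isometry on differences supplies the
    Cauchy property that [cauchy_sqr_integral_lim] asks for. *)
Lemma isometry_limit (D : set X) (E : set Y) (v_ : nat -> X -> R[i])
    (v : X -> R[i]) (u_ : nat -> Y -> R[i]) (u : Y -> R[i]) (c : R) :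
  measurable D -> measurable E -> 0 <= c ->
  (forall n, cmeasurable D (v_ n)) -> cmeasurable D v ->
  (forall n, cmeasurable E (u_ n)) -> cmeasurable E u ->
  (forall y, E y -> normc (u_ n y - u y) @[n --> \oo] --> 0) ->
  (\int[mu]_(x in D) (normc (v x) ^+ 2)%:E < +oo)%E ->
  (\int[mu]_(x in D) (normc (v_ n x - v x) ^+ 2)%:E)%E @[n --> \oo] --> 0%E ->
  (forall n, \int[nu]_(y in E) (normc (u_ n y) ^+ 2)%:E =
     c%:E * \int[mu]_(x in D) (normc (v_ n x) ^+ 2)%:E)%E ->
  (forall n m, \int[nu]_(y in E) (normc (u_ n y - u_ m y) ^+ 2)%:E =
     c%:E * \int[mu]_(x in D) (normc (v_ n x - v_ m x) ^+ 2)%:E)%E ->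
  (\int[nu]_(y in E) (normc (u y) ^+ 2)%:E =
     c%:E * \int[mu]_(x in D) (normc (v x) ^+ 2)%:E)%E.
Proof.
move=> mD mE c0 mv_ mv mu_ mu0 uu voo vv uv uvB.
have I0 (w : X -> R[i]) : (0 <= \int[mu]_(x in D) (normc (w x) ^+ 2)%:E)%E.
  by apply: integral_ge0 => x _; rewrite lee_fin sqr_ge0.
have vcvg := cvg_sqr_integral mD mv_ mv voo vv.
have [V VE] : exists V : R,
    (\int[mu]_(x in D) (normc (v x) ^+ 2)%:E = V%:E)%E.
  exists (fine (\int[mu]_(x in D) (normc (v x) ^+ 2)%:E)%E).
  by rewrite fineK// ge0_fin_numE.
rewrite VE -EFinM.
apply: (cauchy_sqr_integral_lim (u_ := u_)) => //.
- move=> e e0.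
  (* Two distances, each doubled by the inequality of weight 1, give the 4; [c + 1] keeps the
     denominator positive when [c = 0]. *)
  have e'0 : 0 < e / (4 * (c + 1)) by rewrite divr_gt0// mulr_gt0// ltr_wpDl.
  move/fine_cvgP : vv => [vvfin /cvgrPdist_le/(_ _ e'0) h].
  have [N _ hN] : \forall n \near \oo,
      (\int[mu]_(x in D) (normc (v_ n x - v x) ^+ 2)%:E <=
        (e / (4 * (c + 1)))%:E)%E.
    near=> n; rewrite -[leLHS]fineK; last by near: n.
    rewrite lee_fin (le_trans (ler_norm _))// -normrN -[X in `|X|]add0r.
    by near: n.
  exists N => n m Nn Nm; rewrite uvB.
  have hnm : (\int[mu]_(x in D) (normc (v_ n x - v_ m x) ^+ 2)%:E <=
      ((1 + 1) * (e / (4 * (c + 1))) + (1 + 1^-1) * (e / (4 * (c + 1))))%:E)%E.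
    under eq_integral => x _ do
      rewrite -[v_ n x](subrK (v x)) -addrA.
    apply: integral_sqr_normcD_le => //.
    - exact: cmeasurableB.
    - exact: cmeasurableB.
    - exact: hN.
    - under eq_integral do rewrite normc_distC.
      exact: hN.
  apply: (@le_trans _ _ (c%:E * ((1 + 1) * (e / (4 * (c + 1))) +
      (1 + 1^-1) * (e / (4 * (c + 1))))%:E)%E).
    by apply: lee_pmul; rewrite ?lee_fin.
  rewrite -EFinM lee_fin invr1.
  have -> : c * ((1 + 1) * (e / (4 * (c + 1))) + (1 + 1) * (e / (4 * (c + 1)))) =
      e * (c / (c + 1)) by field; rewrite gt_eqF// ltr_wpDl.
  apply: ler_piMr; first exact: ltW.
  by rewrite ler_pdivrMr ?ltr_wpDl// mul1r lerDl.
- under eq_fun do rewrite uv.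
  by rewrite EFinM -VE; apply: cvgeZl => //.
Unshelve. all: by end_near. Qed.

End isometry_limit.

(** * The wavelet transform at a fixed scale *)

Section L2_facts.
Context {R : realType}.
Local Notation mu := (@lebesgue_measure R).
Implicit Types (f g : R -> R[i]).

Lemma sqnorm2_ge0 f : (0 <= sqnorm2 f)%E.
Proof. by apply: integral_ge0 => x _; rewrite lee_fin sqr_ge0. Qed.

Lemma L2M_bounded f g (M : R) : L2 f -> cmeasurable setT g ->
  (forall x, normc (g x) <= M) -> L2 (fun x => f x * g x).
Proof.
move=> [mf foo] mg gM; have M0 : 0 <= M := le_trans (normc_ge0 _) (gM 0).
split; first exact: cmeasurableM.
apply: (@le_lt_trans _ _ ((M ^+ 2)%:E * sqnorm2 f)%E); last first.
  by rewrite lte_mul_pinfty ?lee_fin ?sqr_ge0.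
rewrite /sqnorm2 -ge0_integralZl//.
- apply: ge0_le_integral => //.
  + by move=> x _; rewrite lee_fin sqr_ge0.
  + by apply/measurable_EFinP; apply: measurable_normc_sqr; exact: cmeasurableM.
  + by apply: measurable_funeM; exact/measurable_EFinP/measurable_normc_sqr.
  + move=> x _; rewrite lee_fin normc_mul exprMn mulrC ler_wpM2r ?sqr_ge0//.
    by rewrite ler_pXn2r ?nnegrE ?normc_ge0.
- exact/measurable_EFinP/measurable_normc_sqr.
- by move=> x _; rewrite lee_fin sqr_ge0.
- by rewrite lee_fin sqr_ge0.
Qed.

Lemma sqnorm2_affine f (a b : R) : a != 0 -> cmeasurable setT f ->
  sqnorm2 (fun x => f (a * x + b)) = ((`|a|^-1)%:E * sqnorm2 f)%E.
Proof.
move=> a0 mf; apply: (ge0_integral_affine b a0 (F := fun x => (normc (f x) ^+ 2)%:E)).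
  exact/measurable_EFinP/measurable_normc_sqr.
by move=> x; rewrite lee_fin sqr_ge0.
Qed.

Lemma L2_affine f (a b : R) : a != 0 -> L2 f -> L2 (fun x => f (a * x + b)).
Proof.
move=> a0 [mf foo]; split.
  apply: (cmeasurableT_comp mf); apply: measurable_funD => //.
rewrite sqnorm2_affine// lte_mul_pinfty ?lee_fin ?invr_ge0//.
Qed.

Lemma cintegrableM_L2 f g : L2 f -> L2 g -> cintegrable mu setT (fun x => f x * g x).
Proof. by move=> [mf foo] [mg goo]; exact: cintegrableM_sqr. Qed.

Lemma L2J f : L2 f -> L2 (fun x => (f x)^J).
Proof.
move=> [mf foo]; split; first exact: cmeasurableJ.
by rewrite /sqnorm2; under eq_integral do rewrite normc_conj.
Qed.

Lemma L2_indic (a b : R) : L2 (fun x => (\1_(`[a, b]%classic : set R) x)%:C).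
Proof.
split; first exact/cmeasurable_real/measurable_indic.
rewrite /sqnorm2.
have E (x : R) : (normc (\1_(`[a, b]%classic : set R) x : R)%:C ^+ 2)%:E =
    (\1_(`[a, b]%classic : set R) x : R)%:E.
  by rewrite sqr_normc /= expr0n addr0 indicE; case: (_ \in _); rewrite ?expr1n ?expr0n.
under eq_integral do rewrite E.
rewrite integral_indic// setIT.
rewrite [X in (X < _)%E](lebesgue_measure_itv `[a, b])/=.
by case: ifPn => _; rewrite -?EFinB ltry.
Qed.

Lemma seq_continuousM_expi f (g : R -> R) : seq_continuous f -> continuous g ->
  seq_continuous (fun x => f x * expi (g x)).
Proof.
move=> fc gc s x sx.
have ec (c : R -> R) : continuous c -> c (g (s n)) @[n --> \oo] --> c (g x).
  move=> cc; apply: (@cvg_comp _ _ _ (fun n => g (s n)) c _ (nbhs (g x))).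
    by apply: (@cvg_comp _ _ _ s g _ (nbhs x)) => //; exact: gc.
  exact: cc.
have e0 : `|cos (g (s n)) - cos (g x)| + `|sin (g (s n)) - sin (g x)|
    @[n --> \oo] --> (0 : R).
  rewrite -[X in _ --> X](addr0 0); apply: cvgD; rewrite -(@normr0 _ R);
    apply: cvg_norm; apply/subr_cvg0; apply: ec.
    exact: continuous_cos.
  exact: continuous_sin.
have lim : normc (f (s n) - f x) + normc (f x) *
    (`|cos (g (s n)) - cos (g x)| + `|sin (g (s n)) - sin (g x)|)
    @[n --> \oo] --> (0 : R).
  rewrite -[X in _ --> X](addr0 0) -[X in _ --> _ + X](mulr0 (normc (f x))).
  by apply: cvgD; [exact: fc|apply: cvgM => //; exact: cvg_cst].
apply: squeeze_cvgr (cvg_cst 0) lim; apply: nearW => n; rewrite normc_ge0/=.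
have -> : f (s n) * expi (g (s n)) - f x * expi (g x) =
    (f (s n) - f x) * expi (g (s n)) + f x * (expi (g (s n)) - expi (g x)).
  by ring.
apply: (le_trans (le_normcD _ _)); rewrite !normc_mul normc_expi mulr1 lerD2l.
by rewrite ler_wpM2l ?normc_ge0//; exact: normc_le_ReIm.
Qed.

End L2_facts.

(** * The transform at a fixed scale as a correlation *)

Section chirps.
Context {R : realType}.
Local Notation mu := (@lebesgue_measure R).
Variables (A B : R).
Hypothesis B0 : B != 0.

Let a := A / (2 * B).

Definition chirp (f : R -> R[i]) (x : R) : R[i] :=
  f x * expi (A / (2 * B) * x ^+ 2).

Definition window (psi : R -> R[i]) (zeta y : R) : R[i] :=
  psi (y / zeta) * expi (- (A / (2 * B) * y ^+ 2)).

Lemma normc_chirp f x : normc (chirp f x) = normc (f x).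
Proof. by rewrite normc_mul normc_expi mulr1. Qed.

Lemma L2_chirp f : L2 f -> L2 (chirp f).
Proof.
move=> fL; apply: (L2M_bounded (M := 1)) => //.
  apply: cmeasurable_expi; apply: measurable_funM => //.
by move=> x; rewrite normc_expi.
Qed.

Lemma L2_window psi zeta : 0 < zeta -> L2 psi -> L2 (window psi zeta).
Proof.
move=> z0 pL; apply: (L2M_bounded (M := 1)).
- have zi0 : zeta^-1 != 0 by rewrite invr_eq0 gt_eqF.
  have := L2_affine 0 zi0 pL.
  by under eq_fun do rewrite addr0 mulrC.
- apply: cmeasurable_expi; apply: measurableT_comp => //.
  exact: measurable_funM.
- by move=> x; rewrite normc_expi.
Qed.

(** The modulus forgets the branch of the square root, so [B < 0] needs no separate treatment. *)
Lemma normc_KB : normc (KB B) ^+ 2 = (2 * pi * `|B|)^-1.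
Proof.
rewrite /KB Normc.normcV exprVn; congr _^-1.
rewrite expr2 -normc_mul -expr2 sqr_sqrtc normc_real normrM gtr0_norm//.
by rewrite mulr_gt0// pi_gt0.
Qed.

(** The identity [- A x (t - x) / B = a (- t^2 + x^2 + (x - t)^2)] splits the conjugate phase of the
    wavelet into a factor in [t], the chirp of [f], and the conjugate phase of the window at
    [x - t]. *)
Lemma sawtE f psi t zeta : 0 < zeta -> L2 f -> L2 psi ->
  sawt A B psi f t zeta =
  (KB B)^J * ((Num.sqrt zeta)^-1)%:C * expi (- (a * t ^+ 2)) *
    corr (chirp f) (window psi zeta) t.
Proof.
move=> z0 fL pL.
have hL := L2_chirp fL; have wL := L2_window z0 pL.
pose K y := chirp f (y + t) * (window psi zeta y)^J.
have Ki : cintegrable mu setT K.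
  apply: cintegrableM_L2; last exact: L2J.
  by have := L2_affine t (oner_neq0 R) hL; under eq_fun do rewrite mul1r.
rewrite /sawt /corr -(cintegral_translate (- t) Ki) -cintegralZ//; last first.
  exact: cintegrable_translate.
apply: eq_cintegral => x _; rewrite /K subrK conjCE /wavelet /chirp /window.
rewrite !conjc_mul -!expiN.
have -> : (((Num.sqrt zeta)%:C)^-1)^J = ((Num.sqrt zeta)^-1)%:C :> R[i].
  by rewrite -fmorphV conjc_real.
have -> : expi (- (A * x * (t - x) / B)) = expi (- (a * t ^+ 2)) *
    expi (a * x ^+ 2) * expi (- - (a * (x - t) ^+ 2)) :> R[i].
  by rewrite -!expiD; congr expi; rewrite /a; field.
rewrite -/a; ring.
Qed.

Lemma sqr_normc_sawt f psi t zeta : 0 < zeta -> L2 f -> L2 psi ->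
  normc (sawt A B psi f t zeta) ^+ 2 =
  (2 * pi * `|B|)^-1 * zeta^-1 * normc (corr (chirp f) (window psi zeta) t) ^+ 2.
Proof.
move=> z0 fL pL; rewrite sawtE// !normc_mul normc_conj normc_expi mulr1.
rewrite normc_real !exprMn normc_KB; congr (_ * _ * _).
by rewrite real_normK ?num_real// exprVn sqr_sqrtr// ltW.
Qed.

End chirps.

(** * Energy of the transform at one scale *)

Section fixed_scale.
Context {R : realType}.
Local Notation mu := (@lebesgue_measure R).
Variables (A B D p q zeta M : R) (f psi H : R -> R[i]).
Hypotheses (B0 : B != 0) (z0 : 0 < zeta).
Hypotheses (fL : L2 f) (fi : cintegrable mu setT f)
  (fM : forall x, normc (f x) <= M) (fc : seq_continuous f) (pL : L2 psi).
Hypothesis psiH : is_saft A B D p q (fun x => bigpsi A B p psi x zeta) H.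

Let a := A / (2 * B).
Let h := chirp A B f.
Let w := window A B psi zeta.
(** The cut at [n * zeta] matches the interval [-n, n] of the partial SAFT [P n] under the
    substitution [y = - zeta * x]. *)
Let wn (n : nat) (y : R) : R[i] :=
  (\1_(`[- (n%:R * zeta), n%:R * zeta]%classic : set R) y : R)%:C * w y.
Let P (n : nat) (W : R) : R[i] := cintegral mu `[- n%:R, n%:R]
  (fun x => bigpsi A B p psi x zeta * saft_kernel A B D p q x W).

Let hL : L2 h. Proof. exact: L2_chirp. Qed.
Let wL : L2 w. Proof. exact: L2_window. Qed.
Let hM x : normc (h x) <= M. Proof. by rewrite normc_chirp. Qed.
Let mh : cmeasurable setT h. Proof. exact: hL.1. Qed.
Let hi : cintegrable mu setT h.
Proof.
apply: (cintegrableM_bounded (M := 1)) => //.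
  apply: cmeasurable_expi; apply: measurable_funM => //.
by move=> x; rewrite normc_expi.
Qed.
Let hc : seq_continuous h.
Proof.
apply: seq_continuousM_expi => // x; apply: cvgM; first exact: cvg_cst.
exact: exprn_continuous.
Qed.

Let wnL n : L2 (wn n).
Proof.
rewrite /wn; under eq_fun do rewrite mulrC.
apply: (L2M_bounded (M := 1)) => //; first exact: (L2_indic _ _).1.
move=> x.
rewrite -[leLHS]ger0_norm ?normc_ge0// -(@ler_pXn2r _ 2) ?nnegrE// expr1n.
rewrite real_normK ?num_real// sqr_normc /= expr0n addr0 indicE.
by case: (_ \in _); rewrite ?expr1n ?expr0n.
Qed.

Let wni n : cintegrable mu setT (wn n).
Proof. by apply: cintegrableM_L2 => //; exact: L2_indic. Qed.

Let phase (W : R) : R := (- 2 * W * (D * p - B * q) + D * W ^+ 2) / (2 * B).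

(** At the frequency [zeta * (B * v + p)] the linear phases of [bigpsi] and of the kernel add up to
    [- zeta * v * x], the offset [p] cancelling, and the quadratic ones to the phase of the
    conjugate window at [- zeta * x]. What remains is [phase], free of [x]. *)
Let PE n v : P n (zeta * (B * v + p)) =
  (KB B)^J * expi (phase (zeta * (B * v + p))) * (zeta^-1)%:C *
    (fourier (wn n) v)^J.
Proof.
have nz0 : - zeta != 0 by rewrite oppr_eq0 gt_eqF.
have ik := cintegrable_fourier_kernel v (wni n).
have ikJ := cintegrableJ measurableT ik.
rewrite /fourier -cintegralJ// -[RHS]mulrA.
have := cintegral_affine 0 nz0 ikJ.
rewrite normrN gtr0_norm// => <-.
rewrite -cintegralZ//; last exact: cintegrable_affine ikJ.
rewrite /P cintegral_mkcond; apply: eq_cintegral => x _.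
rewrite addr0 /wn /w /window /bigpsi /saft_kernel !conjCE !conjc_mul conjc_real.
have -> : \1_(`[- (n%:R * zeta), n%:R * zeta]%classic : set R) (- zeta * x) =
    \1_(`[- n%:R, n%:R]%classic : set R) x :> R.
  have itvE : (- (n%:R * zeta) <= - zeta * x <= n%:R * zeta) =
      (- n%:R <= x <= n%:R).
    by rewrite mulNr (mulrC zeta) lerN2 ler_pM2r// -mulNr ler_pM2r// lerNl andbC.
  rewrite !indicE; congr ((nat_of_bool _)%:R).
  by apply/idP/idP; rewrite !inE/= !in_itv/= itvE.
have -> : (- zeta * x) / zeta = - x by field; rewrite gt_eqF.
rewrite -!expiN.
have E : expi ((A * x ^+ 2 * (zeta ^+ 2 - 1) + 2 * x * p * (zeta - 1)) / (2 * B)) *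
  expi ((A * x ^+ 2 + 2 * x * (p - zeta * (B * v + p)) -
     2 * (zeta * (B * v + p)) * (D * p - B * q) +
     D * (zeta * (B * v + p)) ^+ 2) / (2 * B)) =
  expi (phase (zeta * (B * v + p))) *
  expi (- - (A / (2 * B) * (- zeta * x) ^+ 2)) *
  expi (- - (v * (- zeta * x))) :> R[i].
  by rewrite -!expiD; congr expi; rewrite /phase; field.
rewrite (_ : forall u1 u2 u3 u4 u5 : R[i], u1 * (u2 * u3 * (u4 * u5)) =
  (u2 * u5) * (u1 * u3 * u4)); last by move=> *; ring.
rewrite E; ring.
Qed.

(** Stated for differences, as the Cauchy property needs; [z2 := 0] gives the modulus of a single
    partial SAFT. *)
Let normc_PB (z1 z2 : R[i]) (W : R) :
  normc ((KB B)^J * expi (phase W) * (zeta^-1)%:C * z1^J -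
         (KB B)^J * expi (phase W) * (zeta^-1)%:C * z2^J) ^+ 2 =
  (2 * pi * `|B|)^-1 * zeta^-1 ^+ 2 * normc (z1 - z2) ^+ 2.
Proof.
rewrite -mulrBr -[z1^J - z2^J](raddfB (@conjc R)) !normc_mul !normc_conj.
by rewrite normc_expi mulr1 normc_real !exprMn normc_KB// real_normK ?num_real.
Qed.

Let mP n : cmeasurable setT (P n).
Proof.
have E W : P n W = (KB B)^J * expi (phase W) * (zeta^-1)%:C *
    (fourier (wn n) ((zeta * B)^-1 * W + - (p / B)))^J.
  rewrite -[in LHS](_ : zeta * (B * ((zeta * B)^-1 * W + - (p / B)) + p) = W).
    rewrite PE; congr (_ * expi (phase _) * _ * _).
    by field; rewrite B0 gt_eqF.
  by field; rewrite B0 gt_eqF.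
rewrite (_ : P n = fun W => (KB B)^J * expi (phase W) * (zeta^-1)%:C *
    (fourier (wn n) ((zeta * B)^-1 * W + - (p / B)))^J); last first.
  by apply/funext => W; exact: E.
apply: cmeasurableM; first apply: cmeasurableM; first apply: cmeasurableM.
- exact: cmeasurable_cst.
- apply: cmeasurable_expi; apply: measurable_funM => //.
  apply: measurable_funD; apply: measurable_funM => //.
- exact: cmeasurable_cst.
- apply: cmeasurableJ.
  apply: (cmeasurableT_comp (f := fourier (wn n))).
    exact: cmeasurable_fourier (wnL n).1.
  by apply: measurable_funD => //; exact: measurable_funM.
Qed.

Let affE v : zeta * (B * v + p) = zeta * B * v + zeta * p.
Proof. by ring. Qed.

Let zB0 : zeta * B != 0. Proof. by rewrite mulf_neq0// gt_eqF. Qed.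

Let mPv n : cmeasurable setT (fun v => P n (zeta * (B * v + p))).
Proof.
apply: (cmeasurableT_comp (mP n)); apply: measurable_funM => //.
by apply: measurable_funD => //; exact: measurable_funM.
Qed.

Let mfh : cmeasurable setT (fourier h).
Proof. exact: cmeasurable_fourier. Qed.

(** Plancherel for [corr h g]. The constant is [(2 * pi)^-1] divided by the factor in the assumption
    on [Q]. Keeping [g] general covers both [wn n] and the differences of such windows. *)
Let corr_sqr g (Q : R -> R[i]) : cintegrable mu setT g -> cmeasurable setT Q ->
  (forall v, normc (Q v) ^+ 2 =
    (2 * pi * `|B|)^-1 * zeta^-1 ^+ 2 * normc (fourier g v) ^+ 2) ->
  (\int[mu]_t (normc (corr h g t) ^+ 2)%:E =
   (zeta ^+ 2 * `|B|)%:E *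
     \int[mu]_v (normc (fourier h v * Q v) ^+ 2)%:E)%E.
Proof.
move=> gi mQ QE; have pi0 : 0 < 2 * pi :> R by rewrite mulr_gt0// pi_gt0.
have nB : 0 < `|B| by rewrite normr_gt0.
have ci := cintegrable_corr hi gi.
have pl := plancherel ci (fun t => corr_le t mh hM gi)
  (seq_continuous_corr mh hM hc gi).
have -> : (\int[mu]_t (normc (corr h g t) ^+ 2)%:E =
  ((2 * pi)^-1)%:E * \int[mu]_v (normc (fourier (corr h g) v) ^+ 2)%:E)%E.
  by rewrite pl muleA -EFinM mulVf ?gt_eqF// mul1e.
rewrite -!integralZl_sqr_normc//; first last.
- by rewrite invr_ge0 ltW.
- exact: cmeasurable_fourier (cintegrable_measurable ci).
- by rewrite mulr_ge0 ?sqr_ge0.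
- exact: cmeasurableM.
apply: eq_integral => v _; congr EFin.
rewrite (fourier_corr v hi hM gi) !normc_mul normc_conj !exprMn QE.
have pp := @pi_gt0 R; move: (@pi R) pp => varpi varpi0.
by field; rewrite !gt_eqF.
Qed.

Let sqnormP n : (sqnorm2 (fun v => (P n (zeta * (B * v + p)) -
    H (zeta * (B * v + p)))%R) =
  (`|zeta * B|^-1)%:E * sqnorm2 (fun W => (H W - P n W)%R))%E.
Proof.
have mHP : cmeasurable setT (fun W => H W - P n W).
  by apply: cmeasurableB => //; exact: psiH.1.1.
rewrite -(sqnorm2_affine (zeta * p) zB0 mHP); apply: eq_integral => v _.
by rewrite normc_distC -affE.
Qed.

Let mcorr : cmeasurable setT (corr h w).
Proof.
apply: (cmeasurable_cintegral mu
  (F := fun z : R * R => h (z.2 + z.1) * (w z.2)^J)).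
apply: cmeasurableM.
  by apply: (cmeasurableT_comp mh); exact: measurable_funD.
by apply: cmeasurableJ; exact: (cmeasurableT_comp wL.1 measurable_snd).
Qed.

Let corr_wn t : normc (corr h (wn n) t - corr h w t) @[n --> \oo] --> 0.
Proof.
have htL : L2 (fun y => h (y + t)).
  by have := L2_affine t (oner_neq0 R) hL; under eq_fun do rewrite mul1r.
have iK : cintegrable mu setT (fun y => h (y + t) * (w y)^J).
  by apply: cintegrableM_L2 => //; exact: L2J.
apply: (@cintegral_dominated _ _ _ mu setT
    (fun n (y : R) => h (y + t) * (wn n y)^J) (fun y : R => h (y + t) * (w y)^J)
    (fun y => normc (h (y + t) * (w y)^J))) => //.
- move=> n; apply: cmeasurableM; first exact: htL.1.
  exact/cmeasurableJ/(wnL n).1.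
- exact: cintegrable_measurable iK.
- move=> y _; apply: cvg_near_cst; near=> n.
  suff -> : wn n y = w y by rewrite subrr Normc.normc0.
  rewrite /wn indicE mem_set ?mul1r//= in_itv/= -ler_norml.
  rewrite -ler_pdivrMr//; near: n; exact: nbhs_infty_ger.
- exact: cintegrable_normc iK.
- move=> n y _.
  suff : normc (h (y + t) * (wn n y)^J) <= normc (h (y + t) * (w y)^J) by [].
  rewrite normc_mul [leRHS]normc_mul !normc_conj ler_wpM2l ?normc_ge0//.
  rewrite /wn indicE; case: (y \in _); first by rewrite mul1r.
  by rewrite mul0r Normc.normc0 normc_ge0.
Unshelve. all: by end_near. Qed.

(** The window [w] need not be integrable, so [corr_sqr] is applied to the truncations [wn n]. On
    the frequency side they converge in L^2 by the very definition of the SAFT, [fourier h] being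
    bounded; on the time side [corr_wn] gives pointwise convergence. *)
Lemma integral_sqr_corr : (\int[mu]_t (normc (corr h w t) ^+ 2)%:E =
  (zeta ^+ 2 * `|B|)%:E *
    \int[mu]_v (normc (fourier h v * H (zeta * (B * v + p))) ^+ 2)%:E)%E.
Proof.
have [[mH Hoo] HP] := psiH.
have bh v : normc (fourier h v) <= \int[mu]_x normc (h x).
  exact: normc_fourier_le.
have mHa : cmeasurable setT (fun v => H (zeta * (B * v + p))).
  apply: (cmeasurableT_comp mH); apply: measurable_funM => //.
  by apply: measurable_funD => //; exact: measurable_funM.
have HL : L2 (fun v => H (zeta * (B * v + p))).
  have := L2_affine (zeta * p) zB0 psiH.1.
  by under eq_fun do rewrite -affE.
apply: (@isometry_limit _ _ _ _ R mu mu setT setT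
  (fun n v => fourier h v * P n (zeta * (B * v + p))) _
  (fun n => corr h (wn n))) => //.
- by rewrite mulr_ge0 ?sqr_ge0.
- by move=> n; apply: cmeasurableM => //; exact: mPv.
- exact: cmeasurableM.
- by move=> n; exact: cintegrable_measurable (cintegrable_corr hi (wni n)).
- have [_ fHoo] := L2M_bounded HL mfh bh.
  by under eq_integral do rewrite mulrC; exact: fHoo.
- apply: (@squeeze_cvge _ _ _ _ (fun=> 0%E) _ (fun n =>
    ((\int[mu]_x normc (h x)) ^+ 2 * `|zeta * B|^-1)%:E *
      sqnorm2 (fun W => (H W - P n W)%R))%E).
  + apply: nearW => n; apply/andP; split.
      by apply: integral_ge0 => v _; rewrite lee_fin sqr_ge0.
    rewrite EFinM -muleA -sqnormP -integralZl_sqr_normc//; last 2 first.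
    * by apply: cmeasurableB => //; exact: mPv.
    * exact: sqr_ge0.
    apply: ge0_le_integral => //.
    * by move=> v _; rewrite lee_fin sqr_ge0.
    * apply/measurable_EFinP; apply: measurable_normc_sqr.
      by apply: cmeasurableB; apply: cmeasurableM => //; exact: mPv.
    * apply/measurable_EFinP; apply: measurable_funM => //.
      by apply: measurable_normc_sqr; apply: cmeasurableB => //; exact: mPv.
    * move=> v _; rewrite lee_fin -mulrBr normc_mul exprMn ler_wpM2r ?sqr_ge0//.
      by rewrite ler_pXn2r ?nnegrE ?normc_ge0// (le_trans (normc_ge0 _) (bh 0)).
  + exact: cvg_cst.
  + rewrite -[X in _ --> X](mule0 ((\int[mu]_x normc (h x)) ^+ 2 * `|zeta * B|^-1)%:E).
    exact: cvgeZl.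
- move=> n; apply: corr_sqr => // v; rewrite PE.
  by have := normc_PB (fourier (wn n) v) 0 (zeta * (B * v + p));
    rewrite conjc0 mulr0 !subr0.
- move=> n m.
  have wnmi : cintegrable mu setT (fun y => wn n y - wn m y).
    exact: cintegrableB.
  transitivity ((zeta ^+ 2 * `|B|)%:E *
    \int[mu]_v (normc (fourier h v * (P n (zeta * (B * v + p)) -
      P m (zeta * (B * v + p)))) ^+ 2)%:E)%E; last first.
    by congr (_ * _)%E; apply: eq_integral => v _; rewrite mulrBr.
  rewrite -(corr_sqr wnmi).
  + apply: eq_integral => t _; congr ((normc _ ^+ 2)%:E).
    rewrite /corr -cintegralB//; do ?exact: cintegrable_corr_section hM _.
    by apply: eq_cintegral => y _; rewrite -mulrBr -raddfB.
  + by apply: cmeasurableB; exact: mPv.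
  + move=> v; rewrite !PE normc_PB; congr (_ * normc _ ^+ 2).
    rewrite /fourier -cintegralB//; do ?exact: cintegrable_fourier_kernel.
    by apply: eq_cintegral => y _; rewrite mulrBl.
Qed.

(** The powers of [zeta] combine to [zeta^-1 * zeta^-2 * zeta^2 = zeta^-1], the weight in [Cpsi],
    and [|B|] cancels. *)
Lemma integral_sqr_sawt :
  (\int[mu]_t (normc (sawt A B psi f t zeta) ^+ 2 * (zeta ^+ 2)^-1)%:E =
   \int[mu]_v ((2 * pi)^-1 * normc (fourier h v) ^+ 2 *
     (normc (H (zeta * (B * v + p))) ^+ 2 / zeta))%:E)%E.
Proof.
have pp := @pi_gt0 R; have nB : 0 < `|B| by rewrite normr_gt0.
have k0 : 0 <= (2 * pi * `|B|)^-1 * zeta^-1 * (zeta ^+ 2)^-1.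
  by rewrite !mulr_ge0 ?invr_ge0 ?mulr_ge0 ?sqr_ge0 ?ltW.
have mHa : cmeasurable setT (fun v => H (zeta * (B * v + p))).
  apply: (cmeasurableT_comp psiH.1.1); apply: measurable_funM => //.
  by apply: measurable_funD => //; exact: measurable_funM.
transitivity (((2 * pi * `|B|)^-1 * zeta^-1 * (zeta ^+ 2)^-1)%:E *
    \int[mu]_t (normc (corr h w t) ^+ 2)%:E)%E.
  rewrite -integralZl_sqr_normc//; apply: eq_integral => t _.
  by rewrite sqr_normc_sawt// [in RHS]mulrAC.
rewrite integral_sqr_corr muleA -EFinM -integralZl_sqr_normc//; last 2 first.
- exact: cmeasurableM.
- by rewrite !mulr_ge0 ?invr_ge0 ?mulr_ge0 ?sqr_ge0 ?ltW.
apply: eq_integral => v _; congr EFin; rewrite normc_mul exprMn.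
move: (@pi R) pp {k0} => varpi pp.
by field; rewrite !gt_eqF.
Qed.

End fixed_scale.

(** * The Parseval formula *)

Section sawt_facts.
Context {R : realType}.
Local Notation mu := (@lebesgue_measure R).
Variables (A B : R).
Implicit Types (f psi : R -> R[i]).

Lemma measurable_strip (e : R) : measurable (strip e).
Proof. by apply: measurableX => //; exact: measurable_itv. Qed.

Lemma cmeasurable_wavelet psi : cmeasurable setT psi ->
  cmeasurable setT (fun z : R * (R * R) => wavelet A B psi z.2.1 z.2.2 z.1).
Proof.
move=> mpsi; rewrite /wavelet.
have m1 : measurable_fun setT (fun z : R * (R * R) => z.1) by exact: measurable_fst.
have m21 : measurable_fun setT (fun z : R * (R * R) => z.2.1).
  exact: (measurableT_comp measurable_fst measurable_snd).
have m22 : measurable_fun setT (fun z : R * (R * R) => z.2.2).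
  exact: (measurableT_comp measurable_snd measurable_snd).
apply: cmeasurableM; first apply: cmeasurableM.
- under eq_fun do rewrite -fmorphV.
  apply: cmeasurableZ; apply: cmeasurable_real.
  apply: measurableT_comp; first exact: measurable_invr.
  apply: measurableT_comp m22; apply: continuous_measurable_fun.
  exact: sqrt_continuous.
- apply: (cmeasurableT_comp mpsi); apply: measurable_funM.
    exact: measurable_funB.
  by apply: measurableT_comp m22; exact: measurable_invr.
- apply: cmeasurable_expi; apply: measurable_funM => //.
  apply: measurable_funM; last exact: measurable_funB.
  exact: measurable_funM.
Qed.

Lemma cmeasurable_sawt f psi : cmeasurable setT f -> cmeasurable setT psi ->
  cmeasurable setT (fun z : R * R => sawt A B psi f z.1 z.2).
Proof.
move=> mf mpsi.
apply: (cmeasurable_cintegral mu (F := fun z : (R * R) * R =>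
  f z.2 * (wavelet A B psi z.1.1 z.1.2 z.2)^J)).
apply: cmeasurableM; first exact: (cmeasurableT_comp mf measurable_snd).
apply: cmeasurableJ.
apply: (cmeasurableT_comp (cmeasurable_wavelet mpsi)
  (g := fun z : (R * R) * R => (z.2, z.1))).
exact: measurable_swap.
Qed.

End sawt_facts.

Section strip_parseval.
Context {R : realType}.
Local Notation mu := (@lebesgue_measure R).
Variables (A B D p q c : R) (psi : R -> R[i]) (Psihat : R -> R -> R[i]).
Hypotheses (B0 : B != 0) (pL : L2 psi)
  (hP : is_bigpsi_saft A B D p q psi Psihat)
  (hc : {ae mu, forall w, Cpsi Psihat w = c%:E}).

Lemma Cpsi_ge0 w : (0 <= Cpsi Psihat w)%E.
Proof.
apply: integral_ge0 => z /=; rewrite in_itv/= andbT => z0.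
by rewrite lee_fin divr_ge0 ?sqr_ge0// ltW.
Qed.

(** If [c] were negative, the exceptional null set would be the whole line, which contains an
    interval of length 1. *)
Lemma admissibility_cst_ge0 : 0 <= c.
Proof.
have [N [mN N0 cN]] := hc; rewrite leNgt; apply/negP => cneg.
have NT : N = setT.
  apply/seteqP; split => // w _; apply: cN => /= wc.
  by have := Cpsi_ge0 w; rewrite wc lee_fin leNgt cneg.
have : (mu `[0%R, 1%R]%classic <= mu N)%E.
  by apply: le_measure; rewrite ?inE// NT.
rewrite N0 [X in (X <= _)%E](lebesgue_measure_itv `[0%R, 1%R])/= lte_fin ltr01.
by rewrite -EFinB lee_fin subr0 ler10.
Qed.

(* Test functions on which Plancherel's formula is applied directly. *)
Definition nice (f : R -> R[i]) := [/\ L2 f, cintegrable mu setT f,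
  exists M, forall x, normc (f x) <= M & seq_continuous f].

(** Tonelli exchanges scale and frequency. At frequency [v] the integral over scales is [Cpsi] at
    [B * v + p], equal to [c] for almost every [v] because a nonconstant affine map pulls null sets
    back to null sets. Plancherel for the chirp of [f] concludes. *)
Lemma sawt_parseval_nice f : nice f ->
  (\int[(mu \x mu)%E]_(z in strip 0)
     (normc (sawt A B psi f z.1 z.2) ^+ 2 * (z.2 ^+ 2)^-1)%:E =
   c%:E * sqnorm2 f)%E.
Proof.
move=> [fL fi [M fM] fc].
have pp := @pi_gt0 R; have c0 := admissibility_cst_ge0.
(* The condition [zeta > 0] is carried by an indicator, so that Tonelli is used on the full
   plane. *)
pose pos (zeta : R) : R := \1_(`]0, +oo[%classic : set R) zeta.
have pos0 zeta : 0 <= pos zeta by rewrite /pos indicE.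
have mpos : measurable_fun setT pos by exact: measurable_indic.
have ms := cmeasurable_sawt A B fL.1 pL.1.
pose h := chirp A B f.
have mh : cmeasurable setT h := (L2_chirp A B fL).1.
have mfh : cmeasurable setT (fourier h) := cmeasurable_fourier mh.
have mi2 : measurable_fun setT (fun z : R * R => (z.2 ^+ 2)^-1).
  apply: measurableT_comp; first exact: measurable_invr.
  by apply: measurable_funX.
pose G (z : R * R) := (pos z.2 *
  (normc (sawt A B psi f z.1 z.2) ^+ 2 * (z.2 ^+ 2)^-1))%:E.
have mG : measurable_fun setT G.
  apply/measurable_EFinP; apply: measurable_funM.
    exact: (measurableT_comp mpos measurable_snd).
  by apply: measurable_funM => //; exact: measurable_normc_sqr.
have G0 z : (0 <= G z)%E.
  rewrite lee_fin; apply: mulr_ge0; first exact: pos0.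
  by apply: mulr_ge0; rewrite ?invr_ge0 sqr_ge0.
pose K (z : R * R) := (pos z.2 * ((2 * pi)^-1 * normc (fourier h z.1) ^+ 2 *
     (normc (Psihat (z.2 * (B * z.1 + p)) z.2) ^+ 2 / z.2)))%:E.
have mK : measurable_fun setT K.
  apply/measurable_EFinP; apply: measurable_funM.
    exact: (measurableT_comp mpos measurable_snd).
  apply: measurable_funM.
    apply: measurable_funM => //; apply: measurable_normc_sqr.
    exact: (cmeasurableT_comp mfh measurable_fst).
  apply: measurable_funM; last first.
    by apply: measurableT_comp measurable_snd; exact: measurable_invr.
  apply: measurable_normc_sqr.
  apply: (cmeasurableT_comp hP.1
    (g := fun z : R * R => (z.2 * (B * z.1 + p), z.2))).
  apply: measurable_fun_pair => //; apply: measurable_funM => //.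
  by apply: measurable_funD => //; apply: measurable_funM.
have K0 z : (0 <= K z)%E.
  rewrite lee_fin /pos indicE.
  case: (boolP (z.2 \in _)) => [|_]; last by rewrite mul0r.
  rewrite inE/= in_itv/= andbT => z0; rewrite mul1r.
  by apply: mulr_ge0; apply: mulr_ge0; rewrite ?sqr_ge0// invr_ge0 ?mulr_ge0// ltW.
transitivity (\int[(mu \x mu)%E]_z G z)%E.
  rewrite integral_mkcond; apply: eq_integral => z _; rewrite patchE /G /pos.
  rewrite indicE.
  have -> : (z \in strip 0) = (z.2 \in (`]0, +oo[%classic : set R)).
    apply/idP/idP; rewrite !inE; first by case.
    by move=> z20; split.
  by case: ifPn => _; rewrite ?mul1r ?mul0r.
rewrite fubini_tonelli2//.
transitivity (\int[mu]_zeta \int[mu]_v K (v, zeta))%E.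
  apply: eq_integral => zeta _; rewrite /fubini_G /G /K /=.
  rewrite /pos indicE; case: (boolP (zeta \in _)) => [|_]; last first.
    by rewrite !integral0_eq// => x _; rewrite mul0r.
  rewrite inE/= in_itv/= andbT => z0.
  under eq_integral do rewrite mul1r.
  under [RHS]eq_integral do rewrite mul1r.
  exact: (integral_sqr_sawt B0 z0 fL fi fM fc pL (hP.2 _ z0)).
transitivity (\int[mu]_v \int[mu]_zeta K (v, zeta))%E.
  have FT := fubini_tonelli (m1 := mu) (m2 := mu) K mK K0.
  exact: (esym FT).
transitivity (\int[mu]_v ((2 * pi)^-1 * c * normc (fourier h v) ^+ 2)%:E)%E.
  apply: ae_eq_integral => //.
  - exact: (measurable_fun_fubini_tonelli_F (m2 := mu) K mK K0).
  - apply/measurable_EFinP; apply: measurable_funM => //.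
    exact: measurable_normc_sqr.
  - apply: ae_lebesgueS (ae_affine p B0 hc) => v hv _.
    have k0 : 0 <= (2 * pi)^-1 * normc (fourier h v) ^+ 2.
      by apply: mulr_ge0; rewrite ?sqr_ge0// invr_ge0 mulr_ge0// ltW.
    rewrite [RHS](_ : _ = ((2 * pi)^-1 * normc (fourier h v) ^+ 2)%:E *
      Cpsi Psihat (B * v + p))%E; last by rewrite hv -EFinM mulrAC.
    have mPv : measurable_fun (`]0, +oo[%classic : set R)
        (fun zeta => (normc (Psihat (zeta * (B * v + p)) zeta) ^+ 2 / zeta)%:E).
      apply/measurable_EFinP; apply: measurable_funM; last first.
        by apply: measurable_funTS; exact: measurable_invr.
      apply: measurable_normc_sqr; apply: cmeasurableTS.
      apply: (cmeasurableT_comp hP.1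
        (g := fun zeta : R => (zeta * (B * v + p), zeta))).
      by apply: measurable_fun_pair => //; exact: measurable_funM.
    rewrite /Cpsi -ge0_integralZl//; last first.
      move=> zeta /=; rewrite in_itv/= andbT => z0.
      by rewrite lee_fin divr_ge0 ?sqr_ge0// ltW.
    rewrite [RHS]integral_mkcond.
    apply: eq_integral => zeta _; rewrite /K /= /pos indicE patchE.
    by case: ifPn => _; rewrite ?mul1r// mul0r.
have hi : cintegrable mu setT h.
  apply: (cintegrableM_bounded (M := 1)) => //.
    by apply: cmeasurable_expi; apply: measurable_funM => //.
  by move=> x; rewrite normc_expi.
have hM x : normc (h x) <= M by rewrite normc_chirp.
have hcont : seq_continuous h.
  apply: seq_continuousM_expi => // x; apply: cvgM; first exact: cvg_cst.
  exact: exprn_continuous.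
rewrite integralZl_sqr_normc//; last first.
  by apply: mulr_ge0 => //; rewrite invr_ge0 mulr_ge0// ltW.
rewrite (plancherel hi hM hcont) muleA -EFinM.
have -> : (2 * pi)^-1 * c * (2 * pi) = c.
  by rewrite mulrAC mulVf ?mul1r// gt_eqF// mulr_gt0.
by congr (_ * _)%E; apply: eq_integral => x _; rewrite normc_chirp.
Qed.

End strip_parseval.

(** * Density of bounded, continuous, integrable functions in L^2 *)

Section density.
Context {R : realType}.
Local Notation mu := (@lebesgue_measure R).

Let clamp (N y : R) := Num.max (- N) (Num.min N y).
Let cut (N x : R) := Num.max 0 (Num.min 1 (N + 1 - `|x|)).

Let clamp_le (N y : R) : 0 <= N -> `|clamp N y| <= N.
Proof.
move=> N0; rewrite /clamp ler_norml le_max lexx/= ge_max.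
by rewrite ge_min lexx/= andbT ge0_cp.
Qed.

Let clamp_dist (N y z : R) : `|z| <= N -> `|clamp N y - z| <= `|y - z|.
Proof.
rewrite ler_norml => /andP[z1 z2]; rewrite /clamp.
case: (leP N y) => yN.
  rewrite max_r; last by lra.
  rewrite !ger0_norm; lra.
case: (leP (- N) y) => // yN'.
rewrite !ler0_norm; lra.
Qed.

Let cut_ge0 N x : 0 <= cut N x. Proof. by rewrite /cut le_max lexx. Qed.

Let cut_le1 N x : cut N x <= 1.
Proof. by rewrite /cut ge_max ler01 ge_min lexx. Qed.

Let cut1 N x : `|x| <= N -> cut N x = 1.
Proof.
move=> xN; rewrite /cut min_l; last by lra.
by rewrite max_r.
Qed.

Let cut0 N x : N + 1 <= `|x| -> cut N x = 0.
Proof.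
move=> xN; rewrite /cut max_l// ge_min; apply/orP; right; lra.
Qed.

Let continuous_maxr (f g : R -> R) : continuous f -> continuous g ->
  continuous (fun x => Num.max (f x) (g x)).
Proof.
move=> fc gc; under eq_fun do rewrite maxr_absE.
move=> x; apply: cvgM; last exact: cvg_cst.
apply: cvgD; first by apply: cvgD; [exact: fc|exact: gc].
by apply: cvg_norm; apply: cvgB; [exact: fc|exact: gc].
Qed.

Let continuous_minr (f g : R -> R) : continuous f -> continuous g ->
  continuous (fun x => Num.min (f x) (g x)).
Proof.
move=> fc gc; under eq_fun do rewrite minr_absE.
move=> x; apply: cvgM; last exact: cvg_cst.
apply: cvgB; first by apply: cvgD; [exact: fc|exact: gc].
by apply: cvg_norm; apply: cvgB; [exact: fc|exact: gc].
Qed.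

Let continuous_clamp N (g : R -> R) : continuous g -> continuous (fun x => clamp N (g x)).
Proof.
move=> gc; apply: continuous_maxr; first exact: cst_continuous.
by apply: continuous_minr => //; exact: cst_continuous.
Qed.

Let continuous_cut N : continuous (cut N).
Proof.
apply: continuous_maxr; first exact: cst_continuous.
apply: continuous_minr; first exact: cst_continuous.
by move=> x; apply: cvgB; [exact: cvg_cst|exact: norm_continuous].
Qed.

(** After truncation of [u] to a bounded function [tr N] of bounded support, continuous approximants
    in L^1 are clamped to [-N, N]. This turns L^1 closeness into L^2 closeness, since a difference
    bounded by [2 * N] has square at most [2 * N] times its modulus. *)
Lemma continuous_dense_sqr (u : R -> R) (e : R) : measurable_fun setT u ->
  (\int[mu]_x (u x ^+ 2)%:E < +oo)%E -> 0 < e ->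
  exists v : R -> R, [/\ continuous v, exists M, forall x, `|v x| <= M,
    mu.-integrable setT (EFin \o v) &
    (\int[mu]_x ((v x - u x) ^+ 2)%:E <= e%:E)%E].
Proof.
move=> mu_ uoo e0.
pose tr (n : nat) x : R := if (`|x| <= n%:R) && (`|u x| <= n%:R) then u x else 0.
have mtr n : measurable_fun setT (tr n).
  apply: measurable_fun_ifT => //; apply: measurable_and.
    by apply: measurable_fun_ler => //.
  by apply: measurable_fun_ler => //; exact: measurableT_comp.
have [N hN] : exists N : nat, (\int[mu]_x ((u x - tr N x) ^+ 2)%:E <= (e / 4)%:E)%E.
  have e4 : 0 < e / 4 by rewrite divr_gt0.
  have [] := @dominated_convergence _ _ _ mu setT measurableT
    (fun n x => ((u x - tr n x) ^+ 2)%:E) (fun=> 0%E) (fun x => (u x ^+ 2)%:E).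
  - move=> n; apply/measurable_EFinP; apply: measurable_funX.
    by apply: measurable_funB => //; exact: mtr.
  - exact: measurable_cst.
  - apply: aeW => x _; apply: cvg_near_cst; near=> n.
    rewrite /tr ifT ?subrr ?expr0n//; apply/andP; split.
      by near: n; exact: nbhs_infty_ger.
    by near: n; exact: nbhs_infty_ger.
  - apply/integrableP; split; first exact/measurable_EFinP/measurable_funX.
    by under eq_integral do rewrite /= ger0_norm ?sqr_ge0//.
  - apply: aeW => x n _; rewrite /= lee_fin ger0_norm ?sqr_ge0// /tr.
    by case: ifPn => _; rewrite ?subr0// subrr expr0n sqr_ge0.
  move=> _ _; rewrite integral0 => /fine_cvgP[fin /cvgrPdist_le/(_ _ e4)] h.
  near \oo => n; exists n.
  rewrite -[leLHS]fineK; last by near: n.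
  rewrite lee_fin (le_trans (ler_norm _))// -normrN -[X in `|X|]add0r.
  by near: n.
(* One unit wider on each side than the support of [tr N], to leave room for [cut] to descend from 1
   to 0. *)
pose E : set R := `[- (N%:R + 1), N%:R + 1]%classic.
have mE : measurable E by exact: measurable_itv.
have muE : (mu E < +oo)%E.
  rewrite [X in (X < _)%E](lebesgue_measure_itv `[- (N%:R + 1), N%:R + 1])/=.
  by case: ifPn => _; rewrite -?EFinB ltry.
have trN x : `|tr N x| <= N%:R.
  by rewrite /tr; case: ifPn => [/andP[]//|_]; rewrite normr0.
have itr : mu.-integrable E (EFin \o tr N).
  apply: measurable_bounded_integrable => //.
    by apply: measurable_funTS; exact: mtr.
  exists N%:R; split; first exact: num_real.
  by move=> M NM x Ex; exact: le_trans (trN x) (ltW NM).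
have [g_ [gc gi g0]] := approximation_continuous_integrable mE muE itr.
(* Chosen so that [4 * N * d <= e / 2]; the truncation error contributes the other half,
   [2 * (e / 4)]. *)
pose d := e / (8 * (N%:R + 1)).
have N1 : 0 < N%:R + 1 :> R by rewrite ltr_wpDl.
have d0 : 0 < d by rewrite divr_gt0// mulr_gt0.
have [n hn] : exists n, (\int[mu]_(z in E) `|(tr N z - g_ n z)%:E| <= d%:E)%E.
  move/fine_cvgP : g0 => [fin /cvgrPdist_le/(_ _ d0) h].
  near \oo => n; exists n.
  rewrite -[leLHS]fineK; last by near: n.
  rewrite lee_fin (le_trans (ler_norm _))// -normrN -[X in `|X|]add0r.
  by near: n.
pose v x := cut N%:R x * clamp N%:R (g_ n x).
have vc : continuous v.
  by move=> x; apply: cvgM; [exact: continuous_cut|exact: continuous_clamp].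
have vN x : `|v x| <= N%:R.
  rewrite /v normrM ger0_norm// -[leRHS]mul1r.
  by apply: ler_pM => //; exact: clamp_le.
have v0 x : x \notin E -> v x = 0.
  move=> xE; rewrite /v cut0 ?mul0r// leNgt; apply: contra xE.
  by rewrite ltr_norml inE /E/= in_itv/= => /andP[x1 x2]; rewrite !ltW.
have tr0 x : x \notin E -> tr N x = 0.
  move=> xE; rewrite /tr ifF//; apply: contraNF xE => /andP[+ _].
  by rewrite ler_norml inE /E/= in_itv/= => /andP[x1 x2]; apply/andP; split; lra.
have dist x : `|v x - tr N x| <= `|tr N x - g_ n x|.
  rewrite [leRHS]distrC; have [xN|xN] := leP `|x| N%:R.
    by rewrite /v cut1// mul1r clamp_dist.
  have -> : tr N x = 0 by rewrite /tr leNgt xN.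
  rewrite !subr0 /v normrM ger0_norm// -[leRHS]mul1r.
  apply: ler_pM => //.
  by have := @clamp_dist N%:R (g_ n x) 0; rewrite !subr0 normr0; apply.
have sqr_dist x : (v x - tr N x) ^+ 2 <= 2 * N%:R * `|tr N x - g_ n x|.
  rewrite -real_normK ?num_real// expr2; apply: ler_pM => //.
  by apply: (le_trans (ler_normB _ _)); have := vN x; have := trN x; lra.
have mv : measurable_fun setT v by exact: continuous_measurable_fun.
exists v; split => //.
- by exists N%:R.
- have iv : mu.-integrable E (EFin \o v).
    apply: measurable_bounded_integrable => //; first exact: measurable_funTS.
    exists N%:R; split; first exact: num_real.
    by move=> M NM x Ex; exact: le_trans (vN x) (ltW NM).
  have := (@integrable_mkcond _ _ _ mu E (EFin \o v) mE).1 iv.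
  apply: eq_integrable => // x _.
  by rewrite patchE; case: ifPn => // /v0 /= ->.
- pose k x := `|tr N x - g_ n x|.
  have mk : measurable_fun setT k.
    apply: measurableT_comp => //; apply: measurable_funB; first exact: mtr.
    by apply: continuous_measurable_fun; exact: gc.
  have k0 x : 0 <= k x by exact: normr_ge0.
  have le_k x : (v x - u x) ^+ 2 <=
      2 * (u x - tr N x) ^+ 2 + 4 * N%:R * (\1_E x * k x).
    have h : (v x - tr N x) ^+ 2 <= 2 * N%:R * (\1_E x * k x).
      rewrite indicE; case: (boolP (x \in E)) => xE; first by rewrite mul1r.
      by rewrite v0// tr0// subrr expr0n mul0r mulr0.
    have -> : v x - u x = (v x - tr N x) - (u x - tr N x) by ring.
    move: (v x - tr N x) (u x - tr N x) (\1_E x * k x) h => y z k' h.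
    have -> : (y - z) ^+ 2 = 2 * z ^+ 2 + 2 * y ^+ 2 - (y + z) ^+ 2 by ring.
    have -> : 4 * N%:R * k' = 2 * (2 * N%:R * k') by ring.
    have := sqr_ge0 (y + z); lra.
  have m1 : measurable_fun setT (fun x => (u x - tr N x) ^+ 2).
    by apply: measurable_funX; apply: measurable_funB => //; exact: mtr.
  have m2 : measurable_fun setT (fun x => \1_E x * k x).
    by apply: measurable_funM => //; exact: measurable_indic.
  have ik0 x : 0 <= \1_E x * k x by rewrite indicE mulr_ge0.
  apply: (@le_trans _ _ (\int[mu]_x (2%:E * ((u x - tr N x) ^+ 2)%:E +
      (4 * N%:R)%:E * (\1_E x * k x)%:E))%E).
    apply: ge0_le_integral => //.
    + by move=> x _; rewrite lee_fin sqr_ge0.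
    + by apply/measurable_EFinP; apply: measurable_funX; exact: measurable_funB.
    + by apply: emeasurable_funD; apply: measurable_funeM; exact/measurable_EFinP.
    + by move=> x _; rewrite -!EFinM -EFinD lee_fin le_k.
  rewrite ge0_integralD//; first last.
  + by apply: measurable_funeM; exact/measurable_EFinP.
  + by move=> x _; rewrite -EFinM lee_fin !mulr_ge0.
  + by apply: measurable_funeM; exact/measurable_EFinP.
  + by move=> x _; rewrite -EFinM lee_fin mulr_ge0// sqr_ge0.
  rewrite ge0_integralZl//; first last.
  + by move=> x _; rewrite lee_fin sqr_ge0.
  + exact/measurable_EFinP.
  rewrite ge0_integralZl//; last 2 first.
  + exact/measurable_EFinP.
  + by move=> x _; rewrite lee_fin.
  have -> : (\int[mu]_x (\1_E x * k x)%:E =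
      \int[mu]_(z in E) `|(tr N z - g_ n z)%:E|)%E.
    rewrite [RHS]integral_mkcond; apply: eq_integral => x _.
    by rewrite patchE indicE; case: ifPn => _; rewrite ?mul1r ?mul0r.
  apply: (@le_trans _ _ (2%:E * (e / 4)%:E + (4 * N%:R)%:E * d%:E)%E).
    by apply: leeD; apply: lee_wpmul2l.
  rewrite -!EFinM -EFinD lee_fin.
  have -> : 2 * (e / 4) + 4 * N%:R * d = e / 2 + (N%:R / (N%:R + 1)) * (e / 2).
    by rewrite /d; field; rewrite gt_eqF.
  have : N%:R / (N%:R + 1) * (e / 2) <= 1 * (e / 2).
    by rewrite ler_pM2r ?divr_gt0// ler_pdivrMr// mul1r lerDl.
  lra.
Unshelve. all: by end_near. Qed.

Lemma nice_dense (f : R -> R[i]) : L2 f -> exists f_ : nat -> R -> R[i],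
  (forall n, nice (f_ n)) /\
  (sqnorm2 (fun x => f_ n x - f x) @[n --> \oo] --> 0%E).
Proof.
move=> [[mRe mIm] foo].
have half (s : R[i] -> R) : measurable_fun setT (fun x => s (f x)) ->
    (forall z, s z ^+ 2 <= normc z ^+ 2) ->
    (\int[mu]_x (s (f x) ^+ 2)%:E < +oo)%E.
  move=> ms sz; apply: le_lt_trans foo; apply: ge0_le_integral => //.
  - by move=> x _; rewrite lee_fin sqr_ge0.
  - exact/measurable_EFinP/measurable_funX.
  - by apply/measurable_EFinP; exact: measurable_normc_sqr.
  - by move=> x _; rewrite lee_fin.
have Reoo := half _ mRe (fun z => (_ : complex.Re z ^+ 2 <= normc z ^+ 2)).
have {}Reoo : (\int[mu]_x (complex.Re (f x) ^+ 2)%:E < +oo)%E.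
  by apply: Reoo => z; rewrite sqr_normc lerDl sqr_ge0.
have Imoo : (\int[mu]_x (complex.Im (f x) ^+ 2)%:E < +oo)%E.
  by apply: half => // z; rewrite sqr_normc lerDr sqr_ge0.
have n1 n : 0 < n.+1%:R^-1 / 2 :> R by rewrite divr_gt0.
have [a ha] := choice (fun n => continuous_dense_sqr mRe Reoo (n1 n)).
have [b hb] := choice (fun n => continuous_dense_sqr mIm Imoo (n1 n)).
have ma n : measurable_fun setT (a n).
  by apply: continuous_measurable_fun; have [] := ha n.
have mb n : measurable_fun setT (b n).
  by apply: continuous_measurable_fun; have [] := hb n.
pose f_ n x : R[i] := a n x +i* b n x.
have mf_ n : cmeasurable setT (f_ n) by split; [exact: ma|exact: mb].
have mf : cmeasurable setT f by [].
have le1n n : (sqnorm2 (fun x => (f_ n x - f x)%R) <= (n.+1%:R^-1)%:E)%E.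
  have [_ _ _ an] := ha n; have [_ _ _ bn] := hb n.
  have E x : normc (f_ n x - f x) ^+ 2 =
      (a n x - complex.Re (f x)) ^+ 2 + (b n x - complex.Im (f x)) ^+ 2.
    by rewrite sqr_normc !raddfB.
  rewrite /sqnorm2; under eq_integral do rewrite E EFinD.
  rewrite ge0_integralD//; first last.
  - apply/measurable_EFinP; apply: measurable_funX.
    by apply: measurable_funB => //; exact: mb.
  - by move=> x _; rewrite lee_fin sqr_ge0.
  - apply/measurable_EFinP; apply: measurable_funX.
    by apply: measurable_funB => //; exact: ma.
  - by move=> x _; rewrite lee_fin sqr_ge0.
  by apply: (le_trans (leeD an bn)); rewrite -EFinD lee_fin -splitr.
exists f_; split.
- move=> n; have [ac [Ma aM] ai an] := ha n; have [bc [Mb bM] bi bn] := hb n.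
  split.
  + split => //.
    apply: (@le_lt_trans _ _ (((1 + 1) * n.+1%:R^-1 + (1 + 1^-1) *
        fine (sqnorm2 f))%:E)); last exact: ltry.
    rewrite /sqnorm2; under eq_integral => x _ do rewrite -[f_ n x](subrK (f x)).
    apply: integral_sqr_normcD_le => //.
    * by apply: cmeasurableB => //; exact: mf_.
    * exact: le1n.
    * by rewrite fineK// ge0_fin_numE// sqnorm2_ge0.
  + by split.
  + exists (Ma + Mb) => x; apply: (le_trans (normc_le_ReIm _)).
    by apply: lerD; [exact: aM|exact: bM].
  + move=> s x sx.
    have lim : `|a n (s k) - a n x| + `|b n (s k) - b n x| @[k --> \oo] --> (0 : R).
      rewrite -[X in _ --> X](addr0 0); apply: cvgD; rewrite -(@normr0 _ R);
        apply: cvg_norm; apply/subr_cvg0.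
        by apply: (@cvg_comp _ _ _ s (a n) _ (nbhs x)) => //; exact: ac.
      by apply: (@cvg_comp _ _ _ s (b n) _ (nbhs x)) => //; exact: bc.
    apply: squeeze_cvgr (cvg_cst 0) lim; apply: nearW => k.
    by rewrite normc_ge0; exact: (normc_le_ReIm (f_ n (s k) - f_ n x)).
- apply: (@squeeze_cvge _ _ _ _ (fun=> 0%E) _ (fun n => (n.+1%:R^-1)%:E)).
  + by apply: nearW => n; rewrite sqnorm2_ge0 le1n.
  + exact: cvg_cst.
  + exact: cvge_harmonic.
Qed.

End density.

Section sawt_linear.
Context {R : realType}.
Local Notation mu := (@lebesgue_measure R).
Variables (A B : R) (psi : R -> R[i]).
Hypotheses (B0 : B != 0) (pL : L2 psi).
Implicit Types f g : R -> R[i].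

Lemma sqr_normc_wavelet t zeta x : 0 < zeta ->
  normc (wavelet A B psi t zeta x) ^+ 2 =
  (2 * pi * `|B|)^-1 * zeta^-1 * normc (psi ((x - t) / zeta)) ^+ 2.
Proof.
move=> z0; rewrite /wavelet !normc_mul normc_expi mulr1 !exprMn normc_KB.
congr (_ * _ * _); rewrite -fmorphV normc_real real_normK ?num_real// exprVn.
by rewrite sqr_sqrtr// ltW.
Qed.

Lemma L2_wavelet t zeta : 0 < zeta -> L2 (wavelet A B psi t zeta).
Proof.
move=> z0; split.
  exact: (cmeasurableT_comp (cmeasurable_wavelet A B pL.1)
    (g := fun x : R => (x, (t, zeta)))).
rewrite /sqnorm2; under eq_integral do rewrite sqr_normc_wavelet//.
have zi0 : zeta^-1 != 0 by rewrite invr_eq0 gt_eqF.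
have pa := L2_affine (- t / zeta) zi0 pL.
have k0 : 0 <= (2 * pi * `|B|)^-1 * zeta^-1.
  by rewrite mulr_ge0 ?invr_ge0 ?mulr_ge0 ?pi_ge0// ltW.
have E (x : R) : (x - t) / zeta = zeta^-1 * x + - t / zeta by ring.
under eq_integral do rewrite E.
rewrite integralZl_sqr_normc//; last exact: pa.1.
by rewrite lte_mul_pinfty ?lee_fin//; exact: pa.2.
Qed.

Lemma cintegrable_sawt f t zeta : 0 < zeta -> L2 f ->
  cintegrable mu setT (fun x => f x * (wavelet A B psi t zeta x)^J).
Proof.
by move=> z0 fL; apply: cintegrableM_L2 => //; apply: L2J; exact: L2_wavelet.
Qed.

Lemma sawtB f g t zeta : 0 < zeta -> L2 f -> L2 g ->
  sawt A B psi (fun x => f x - g x) t zeta =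
  sawt A B psi f t zeta - sawt A B psi g t zeta.
Proof.
move=> z0 fL gL; rewrite /sawt -cintegralB//; do ?exact: cintegrable_sawt.
by apply: eq_cintegral => x _; rewrite mulrBl.
Qed.

Lemma sawtD f g t zeta : 0 < zeta -> L2 f -> L2 g ->
  sawt A B psi (fun x => f x + g x) t zeta =
  sawt A B psi f t zeta + sawt A B psi g t zeta.
Proof.
move=> z0 fL gL; rewrite /sawt -cintegralD//; do ?exact: cintegrable_sawt.
by apply: eq_cintegral => x _; rewrite mulrDl.
Qed.

Lemma L2B f g : L2 f -> L2 g -> L2 (fun x => f x - g x).
Proof.
move=> [mf foo] [mg goo]; split; first exact: cmeasurableB.
apply: (@le_lt_trans _ _ (((1 + 1) * fine (sqnorm2 f) +
  (1 + 1^-1) * fine (sqnorm2 g))%:E)); last exact: ltry.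
apply: integral_sqr_normcD_le => //.
- exact: cmeasurableN.
- by rewrite fineK// ge0_fin_numE// sqnorm2_ge0.
- under eq_integral do rewrite normcN.
  by rewrite fineK// ge0_fin_numE// sqnorm2_ge0.
Qed.

Lemma L2Z f (z : R[i]) : L2 f -> L2 (fun x => z * f x).
Proof.
move=> fL; under eq_fun do rewrite mulrC.
by apply: (L2M_bounded (M := normc z)) => //; exact: cmeasurable_cst.
Qed.

Lemma L2D f g : L2 f -> L2 g -> L2 (fun x => f x + g x).
Proof.
move=> fL gL; have := L2B fL (L2Z (- 1) gL).
by under eq_fun do rewrite mulN1r opprK.
Qed.

(** Makes evaluation of the transform at a point continuous for the L^2 norm of the signal; this
    provides the pointwise convergence that [isometry_limit] requires. *)
Lemma sqr_normc_sawt_le f t zeta : 0 < zeta -> L2 f ->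
  normc (sawt A B psi f t zeta) ^+ 2 <=
  fine (sqnorm2 f) * fine (sqnorm2 (wavelet A B psi t zeta)).
Proof.
move=> z0 fL; have wL := L2_wavelet t z0.
apply: cauchy_schwarz => //.
- exact: fL.1.
- exact/cmeasurableJ/wL.1.
- by rewrite fine_ge0// sqnorm2_ge0.
- by rewrite fine_ge0// sqnorm2_ge0.
- by rewrite fineK// ge0_fin_numE ?sqnorm2_ge0//; exact: fL.2.
- under eq_integral do rewrite normc_conj.
  by rewrite fineK// ge0_fin_numE ?sqnorm2_ge0//; exact: wL.2.
Qed.

End sawt_linear.

Section sawt_parseval.
Context {R : realType}.
Local Notation mu := (@lebesgue_measure R).
Variables (A B D p q c : R) (psi : R -> R[i]) (Psihat : R -> R -> R[i]).
Hypotheses (B0 : B != 0) (pL : L2 psi)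
  (hP : is_bigpsi_saft A B D p q psi Psihat)
  (hc : {ae mu, forall w, Cpsi Psihat w = c%:E}).

(** One factor [zeta^-1], half of the density [zeta^-2], is absorbed into the transform, so that its
    energy is a plain squared norm on the half-plane. *)
Let W (f : R -> R[i]) (z : R * R) : R[i] :=
  sawt A B psi f z.1 z.2 * (z.2^-1)%:C.

Let normcW f z : normc (W f z) ^+ 2 =
  normc (sawt A B psi f z.1 z.2) ^+ 2 * (z.2 ^+ 2)^-1.
Proof. by rewrite normc_mul exprMn normc_real real_normK ?num_real// exprVn. Qed.

Let mW f : cmeasurable setT f -> cmeasurable setT (W f).
Proof.
move=> mf; apply: cmeasurableM; first exact: cmeasurable_sawt mf pL.1.
apply: cmeasurable_real; apply: measurableT_comp; first exact: measurable_invr.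
exact: measurable_snd.
Qed.

Lemma niceB (f g : R -> R[i]) : nice f -> nice g -> nice (fun x => f x - g x).
Proof.
move=> [fL fi [M fM] fc] [gL gi [N gN] gc]; split.
- exact: L2B.
- exact: cintegrableB.
- exists (M + N) => x; apply: (le_trans (le_normcD _ _)); rewrite normcN.
  by apply: lerD; [exact: fM|exact: gN].
- move=> s x sx.
  have lim : normc (f (s n) - f x) + normc (g (s n) - g x) @[n --> \oo] --> (0 : R).
    by rewrite -[X in _ --> X](addr0 0); apply: cvgD; [exact: fc|exact: gc].
  apply: squeeze_cvgr (cvg_cst 0) lim; apply: nearW => n; rewrite normc_ge0/=.
  have -> : f (s n) - g (s n) - (f x - g x) = (f (s n) - f x) - (g (s n) - g x).
    by ring.
  by apply: (le_trans (le_normcD _ _)); rewrite normcN.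
Qed.

Lemma sawt_parseval f : L2 f ->
  (\int[(mu \x mu)%E]_(z in strip 0)
     (normc (sawt A B psi f z.1 z.2) ^+ 2 * (z.2 ^+ 2)^-1)%:E =
   c%:E * sqnorm2 f)%E.
Proof.
move=> fL; have [f_ [nf_ f0]] := nice_dense fL.
under eq_integral do rewrite -normcW.
have ms : measurable (strip (0 : R)) by exact: measurable_strip.
rewrite /sqnorm2; apply: (@isometry_limit _ _ _ _ R mu (mu \x mu)%E setT (strip 0)
  f_ f (fun n => W (f_ n)) (W f) c) => //.
- exact: admissibility_cst_ge0 hc.
- by move=> n; have [[]] := nf_ n.
- exact: fL.1.
- by move=> n; apply: cmeasurableTS; apply: mW; have [[]] := nf_ n.
- by apply: cmeasurableTS; apply: mW; exact: fL.1.
- move=> [t zeta] [_ /=]; rewrite in_itv/= andbT => z0.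
  have wL := L2_wavelet A B pL t z0.
  have fn_L2 n : L2 (f_ n) by have [] := nf_ n.
  set K := fine (sqnorm2 (wavelet A B psi t zeta)).
  have WE n : normc (W (f_ n) (t, zeta) - W f (t, zeta)) =
      normc (sawt A B psi (fun x => f_ n x - f x) t zeta) * zeta^-1.
    rewrite (_ : W (f_ n) (t, zeta) - W f (t, zeta) =
      sawt A B psi (fun x => f_ n x - f x) t zeta * (zeta^-1)%:C); last first.
      by rewrite /W sawtB// mulrBl.
    by rewrite normc_mul normc_real ger0_norm// invr_ge0 ltW.
  suff : normc (W (f_ n) (t, zeta) - W f (t, zeta)) @[n --> \oo] --> 0 by [].
  rewrite (funext WE).
  have lim : Num.sqrt (fine (sqnorm2 (fun x => f_ n x - f x)) * K) * zeta^-1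
      @[n --> \oo] --> (0 : R).
    rewrite -[X in _ --> X](mul0r zeta^-1); apply: cvgM; last exact: cvg_cst.
    rewrite -(@sqrtr0 R); apply: continuous_cvg; first exact: sqrt_continuous.
    rewrite -[X in _ --> X](mul0r K); apply: cvgM; last exact: cvg_cst.
    exact: fine_cvg.
  apply: squeeze_cvgr (cvg_cst 0) lim; apply: nearW => n.
  have zi0 : 0 <= zeta^-1 by rewrite invr_ge0 ltW.
  apply/andP; split; first by apply: mulr_ge0 => //; exact: normc_ge0.
  apply: ler_wpM2r => //.
  rewrite -[leLHS]ger0_norm ?normc_ge0// -sqrtr_sqr ler_wsqrtr//.
  by apply: sqr_normc_sawt_le => //; exact: L2B.
- exact: fL.2.
- move=> n; under eq_integral do rewrite normcW.
  exact: (sawt_parseval_nice B0 pL hP hc (nf_ n)).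
- move=> n m; have nnm := niceB (nf_ n) (nf_ m).
  rewrite -[RHS](sawt_parseval_nice B0 pL hP hc nnm).
  apply: eq_integral => z; rewrite inE => -[_ /=]; rewrite in_itv/= andbT => z0.
  rewrite -normcW /W sawtB//; first by rewrite mulrBl.
    by have [] := nf_ n.
  by have [] := nf_ m.
Qed.

End sawt_parseval.

(** * Reconstruction *)

Section polarization.
Context {d : measure_display} {T : measurableType d} {R : realType}.
Variable mu : {measure set T -> \bar R}.

(** Real parts of inner products are enough: the residual is paired with its own truncations, and
    these products are squared norms. *)
Lemma polarization (D : set T) (u v : T -> R[i]) :
  measurable D -> cmeasurable D u -> cmeasurable D v ->
  (\int[mu]_(x in D) (normc (u x) ^+ 2)%:E < +oo)%E ->
  (\int[mu]_(x in D) (normc (v x) ^+ 2)%:E < +oo)%E ->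
  (\int[mu]_(x in D) (normc (u x + v x) ^+ 2)%:E =
   (\int[mu]_(x in D) (normc (u x) ^+ 2) + \int[mu]_(x in D) (normc (v x) ^+ 2)
    + 2 * complex.Re (cintegral mu D (fun x => u x * (v x)^J)))%:E)%E.
Proof.
move=> mD mu_ mv uoo voo.
have sqr_int (w : T -> R[i]) : cmeasurable D w ->
    (\int[mu]_(x in D) (normc (w x) ^+ 2)%:E < +oo)%E ->
    mu.-integrable D (EFin \o (fun x => normc (w x) ^+ 2)).
  move=> mw woo; apply/integrableP; split.
    exact/measurable_EFinP/measurable_normc_sqr.
  by under eq_integral do rewrite /= ger0_norm ?sqr_ge0//.
have ui := sqr_int _ mu_ uoo; have vi := sqr_int _ mv voo.
have uvi : cintegrable mu D (fun x => u x * (v x)^J).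
  apply: cintegrableM_sqr => //; first exact: cmeasurableJ.
  by under eq_integral do rewrite normc_conj.
under eq_integral do rewrite sqr_normcD.
rewrite -EFin_Rintegral//; last first.
  exact: (integrableD mD (integrableD mD ui vi) (integrableZl mD 2 uvi.1)).
congr EFin; rewrite RintegralD//; last 2 first.
- exact: (integrableD mD ui vi).
- exact: (integrableZl mD 2 uvi.1).
rewrite RintegralD// RintegralZl//; exact: uvi.1.
Qed.

End polarization.

Section plane.
Context {R : realType}.
Local Notation mu := (@lebesgue_measure R).

(* MathComp-Analysis registers the product as sigma-finite only for
   subprobabilities. *)
Definition plane : set (measurableTypeR R * measurableTypeR R) -> \bar R :=
  (mu \x mu)%E.

HB.instance Definition _ := Measure.copy plane (mu \x mu)%E.

Let sigma_finite_plane : sigma_finite setT plane.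
Proof.
have /sigma_finiteP[G [TG ndG Goo]] := sigma_finiteT mu.
(* Squares of an increasing exhaustion of the line exhaust the plane. *)
exists (fun n => G n `*` G n).
  rewrite -setXTT TG predeqE => -[x y]; split.
    move=> [/= [n _ Gnx] [k _ Gky]]; exists (maxn n k) => //; split.
    - by move: x Gnx; exact/subsetPset/ndG/leq_maxl.
    - by move: y Gky; exact/subsetPset/ndG/leq_maxr.
  by move=> [n _ []/= ? ?]; split; exists n.
move=> k; have [? ?] := Goo k; split; first exact: measurableX.
rewrite [X in (X < _)%E](product_measure1E mu mu)// lte_mul_pinfty//.
by rewrite ge0_fin_numE.
Qed.

HB.instance Definition _ :=
  Measure_isSigmaFinite.Build _ _ _ plane sigma_finite_plane.

End plane.

(** * The residual of the synthesis integral over scales above [e] *)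

Section reconstruction.
Context {R : realType}.
Local Notation mu := (@lebesgue_measure R).
Local Notation mu2 := (mu \x mu)%E.
Variables (A B D p q c : R) (psi f : R -> R[i]) (Psihat : R -> R -> R[i]).
Hypotheses (B0 : B != 0) (fL : L2 f) (pL : L2 psi)
  (hP : is_bigpsi_saft A B D p q psi Psihat)
  (hc : {ae mu, forall w, Cpsi Psihat w = c%:E}).

Let F := synthesis A B psi f.
Let S (e x : R) : R[i] := cintegral mu2 (strip e) (F x).
Let W (g : R -> R[i]) (z : R * R) : R[i] :=
  sawt A B psi g z.1 z.2 * (z.2^-1)%:C.
(** The second factor [zeta^-1] of the density goes to the wavelet, so that the integrand is the
    product [W f * w x] of two functions square integrable over [strip e]. *)
Let w (x : R) (z : R * R) : R[i] :=
  wavelet A B psi z.1 z.2 x * (z.2^-1)%:C.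

Let c0 : 0 <= c. Proof. exact: admissibility_cst_ge0 hc. Qed.

Let FE x z : F x z = W f z * w x z.
Proof.
rewrite /F /synthesis /W /w -exprVn expr2 rmorphM /=; ring.
Qed.

Let normcW g z : normc (W g z) ^+ 2 =
  normc (sawt A B psi g z.1 z.2) ^+ 2 * (z.2 ^+ 2)^-1.
Proof. by rewrite normc_mul exprMn normc_real real_normK ?num_real// exprVn. Qed.

Let parsevalW g : L2 g ->
  (\int[mu2]_(z in strip 0) (normc (W g z) ^+ 2)%:E = c%:E * sqnorm2 g)%E.
Proof.
move=> gL; rewrite -(sawt_parseval B0 pL hP hc gL).
by apply: eq_integral => z _; rewrite normcW.
Qed.

Let Woo g : L2 g -> (\int[mu2]_(z in strip 0) (normc (W g z) ^+ 2)%:E < +oo)%E.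
Proof.
by move=> gL; rewrite parsevalW// lte_mul_pinfty ?lee_fin//; exact: gL.2.
Qed.

Let minv2 : measurable_fun setT (fun z : R * R => z.2^-1).
Proof.
by apply: measurableT_comp measurable_snd; exact: measurable_invr.
Qed.

Let mW g : cmeasurable setT g -> cmeasurable setT (W g).
Proof.
move=> mg; apply: cmeasurableM; first exact: cmeasurable_sawt mg pL.1.
exact: cmeasurable_real.
Qed.

Let mw2 : cmeasurable setT (fun y : R * (R * R) => w y.1 y.2).
Proof.
apply: cmeasurableM; first exact: cmeasurable_wavelet pL.1.
by apply: cmeasurable_real; exact: (measurableT_comp minv2 measurable_snd).
Qed.

Let mw x : cmeasurable setT (w x).
Proof. exact: (cmeasurableT_comp mw2 (pair1_measurable x)). Qed.

Let strip0 (e : R) : 0 <= e -> strip e `<=` strip 0.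
Proof.
move=> e0 [t z] [_ /=]; rewrite in_itv/= andbT => ez; split => //=.
by rewrite in_itv/= andbT; exact: le_lt_trans ez.
Qed.

(** Its last factor bounds the integral of [zeta^-2] over [zeta > e]: since
    [zeta^-2 = (1 + zeta^-2) / (1 + zeta^2)], the integrand is at most [1 + e^-2] times the Poisson
    kernel, of mass [2 * pi]. *)
Let Kw (e : R) : R :=
  (2 * pi * `|B|)^-1 * fine (sqnorm2 psi) * ((1 + (e ^+ 2)^-1) * (2 * pi)).

(** Integrating over all [t] removes the translation by [x], so the bound is uniform in [x]. This is
    what makes [S e] bounded. *)
Let w_le x e : 0 < e ->
  (\int[mu2]_(z in strip e) (normc (w x z) ^+ 2)%:E <= (Kw e)%:E)%E.
Proof.
move=> e0; set V := fine (sqnorm2 psi).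
have V0 : 0 <= V by rewrite fine_ge0// sqnorm2_ge0.
have VE : sqnorm2 psi = V%:E.
  by rewrite fineK// ge0_fin_numE ?sqnorm2_ge0//; exact: pL.2.
have b0 : 0 <= (2 * pi * `|B|)^-1 :> R.
  by rewrite invr_ge0 !mulr_ge0// pi_ge0.
pose G (z : R * R) := ((\1_(strip e) z : R) * normc (w x z) ^+ 2)%:E.
have mG : measurable_fun setT G.
  apply/measurable_EFinP; apply: measurable_funM.
    by apply: measurable_indic; exact: measurable_strip.
  exact: measurable_normc_sqr.
have G0 z : (0 <= G z)%E by rewrite lee_fin mulr_ge0 ?sqr_ge0// indicE.
have -> : (\int[mu2]_(z in strip e) (normc (w x z) ^+ 2)%:E = \int[mu2]_z G z)%E.
  rewrite integral_mkcond; apply: eq_integral => z _; rewrite patchE /G indicE.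
  by case: ifPn => _; rewrite ?mul1r ?mul0r.
rewrite fubini_tonelli2//.
have p0 (s : R) : 0 <= 2 * (1 + s ^+ 2)^-1.
  by rewrite mulr_ge0// invr_ge0 addr_ge0// sqr_ge0.
have C0 : 0 <= (2 * pi * `|B|)^-1 * V * (1 + (e ^+ 2)^-1).
  by rewrite !mulr_ge0// addr_ge0// invr_ge0 sqr_ge0.
have mp : measurable_fun setT (fun s : R => 2 * (1 + s ^+ 2)^-1).
  by apply: continuous_measurable_fun; exact: continuous_poisson.
apply: (@le_trans _ _ (\int[mu]_zeta
    (((2 * pi * `|B|)^-1 * V * (1 + (e ^+ 2)^-1))%:E *
     (2 * (1 + zeta ^+ 2)^-1)%:E))%E); last first.
  rewrite ge0_integralZl//; last 2 first.
  - exact/measurable_EFinP.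
  - by move=> s _; rewrite lee_fin.
  by rewrite integral_poisson -EFinM lee_fin /Kw !mulrA.
apply: ge0_le_integral => //.
- by move=> zeta _; apply: integral_ge0.
- exact: (measurable_fun_fubini_tonelli_G (m1 := mu) G mG G0).
- by apply: measurable_funeM; exact/measurable_EFinP.
move=> zeta _; rewrite /fubini_G /G/=.
have [ez|ez] := ltP e zeta; last first.
  rewrite integral0_eq; last first.
    move=> t _; rewrite indicE memNset ?mul0r//= => -[_ /=].
    by rewrite in_itv/= andbT ltNge ez.
  by rewrite -EFinM lee_fin mulr_ge0.
have z0 : 0 < zeta by exact: lt_trans ez.
have zi0 : - zeta^-1 != 0 by rewrite oppr_eq0 invr_eq0 gt_eqF.
have pa := L2_affine (x / zeta) zi0 pL.
apply: (@le_trans _ _ (((2 * pi * `|B|)^-1 * (zeta ^+ 2)^-1 * V)%:E)); last first.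
  rewrite -EFinM lee_fin [leLHS]mulrAC -[leRHS]mulrA.
  apply: ler_wpM2l; first exact: mulr_ge0.
  have -> : (zeta ^+ 2)^-1 = (1 + (zeta ^+ 2)^-1) * (1 + zeta ^+ 2)^-1.
    by field; rewrite !gt_eqF// ltr_pwDl// sqr_ge0.
  have i1 : 0 <= (1 + zeta ^+ 2)^-1 by rewrite invr_ge0 addr_ge0// sqr_ge0.
  apply: ler_pM => //; first by rewrite addr_ge0// invr_ge0 sqr_ge0.
    by rewrite lerD2l lef_pV2 ?posrE ?exprn_gt0// ler_pXn2r ?nnegrE ?ltW.
  by rewrite ler_peMl// ler1n.
rewrite le_eqVlt; apply/orP; left; apply/eqP.
have wE t : ((\1_(strip e) (t, zeta) : R) * normc (w x (t, zeta)) ^+ 2) =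
    (2 * pi * `|B|)^-1 * zeta^-1 * (zeta ^+ 2)^-1 *
      normc (psi (- zeta^-1 * t + x / zeta)) ^+ 2.
  rewrite indicE mem_set ?mul1r; last by split => //=; rewrite in_itv/= andbT.
  rewrite /w normc_mul exprMn normc_real real_normK ?num_real//=.
  rewrite sqr_normc_wavelet// exprVn mulrAC; congr (_ * normc (psi _) ^+ 2).
  by ring.
under eq_integral do rewrite wE.
have k0 : 0 <= (2 * pi * `|B|)^-1 * zeta^-1 * (zeta ^+ 2)^-1.
  by apply: mulr_ge0; [apply: mulr_ge0 => //|]; rewrite invr_ge0 ?sqr_ge0// ltW.
rewrite (integralZl_sqr_normc mu measurableT pa.1 k0).
rewrite -/(sqnorm2 _) (sqnorm2_affine _ zi0 pL.1) VE -!EFinM; congr EFin.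
rewrite normrN normfV invrK (gtr0_norm z0).
move: ((2 * pi * `|B|)^-1) => b.
by field; rewrite gt_eqF.
Qed.

Let W_stripoo g e : L2 g -> 0 <= e ->
  (\int[mu2]_(z in strip e) (normc (W g z) ^+ 2)%:E < +oo)%E.
Proof.
move=> gL e0; apply: le_lt_trans (Woo gL).
apply: ge0_subset_integral; do ?exact: measurable_strip.
- apply/measurable_EFinP; apply: measurable_funTS.
  by apply: measurable_normc_sqr; exact: mW gL.1.
- by move=> z _; rewrite lee_fin sqr_ge0.
- exact: strip0.
Qed.

Let Fi e x : 0 < e -> cintegrable mu2 (strip e) (F x).
Proof.
move=> e0; have ms := measurable_strip e.
rewrite (funext (FE x)); apply: cintegrableM_sqr => //.
- exact/cmeasurableTS/mW/fL.1.
- exact: cmeasurableTS (mw x).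
- exact: W_stripoo (ltW e0).
- exact: le_lt_trans (w_le x e0) (ltry _).
Qed.

(** The bound of [integral_normcM_le] at weight 1, kept in its literal shape so that it applies
    directly. *)
Let KF (e : R) : R :=
  (1 * fine (\int[mu2]_(z in strip e) (normc (W f z) ^+ 2)%:E)%E + 1^-1 * Kw e) / 2.

Let F_le e x : 0 < e ->
  (\int[mu2]_(z in strip e) (normc (F x z))%:E <= (KF e)%:E)%E.
Proof.
move=> e0; have ms := measurable_strip e; under eq_integral do rewrite FE.
apply: integral_normcM_le => //.
- exact/cmeasurableTS/mW/fL.1.
- exact: cmeasurableTS (mw x).
- rewrite fineK// ge0_fin_numE; first exact: W_stripoo (ltW e0).
  by apply: integral_ge0 => z _; rewrite lee_fin sqr_ge0.
- exact: w_le.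
Qed.

Let S_le e x : 0 < e -> normc (S e x) <= KF e.
Proof.
move=> e0; rewrite -lee_fin; apply: le_trans (F_le x e0).
apply: le_normc_cintegral_lee; first exact: measurable_strip.
exact: cintegrable_measurable (Fi x e0).
Qed.

Let mF2 : cmeasurable setT (fun y : R * (R * R) => F y.1 y.2).
Proof.
under eq_fun do rewrite FE; apply: cmeasurableM => //.
exact: (cmeasurableT_comp (mW fL.1) measurable_snd).
Qed.

Let mF2e e : cmeasurable setT
  (fun y : R * (R * R) => (\1_(strip e) y.2 : R)%:C * F y.1 y.2).
Proof.
have m1 : measurable_fun setT (\1_(strip e) : R * R -> R).
  by apply: measurable_indic; exact: measurable_strip.
apply: cmeasurableM => //; apply: cmeasurable_real.
exact: (measurableT_comp m1 measurable_snd).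
Qed.

Let mS e : cmeasurable setT (S e).
Proof.
rewrite (_ : S e = fun x =>
  cintegral mu2 setT (fun z => (\1_(strip e) z : R)%:C * F x z)); last first.
  by apply/funext => x; exact: cintegral_mkcond.
exact: (cmeasurable_cintegral (@plane R) (mF2e e)).
Qed.

Let cmeas_indicS (e : R) : cmeasurable setT (fun z : R * R => (\1_(strip e) z : R)%:C).
Proof. by apply: cmeasurable_real; apply: measurable_indic; exact: measurable_strip. Qed.

Let cintegral_substrip (k : R * R -> R[i]) e : 0 <= e ->
  cintegral mu2 (strip e) k =
  cintegral mu2 (strip 0) (fun z => (\1_(strip e) z : R)%:C * k z).
Proof.
move=> e0; rewrite cintegral_mkcond [RHS]cintegral_mkcond.
apply: eq_cintegral => z _; rewrite !indicE.
have [ze|ze] := boolP (z \in strip e); last by rewrite !mul0r mulr0.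
by rewrite (mem_set (strip0 e0 (set_mem ze))) !mul1r.
Qed.

(** [S e] is the adjoint of the transform applied to [W f] cut to [strip e]. Fubini is justified by
    the bound [KF e], uniform in [x], together with the integrability of [g]. *)
Let duality e g : 0 < e -> L2 g -> cintegrable mu setT g ->
  cintegral mu setT (fun x => S e x * (g x)^J) =
  cintegral mu2 (strip e) (fun z => W f z * (W g z)^J).
Proof.
move=> e0 gL gi; have ms := measurable_strip e.
pose F3 (y : R * (R * R)) : R[i] :=
  (\1_(strip e) y.2 : R)%:C * F y.1 y.2 * (g y.1)^J.
have mF3 : cmeasurable setT F3.
  apply: cmeasurableM; first exact: mF2e.
  by apply: cmeasurableJ; exact: (cmeasurableT_comp gL.1 measurable_fst).
have mFx x : cmeasurable setT (fun z => (\1_(strip e) z : R)%:C * F x z).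
  exact: (cmeasurableT_comp (mF2e e) (pair1_measurable x)).
have normF x : (\int[@plane R]_z (normc ((\1_(strip e) z : R)%:C * F x z))%:E <=
    (KF e)%:E)%E.
  apply: le_trans (F_le x e0); rewrite le_eqVlt; apply/orP; left; apply/eqP.
  rewrite [RHS]integral_mkcond; apply: eq_integral => z _.
  rewrite patchE indicE; case: ifPn => _; first by rewrite mul1r.
  by rewrite mul0r Normc.normc0.
have KF0 : 0 <= KF e.
  rewrite -lee_fin (le_trans _ (normF 0))// integral_ge0// => z _.
  by rewrite lee_fin normc_ge0.
have iF3 : cintegrable (mu \x @plane R)%E setT F3.
  apply: cintegrable_prodP => //.
  apply: (@le_lt_trans _ _ (\int[mu]_x ((KF e)%:E * (normc (g x))%:E))%E).
    apply: ge0_le_integral => //.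
    - by move=> x _; apply: integral_ge0 => z _; rewrite lee_fin normc_ge0.
    - apply: (measurable_fun_fubini_tonelli_F (m2 := @plane R)
        (fun y => (normc (F3 y))%:E)).
        by apply/measurable_EFinP; exact: measurable_normc mF3.
      by move=> y; rewrite lee_fin normc_ge0.
    - apply: measurable_funeM; apply/measurable_EFinP.
      exact: measurable_normc gL.1.
    - move=> x _; rewrite /F3 /=.
      under eq_integral do rewrite normc_mul normc_conj mulrC EFinM.
      rewrite ge0_integralZl//.
      + by rewrite muleC; apply: lee_wpmul2r; rewrite ?lee_fin ?normc_ge0.
      + by apply/measurable_EFinP; exact: measurable_normc (mFx x).
      + by move=> z _; rewrite lee_fin normc_ge0.
      + by rewrite lee_fin normc_ge0.
  rewrite ge0_integralZl//.
  - rewrite lte_mul_pinfty ?lee_fin//.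
    exact: ((cintegrableP mu g measurableT).1 gi).2.
  - apply/measurable_EFinP; exact: measurable_normc gL.1.
  - by move=> x _; rewrite lee_fin normc_ge0.
transitivity (cintegral mu setT (fun x =>
    cintegral (@plane R) setT (fun z => F3 (x, z)))).
  apply: eq_cintegral => x _; rewrite /F3 /S cintegral_mkcond mulrC -cintegralZ//.
    by apply: eq_cintegral => z _; exact: mulrC.
  exact: ((cintegrable_mkcond mu2 (F x) ms).1 (Fi x e0)).
rewrite (cFubini iF3) [RHS]cintegral_mkcond.
apply: eq_cintegral => -[t z] _.
have F3E x : F3 (x, (t, z)) =
  (\1_(strip e) (t, z) : R)%:C * F x (t, z) * (g x)^J by [].
under eq_cintegral do rewrite F3E.
rewrite indicE.
case: (boolP ((t, z) \in strip e)) => [|_]; last first.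
  rewrite /cintegral; apply/eqP; rewrite eq_complex.
  under eq_Rintegral do rewrite !mul0r.
  under [X in _ && (X == _)]eq_Rintegral do rewrite !mul0r.
  by rewrite !mul0r /= /Rintegral !integral0 eqxx.
move=> /set_mem[_ ez]; rewrite /= in_itv/= andbT in ez; rewrite mul1r.
have z0 : 0 < z by exact: lt_trans ez.
have gwi := cintegrable_sawt A B pL t z0 gL.
transitivity (cintegral mu setT (fun x => W f (t, z) * (z^-1)%:C *
    (g x * (wavelet A B psi t z x)^J)^J)).
  apply: eq_cintegral => x _; rewrite mul1r FE /w /= conjc_mul conjcK; ring.
rewrite cintegralZ//; last exact: cintegrableJ.
rewrite cintegralJ//.
have -> : W g (t, z) = sawt A B psi g t z * (z^-1)%:C by [].
have -> : cintegral mu setT (fun x => g x * (wavelet A B psi t z x)^J) =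
  sawt A B psi g t z by [].
rewrite conjc_mul conjc_real; ring.
Qed.

Let fine_sqnorm2 g : L2 g -> sqnorm2 g = (\int[mu]_x (normc (g x) ^+ 2))%:E.
Proof.
move=> gL; rewrite /Rintegral fineK// ge0_fin_numE ?sqnorm2_ge0//.
exact: gL.2.
Qed.

Let Re_parseval g : L2 g ->
  complex.Re (cintegral mu2 (strip 0) (fun z => W f z * (W g z)^J)) =
  c * complex.Re (cintegral mu setT (fun x => f x * (g x)^J)).
Proof.
move=> gL; have ms := measurable_strip (0 : R).
have h1 : (\int[mu2]_(z in strip 0) (normc (W f z + W g z) ^+ 2)%:E =
   (\int[mu2]_(z in strip 0) (normc (W f z) ^+ 2) +
    \int[mu2]_(z in strip 0) (normc (W g z) ^+ 2) + 2 * complex.Re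
      (cintegral mu2 (strip 0) (fun z => W f z * (W g z)^J)))%:E)%E.
  apply: polarization => //; do ?exact: Woo.
    exact: cmeasurableTS (mW fL.1).
  exact: cmeasurableTS (mW gL.1).
have h2 := polarization (mu := mu) measurableT fL.1 gL.1 fL.2 gL.2.
have fgL := L2D fL gL.
have hW : (\int[mu2]_(z in strip 0) (normc (W f z + W g z) ^+ 2)%:E =
    c%:E * sqnorm2 (fun x => (f x + g x)%R))%E.
  rewrite -parsevalW//; apply: eq_integral => -[t z] /set_mem[_ z0].
  rewrite /= in_itv/= andbT in z0.
  by congr ((normc _ ^+ 2)%:E); rewrite /W sawtD// mulrDl.
rewrite /sqnorm2 h2 in hW; rewrite hW -EFinM in h1.
have Rp h : L2 h -> \int[mu2]_(z in strip 0) (normc (W h z) ^+ 2) =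
    c * \int[mu]_x (normc (h x) ^+ 2).
  move=> hL; apply: EFin_inj; rewrite EFinM -fine_sqnorm2// -parsevalW//.
  rewrite /Rintegral fineK// ge0_fin_numE; first exact: Woo.
  by apply: integral_ge0 => z _; rewrite lee_fin sqr_ge0.
have := EFin_inj h1; rewrite !Rp// !mulrDr => /addrI h3.
have two0 : 2 != 0 :> R by rewrite pnatr_eq0.
by apply: (mulfI two0); rewrite -h3 mulrCA.
Qed.

(** On the half-plane this is [W f] cut to scales [zeta <= e]. The form of a difference mirrors
    [c f - S e] under [duality]; [T e] is the corresponding energy. *)
Let low (e : R) (z : R * R) : R[i] := W f z - (\1_(strip e) z : R)%:C * W f z.
Let T (e : R) : \bar R := (\int[mu2]_(z in strip 0) (normc (low e z) ^+ 2)%:E)%E.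

Let mlow e : cmeasurable setT (low e).
Proof.
have mWf := mW fL.1; apply: cmeasurableB => //; apply: cmeasurableM => //.
Qed.

Let lowE e z : low e z = if z \in strip e then 0 else W f z.
Proof.
rewrite /low indicE; case: (z \in strip e); first by rewrite mul1r subrr.
by rewrite mul0r subr0.
Qed.

Let low_le e z : normc (low e z) ^+ 2 <= normc (W f z) ^+ 2.
Proof.
by rewrite lowE; case: ifPn => // _; rewrite Normc.normc0 expr0n sqr_ge0.
Qed.

Let T_ge0 e : (0 <= T e)%E.
Proof. by apply: integral_ge0 => z _; rewrite lee_fin sqr_ge0. Qed.

Let T_le e : (T e <= c%:E * sqnorm2 f)%E.
Proof.
rewrite -parsevalW//; apply: ge0_le_integral => //.
- exact: measurable_strip.
- by move=> z _; rewrite lee_fin sqr_ge0.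
- apply/measurable_EFinP; apply: measurable_funTS.
  exact: measurable_normc_sqr (mlow e).
- apply/measurable_EFinP; apply: measurable_funTS.
  exact: measurable_normc_sqr (mW fL.1).
- by move=> z _; rewrite lee_fin.
Qed.

Let T_fin e : T e \is a fin_num.
Proof.
rewrite ge0_fin_numE// (le_lt_trans (T_le e))// -parsevalW//.
exact: Woo.
Qed.

(** Monotonicity carries the limit along [1 / (n + 1)] over to all [e] tending to 0 from the
    right. *)
Let T_nd e e' : e <= e' -> (T e <= T e')%E.
Proof.
move=> ee; apply: ge0_le_integral => //.
- exact: measurable_strip.
- by move=> z _; rewrite lee_fin sqr_ge0.
- apply/measurable_EFinP; apply: measurable_funTS.
  exact: measurable_normc_sqr (mlow e).
- apply/measurable_EFinP; apply: measurable_funTS.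
  exact: measurable_normc_sqr (mlow e').
- move=> z _; rewrite lee_fin !lowE.
  have [ze|ze] := boolP (z \in strip e).
    by rewrite Normc.normc0 expr0n sqr_ge0.
  rewrite ifN//; apply: contra ze; rewrite !inE => -[_ /=].
  rewrite in_itv/= andbT => ez; split => //=.
  by rewrite in_itv/= andbT; exact: le_lt_trans ez.
Qed.

Let T_cvg0 : T n.+1%:R^-1 @[n --> \oo] --> 0%E.
Proof.
have ms := measurable_strip (0 : R).
have [] := @dominated_convergence _ _ _ mu2 (strip 0) ms
  (fun n z => (normc (low n.+1%:R^-1 z) ^+ 2)%:E) (fun=> 0%E)
  (fun z => (normc (W f z) ^+ 2)%:E).
- move=> n; apply/measurable_EFinP; apply: measurable_funTS.
  exact: measurable_normc_sqr (mlow _).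
- exact: measurable_cst.
- apply: aeW => -[t z] [_ z0]; rewrite /= in_itv/= andbT in z0.
  apply: cvg_near_cst; near=> n.
  rewrite lowE ifT ?Normc.normc0 ?expr0n//.
  rewrite inE; split => //=; rewrite in_itv/= andbT.
  by near: n; exact: near_infty_natSinv_lt (PosNum z0).
- apply/integrableP; split.
    apply/measurable_EFinP; apply: measurable_funTS.
    exact: measurable_normc_sqr (mW fL.1).
  apply: le_lt_trans (Woo fL); rewrite le_eqVlt; apply/orP; left; apply/eqP.
  by apply: eq_integral; move=> z _; rewrite gee0_abs// lee_fin sqr_ge0.
- apply: aeW => z n _.
  by rewrite gee0_abs; rewrite lee_fin; [exact: low_le|exact: sqr_ge0].
by move=> _ _; rewrite integral0.
Unshelve. all: by end_near. Qed.

Let r (e x : R) : R[i] := c%:C * f x - S e x.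

Let mr e : cmeasurable setT (r e).
Proof. by apply: cmeasurableB; [exact: cmeasurableZ fL.1|exact: mS]. Qed.

Let indic_le1 (a b x : R) : normc ((\1_(`[a, b]%classic : set R) x : R)%:C) <= 1.
Proof. by rewrite normc_real indicE; case: (_ \in _); rewrite ?normr1 ?normr0. Qed.

(** Let [N] be the squared norm of the truncated residual [g]. Then [N] is the real part of the
    pairing of [r e] with [g], which [Re_parseval] and [duality] turn into that of [low e] with
    [W g]. Cauchy-Schwarz and the Parseval formula for [g] give [N ^+ 2 <= T e * (c * N)], and one
    factor [N] cancels. *)
Let trunc_le e n : 0 < e ->
  (\int[mu]_x (normc ((\1_(`[- n%:R, n%:R]%classic : set R) x : R)%:C * r e x)
     ^+ 2)%:E <= c%:E * T e)%E.
Proof.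
move=> e0; have se := measurable_strip e; have s0 := measurable_strip (0 : R).
pose i (x : R) : R[i] := (\1_(`[- n%:R, n%:R]%classic : set R) x : R)%:C.
have iL : L2 i := L2_indic _ _.
pose g x := i x * r e x.
have gE x : g x = i x * (c%:C * f x) - i x * S e x by rewrite /g /r mulrBr.
have g1 : L2 (fun x => i x * (c%:C * f x)).
  under eq_fun do rewrite mulrC.
  by apply: (L2M_bounded (M := 1)); [exact: L2Z|exact: iL.1|exact: indic_le1].
have g2 : L2 (fun x => i x * S e x).
  by apply: (L2M_bounded (M := KF e)) => // x; exact: S_le.
have gL : L2 g by rewrite (funext gE); exact: L2B.
have gi : cintegrable mu setT g.
  (* The indicator is idempotent, so [g] is a product of two L^2 functions, hence integrable. *)
  have -> : g = fun x => i x * g x.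
    apply/funext => x; rewrite /g mulrA; congr (_ * _).
    by rewrite /i indicE; case: (_ \in _); rewrite ?mul1r ?mul0r.
  exact: cintegrableM_L2.
have fgi : cintegrable mu setT (fun x => f x * (g x)^J).
  by apply: cintegrableM_L2 => //; exact: L2J.
have Sgi : cintegrable mu setT (fun x => S e x * (g x)^J).
  under eq_fun do rewrite mulrC.
  apply: (cintegrableM_bounded (M := KF e)) => //.
  - exact: cintegrableJ.
  - exact: mS.
  - by move=> x _; exact: S_le.
set N := \int[mu]_x (normc (g x) ^+ 2).
have NE : (\int[mu]_x (normc (g x) ^+ 2)%:E = N%:E)%E by exact: fine_sqnorm2.
suff : (N%:E <= c%:E * T e)%E by rewrite -NE.
have N1 : N = complex.Re (cintegral mu setT (fun x => r e x * (g x)^J)).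
  have -> : cintegral mu setT (fun x => r e x * (g x)^J) =
      cintegral mu setT (fun x => (normc (g x) ^+ 2)%:C).
    apply: eq_cintegral => x _; rewrite -mulcJ /g conjc_mul conjc_real.
    rewrite /i indicE; case: (_ \in _); first by rewrite !mul1r.
    by rewrite !mul0r mulr0.
  by rewrite cintegral_real.
have N2 : N = complex.Re (cintegral mu2 (strip 0) (fun z => low e z * (W g z)^J)).
  rewrite N1.
  have -> : cintegral mu setT (fun x => r e x * (g x)^J) =
      c%:C * cintegral mu setT (fun x => f x * (g x)^J) -
      cintegral mu setT (fun x => S e x * (g x)^J).
    rewrite -cintegralZ// -cintegralB//; last exact: cintegrableZ.
    by apply: eq_cintegral => x _; rewrite /r mulrBl mulrA.
  have ReZ (k : R) (z : R[i]) : complex.Re (k%:C * z) = k * complex.Re z.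
    by case: z => ? ?; rewrite /= mul0r subr0.
  have ReB (u v : R[i]) : complex.Re (u - v) = complex.Re u - complex.Re v.
    by case: u v => ? ? [? ?].
  rewrite duality// ReB ReZ -Re_parseval//.
  have WWi : cintegrable mu2 (strip 0) (fun z => W f z * (W g z)^J).
    apply: cintegrableM_sqr => //.
    - exact: cmeasurableTS (mW fL.1).
    - by apply: cmeasurableJ; exact: cmeasurableTS (mW gL.1).
    - exact: Woo.
    - by under eq_integral do rewrite normc_conj; exact: Woo.
  rewrite (cintegral_substrip _ (ltW e0)).
  rewrite -ReB -cintegralB//.
    by congr (complex.Re _); apply: eq_cintegral => z _; rewrite /low mulrBl mulrA.
  under eq_fun do rewrite mulrC.
  apply: (cintegrableM_bounded (M := 1)) => //; first exact: cmeasurableTS (cmeas_indicS e).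
  move=> z _; rewrite normc_real indicE.
  by case: (_ \in _); rewrite ?normr1 ?normr0.
have N0 : 0 <= N by rewrite -lee_fin -NE; exact: sqnorm2_ge0.
set t := fine (T e); have tE : T e = t%:E by rewrite /t fineK.
have t0 : 0 <= t by rewrite -lee_fin -tE.
have cN0 : 0 <= c * N by rewrite mulr_ge0.
have CS : N ^+ 2 <= t * (c * N).
  rewrite [X in X ^+ 2 <= _]N2.
  have mlow0 : cmeasurable (strip 0) (low e) := cmeasurableTS _ (mlow e).
  apply: le_trans (_ : normc (cintegral mu2 (strip 0)
    (fun z => low e z * (W g z)^J)) ^+ 2 <= _).
    rewrite -real_normK ?num_real// ler_pXn2r ?nnegrE ?normc_ge0//.
    exact: normr_Re_le.
  apply: cauchy_schwarz => //.
  - by apply: cmeasurableJ; exact: cmeasurableTS (mW gL.1).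
  - by rewrite -tE.
  - by under eq_integral do rewrite normc_conj; rewrite parsevalW// EFinM -NE.
rewrite tE -EFinM lee_fin; have [->|Nn0] := eqVneq N 0; first by rewrite mulr_ge0.
have Ngt0 : 0 < N by rewrite lt_def Nn0.
by move: CS; rewrite expr2 mulrCA mulrA ler_pM2r.
Qed.

(** The bound on the truncations does not depend on [n], so Fatou's lemma removes the cut. *)
Let residual_le e : 0 < e -> (sqnorm2 (r e) <= c%:E * T e)%E.
Proof.
move=> e0; apply: (@fatou_cvg_le _ _ _ mu setT (fun n x =>
    normc ((\1_(`[- n%:R, n%:R]%classic : set R) x : R)%:C * r e x) ^+ 2)) => //.
- move=> n; apply: measurable_normc_sqr.
  by apply: cmeasurableM; [exact: (L2_indic _ _).1|exact: mr].
- by move=> n x _; exact: sqr_ge0.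
- move=> x _; apply: cvg_near_cst; near=> n.
  rewrite indicE mem_set ?mul1r//= in_itv/= -ler_norml.
  by near: n; exact: nbhs_infty_ger.
- by near=> n; exact: trunc_le.
Unshelve. all: by end_near. Qed.

Lemma L2_inversion : is_L2_integral F (fun x => c%:C * f x).
Proof.
split.
- exact: L2Z.
- move=> e e0; split=> [x|]; first exact: Fi.
  have rL : L2 (r e).
    split; first exact: mr.
    apply: le_lt_trans (residual_le e0) _.
    by rewrite lte_mul_pinfty ?lee_fin// -ge0_fin_numE.
  (* Square integrability of the synthesis integral is inherited from that of the residual. *)
  have -> : (fun x => cintegral mu2 (strip e) (F x)) = (fun x => c%:C * f x - r e x).
    by apply/funext => x; rewrite /r subKr.
  by apply: L2B => //; exact: L2Z.
- have T0 : (c%:E * T n.+1%:R^-1)%E @[n --> \oo] --> 0%E.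
    by rewrite -[X in _ --> X](mule0 c%:E); exact: cvgeZl.
  have fin e : 0 < e -> sqnorm2 (r e) \is a fin_num.
    move=> e0; rewrite ge0_fin_numE ?sqnorm2_ge0//.
    apply: le_lt_trans (residual_le e0) _.
    by rewrite lte_mul_pinfty ?lee_fin// -ge0_fin_numE.
  apply/fine_cvgP; split.
    near=> e; apply: fin; by near: e; exact: nbhs_right_gt.
  apply/cvgrPdist_le => /= k k0.
  have [n hn] : exists n, (c%:E * T n.+1%:R^-1 <= k%:E)%E.
    move/fine_cvgP : T0 => [Tfin /cvgrPdist_le/(_ _ k0) h].
    near \oo => n; exists n; rewrite -[leLHS]fineK; last by near: n.
    rewrite lee_fin (le_trans (ler_norm _))// -normrN -[X in `|X|]add0r.
    by near: n.
  near=> e.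
  have e0 : 0 < e by near: e; exact: nbhs_right_gt.
  have en : e <= n.+1%:R^-1 by near: e; apply: nbhs_right_le; rewrite invr_gt0.
  rewrite sub0r normrN ger0_norm ?fine_ge0 ?sqnorm2_ge0//.
  rewrite -lee_fin fineK; last exact: fin.
  apply: le_trans (residual_le e0) _; apply: le_trans hn.
  by apply: lee_wpmul2l; [rewrite lee_fin|exact: T_nd].
Unshelve. all: by end_near. Qed.

(** Residuals tend to 0 in L^2, so by Fatou the pointwise lower limit [l] of their squares has
    integral 0 and vanishes almost everywhere. Where the integrand is integrable over the
    half-plane, dominated convergence makes the residuals converge, and [l] identifies their limit
    as 0. *)
Lemma ae_inversion : {ae mu, forall x, cintegrable mu2 (strip 0) (F x) ->
  c%:C * f x = cintegral mu2 (strip 0) (F x)}.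
Proof.
pose e n : R := n.+1%:R^-1.
have e0 n : 0 < e n by rewrite invr_gt0.
pose l x := limn_einf (fun n => (normc (r (e n) x) ^+ 2)%:E).
have r0 n x : (0 <= (normc (r (e n) x) ^+ 2)%:E)%E by rewrite lee_fin sqr_ge0.
have mrn n : measurable_fun setT (fun x => (normc (r (e n) x) ^+ 2)%:E).
  by apply/measurable_EFinP; exact: measurable_normc_sqr (mr _).
have l0 x : (0 <= l x)%E.
  rewrite /l limn_einf_lim; apply: lime_ge; [exact: is_cvg_einfs|apply: nearW => n].
  by apply: le_ereal_inf_tmp => _ [m /= nm <-].
have ml : measurable_fun setT l.
  apply: (emeasurable_fun_cvg
    (fun n x => einfs (fun n => (normc (r (e n) x) ^+ 2)%:E) n)).
    by move=> n; exact: measurable_fun_einfs.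
  by move=> x _; rewrite /l limn_einf_lim; exact: is_cvg_einfs.
have lint : (\int[mu]_x l x = 0)%E.
  apply/eqP; rewrite eq_le integral_ge0// andbT.
  have lim : sqnorm2 (r (e n)) @[n --> \oo] --> 0%E.
    apply: (@squeeze_cvge _ _ _ _ (fun=> 0%E) _ (fun n => c%:E * T (e n))%E).
    - by apply: nearW => n; rewrite sqnorm2_ge0 residual_le.
    - exact: cvg_cst.
    - by rewrite -[X in _ --> X](mule0 c%:E); exact: cvgeZl.
  have <- := (cvg_limn_einf_sup lim).1.
  exact: (fatou mu measurableT mrn (fun n x _ => r0 n x)).
have lae : ae_eq mu setT l (cst 0%E).
  apply/ae_eq_integral_abs => //.
  by rewrite -[RHS]lint; apply: eq_integral => x _; rewrite gee0_abs.
apply: ae_lebesgueS lae => x /(_ I) /= lx0 Fxi.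
have ms := measurable_strip (0 : R).
have Slim : normc (S (e n) x - S 0 x) @[n --> \oo] --> 0.
  rewrite /S; under eq_fun do rewrite cintegral_substrip ?invr_ge0//.
  have mFx := cintegrable_measurable Fxi.
  apply: (@cintegral_dominated _ _ _ mu2 (strip 0) _ _
    (fun z => normc (F x z))) => //.
  - move=> n; apply: cmeasurableM => //; exact: cmeasurableTS (cmeas_indicS _).
  - move=> -[t z] [_ z0]; rewrite /= in_itv/= andbT in z0.
    apply: cvg_near_cst; near=> n.
    rewrite indicE mem_set ?mul1r ?subrr ?Normc.normc0//.
    split => //=; rewrite in_itv/= andbT.
    by near: n; exact: near_infty_natSinv_lt (PosNum z0).
  - exact: cintegrable_normc Fxi.
  - move=> n z _; rewrite normc_mul -[leRHS]mul1r ler_wpM2r ?normc_ge0//.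
    by rewrite normc_real indicE; case: (_ \in _); rewrite ?normr1 ?normr0.
have rlim : normc (r (e n) x) ^+ 2 @[n --> \oo] --> normc (c%:C * f x - S 0 x) ^+ 2.
  under eq_fun do rewrite /r normc_distC.
  rewrite normc_distC.
  exact: cvg_normc_sqrB Slim.
have lE : l x = (normc (c%:C * f x - S 0 x) ^+ 2)%:E.
  apply: (cvg_limn_einf_sup _).1; apply: cvg_EFin => //; by near=> n.
have : normc (c%:C * f x - S 0 x) = 0.
  by apply/eqP; rewrite -sqrf_eq0; apply/eqP/EFin_inj; rewrite -lE.
by move/Normc.eq0_normc/subr0_eq.
Unshelve. all: by end_near. Qed.

End reconstruction.

Theorem theorem3p4 (R : realType) (A B C D p q : R)
  (hdet : A * D - B * C = 1) (hB : B != 0)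
  (f psi : R -> R[i]) (hf : L2 f) (hpsi : L2 psi)
  (Psihat : R -> R -> R[i])
  (hPsihat : is_bigpsi_saft A B D p q psi Psihat)
  (hadm : admissible Psihat)
  (c : R) (hc0 : c != 0)
  (hc : {ae @lebesgue_measure R, forall w, Cpsi Psihat w = c%:E}) :
  exists I : R -> R[i],
    [/\ is_L2_integral (synthesis A B psi f) I,
        {ae @lebesgue_measure R, forall x, f x = (c^-1)%:C * I x}
      & {ae @lebesgue_measure R, forall x,
          cintegrable (lebesgue_measure \x lebesgue_measure)%E
            (strip 0) (synthesis A B psi f x) ->
          f x = (c^-1)%:C *
            cintegral (lebesgue_measure \x lebesgue_measure)%E
              (strip 0) (synthesis A B psi f x)}].
Proof.
(* The L^2 value of the integral is [c f] itself; the pointwise integral over the half-plane may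
   diverge. *)
exists (fun x => c%:C * f x); split.
- exact: L2_inversion hPsihat hc.
- by apply: aeW => x; rewrite mulrA -rmorphM/= mulVf// mul1r.
- apply: ae_lebesgueS (ae_inversion hB hf hpsi hPsihat hc) => x fx Fxi.
  by rewrite -fx// mulrA -rmorphM/= mulVf// mul1r.
Qed.
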